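(* Let $p_+$ and $p_-$ be compatible parameter sets, and let $\alpha_+,\alpha_-$ be real numbers with $R(p_+)<\alpha_+<R(p_-)^{-1}$ and $R(p_-)<\alpha_-<R(p_+)^{-1}$. Let $L(\alpha_+,\alpha_-)=\lambda_1(p_+,p_-;\alpha_+,\alpha_-)$ be the length of the longest increasing subsequence of the random multiset $M(p_+,p_-;\alpha_+,\alpha_-)$. Then $$\mathbf{E}\left((\alpha_+\alpha_-)^{-L(\alpha_+,\alpha_-)}\right)=E(\alpha_+;p_-)^{-1}\,E(\alpha_-;p_+)^{-1}\,E(\alpha_+^{-1};p_+)\,E(\alpha_-^{-1};p_-).$$
   Context: A parameter set is a triple $p=(t,q,r)$, where $t\ge 0$ is real and $q=(q_i)_{i\ge1}$, $r=(r_i)_{i\ge1}$ are sequences of nonnegative reals with $\sum_i q_i+\sum_i r_i<\infty$. Put $Q(p)=\sup_i q_i$, $R(p)=\sup_i r_i$ (with $0^{-1}=+\infty$), and for $|z|<R(p)^{-1}$ put $$E(z;p)=e^{tz}\prod_i (1+zq_i)(1-zr_i)^{-1}.$$ Parameter sets $p_+=(t^+,q^+,r^+)$ and $p_-=(t^-,q^-,r^-)$ are compatible if $Q(p_+)Q(p_-)<1$ and $R(p_+)R(p_-)<1$. Random variables: $P(s)$ is Poisson of mean $s$; $g(s)$ is geometric of parameter $s$, i.e. $\Pr(g(s)=k)=(1-s)s^k$ for $k\ge0$; $b(s)$ equals $1$ with probability $\frac{s}{1+s}$ and $0$ with probability $\frac1{1+s}$. Let $(\mathbb{Z}^+)'=\{1',2',\dots\}$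 be a disjoint copy of $\mathbb{Z}^+=\{1,2,\dots\}$, and $\Omega=[0,1]\uplus\mathbb{Z}^+\uplus(\mathbb{Z}^+)'$. The random multiset $M(p_+,p_-)$ in $\Omega\times\Omega$ is obtained as follows, with all choices independent: - on $[0,1]\times[0,1]$: $P(t^+t^-)$ i.i.d. uniform points; - on $[0,1]\times\{i\}$: $P(t^+q^-_i)$ i.i.d. uniform points; on $[0,1]\times\{i'\}$: $P(t^+r^-_i)$ i.i.d. uniform points; on $\{i\}\times[0,1]$: $P(q^+_it^-)$ i.i.d. uniform points; on $\{i'\}\times[0,1]$: $P(r^+_it^-)$ i.i.d. uniform points; - the point $(i,j)$ has multiplicity $g(q^+_iq^-_j)$; $(i,j')$ has multiplicity $b(q^+_ir^-_j)$; $(i',j)$ has multiplicity $b(r^+_iq^-_j)$; $(i',j')$ has multiplicity $g(r^+_ir^-_j)$. Extended model: let $\Omega^+=\Omega\uplus\{\Sigma\}$. For $\alpha_+,\alpha_-\ge0$ with $\alpha_+R(p_-)<1$ and $\alpha_-R(p_+)<1$, the random multiset $M(p_+,p_-;\alpha_+,\alpha_-)$ in $\Omega^+\times\Omega^+$ consists of $M(p_+,p_-)$ on $\Omega\times\Omega$ together with, independently: - on $[0,1]\times\{\Sigma\}$: $P(\alpha_-t^+)$ i.i.d. uniform points; $(i,\Sigma)$ has multiplicity $b(\alpha_-q^+_i)$; $(i',\Sigma)$ has multiplicity $g(\alpha_-r^+_i)$; - on $\{\Sigma\}\times[0,1]$: $P(\alpha_+t^-)$ i.i.d. uniform points; $(\Sigma,i)$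 has multiplicity $b(\alpha_+q^-_i)$; $(\Sigma,i')$ has multiplicity $g(\alpha_+r^-_i)$; - $(\Sigma,\Sigma)$ has multiplicity $0$. Fix two total orderings $\le_+$ and $\le_-$ on $\Omega$, each restricting to the usual order on $[0,1]$, and extend them to $\Omega^+$ by making $\Sigma$ the smallest element in both. (The orderings are otherwise arbitrary; the distributions considered do not depend on them.) A subsequence of a multiset $M$ is a finite sequence of points $(x_k,y_k)$ of $M$ in which no point occurs more often than its multiplicity in $M$. It is increasing if for all $k$ one has $x_k\le_+x_{k+1}$ and $y_k\le_-y_{k+1}$, and moreover $x_k=x_{k+1}$ implies $x_k\notin\mathbb{Z}^+$, and $y_k=y_{k+1}$ implies $y_k\notin\mathbb{Z}^+$ (so equality is allowed in $[0,1]$, in $(\mathbb{Z}^+)'$ and at $\Sigma$). Its length is its number of terms. $\lambda_1(p_+,p_-;\alpha_+,\alpha_-)$ denotes the maximal length of an increasing subsequence of $M(p_+,p_-;\alpha_+,\alpha_-)$; it is finite with probability 1. *)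

(* Defs.v *)
From HB Require Import structures.
From mathcomp Require Import all_boot all_order all_algebra.
From mathcomp Require Import all_classical all_reals all_analysis.
Set Implicit Arguments.
Unset Strict Implicit.
Unset Printing Implicit Defensive.
Import Order.TTheory GRing.Theory Num.Theory.
Import numFieldNormedType.Exports.
Local Open Scope classical_set_scope.
Local Open Scope ring_scope.

(* Sequences indexed by the positive integers are represented as functions on
   nat, the entry of index i+1 being stored at i; likewise, [Dot i] and
   [Prime i] below stand for i+1 and (i+1)'. *)

Record parameter_set (R : realType) := ParameterSet {
  par_t : R;
  par_q : nat -> R;
  par_r : nat -> R;
  par_t_ge0 : 0 <= par_t;
  par_q_ge0 : forall i, 0 <= par_q i;
  par_r_ge0 : forall i, 0 <= par_r i;
  par_summable : (\sum_(0 <= i <oo) (par_q i)%:E +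
                  \sum_(0 <= i <oo) (par_r i)%:E < +oo)%E }.

Definition par_Q (R : realType) (p : parameter_set R) : R :=
  sup (range (par_q p)).

Definition par_R (R : realType) (p : parameter_set R) : R :=
  sup (range (par_r p)).

(* Only meaningful for `|z| < (par_R p)^-1; outside of this domain the value
   is irrelevant. *)
Definition par_E (R : realType) (z : R) (p : parameter_set R) : R :=
  expR (par_t p * z) *
  limn (fun n => \prod_(i < n) ((1 + z * par_q p i) / (1 - z * par_r p i))).

Definition compatible (R : realType) (pp pm : parameter_set R) : Prop :=
  par_Q pp * par_Q pm < 1 /\ par_R pp * par_R pm < 1.

(* The library's [poisson_pmf] cannot be used here: it is constantly 1 when the
   rate is 0, whereas with 0 ^+ 0 = 1 the formula below gives a unit mass
   at 0. *)
Definition pmf_P (R : realType) (s : R) (k : nat) : R :=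
  expR (- s) * s ^+ k / k`!%:R.

Definition pmf_g (R : realType) (s : R) (k : nat) : R := (1 - s) * s ^+ k.

Definition pmf_b (R : realType) (s : R) (k : nat) : R :=
  match k with
  | 0%N => 1 / (1 + s)
  | 1%N => s / (1 + s)
  | _ => 0
  end.

Inductive Omega (R : realType) :=
| Seg of {i01 R}
| Dot of nat
| Prime of nat.
Arguments Dot {R}.
Arguments Prime {R}.

HB.instance Definition _ (R : realType) := gen_eqMixin (Omega R).
HB.instance Definition _ (R : realType) := gen_choiceMixin (Omega R).

(* [None] is the additional letter Sigma. *)
Definition Omegap (R : realType) := option (Omega R).

(* The extended alphabet is cut into the segment [0,1] and singletons; the
   random multiset is described separately on each product of two blocks. *)
Inductive block := BSeg | BDot of nat | BPrime of nat | BSigma.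

Definition block_of (R : realType) (x : Omegap R) : block :=
  match x with
  | Some (Seg _) => BSeg
  | Some (Dot i) => BDot i
  | Some (Prime i) => BPrime i
  | None => BSigma
  end.

(* The element of block [a] with coordinate [u], which only matters if [a] is
   the segment. *)
Definition place (R : realType) (a : block) (u : {i01 R}) : Omegap R :=
  match a with
  | BSeg => Some (Seg u)
  | BDot i => Some (Dot i)
  | BPrime i => Some (Prime i)
  | BSigma => None
  end.

(* Law of the number of points, counted with multiplicity, in the product of
   the blocks [a] and [b]. *)
Definition count_pmf (R : realType) (pp pm : parameter_set R) (ap am : R)
    (a b : block) : nat -> R :=
  match a, b with
  | BSeg, BSeg => pmf_P (par_t pp * par_t pm)
  | BSeg, BDot i => pmf_P (par_t pp * par_q pm i)
  | BSeg, BPrime i => pmf_P (par_t pp * par_r pm i)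
  | BDot i, BSeg => pmf_P (par_q pp i * par_t pm)
  | BPrime i, BSeg => pmf_P (par_r pp i * par_t pm)
  | BDot i, BDot j => pmf_g (par_q pp i * par_q pm j)
  | BDot i, BPrime j => pmf_b (par_q pp i * par_r pm j)
  | BPrime i, BDot j => pmf_b (par_r pp i * par_q pm j)
  | BPrime i, BPrime j => pmf_g (par_r pp i * par_r pm j)
  | BSeg, BSigma => pmf_P (am * par_t pp)
  | BDot i, BSigma => pmf_b (am * par_q pp i)
  | BPrime i, BSigma => pmf_g (am * par_r pp i)
  | BSigma, BSeg => pmf_P (ap * par_t pm)
  | BSigma, BDot i => pmf_b (ap * par_q pm i)
  | BSigma, BPrime i => pmf_g (ap * par_r pm i)
  | BSigma, BSigma => fun k => (k == 0%N)%:R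
  end.

Definition mutually_independent d (T : measurableType d) (R : realType)
    (P : probability T R) (I : eqType) (F : I -> set (set T)) : Prop :=
  forall (J : seq I) (A : I -> set T), uniq J ->
    (forall i, i \in J -> F i (A i)) ->
    (P (\big[setI/setT]_(i <- J) A i) = \prod_(i <- J) P (A i))%E.

Definition generated_by d d' (T : measurableType d) (T' : measurableType d')
    (X : T -> T') : set (set T) :=
  preimage_set_system setT X measurable.

Inductive source :=
| Count of block & block
| Abscissa of block & nat
| Ordinate of block & nat.

HB.instance Definition _ := gen_eqMixin source.

(* [abscissa b k] is the first coordinate of the k-th point of [0,1] x b and
   [ordinate a k] is the second coordinate of the k-th point of a x [0,1];
   together, [abscissa BSeg k] and [ordinate BSeg k] are the coordinates of the
   k-th point of the square, which is uniform as they are independent. *)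
Record extended_model d (T : measurableType d) (R : realType)
    (P : probability T R) (pp pm : parameter_set R) (ap am : R) :=
  ExtendedModel {
  npoints : block -> block -> T -> nat;
  abscissa : block -> nat -> T -> {i01 R};
  ordinate : block -> nat -> T -> {i01 R};
  npoints_meas : forall a b, measurable_fun setT (npoints a b);
  abscissa_meas : forall b k, measurable_fun setT (fun w => (abscissa b k w)%:num);
  ordinate_meas : forall a k, measurable_fun setT (fun w => (ordinate a k w)%:num);
  npoints_law : forall a b n,
    P [set w | npoints a b w = n] = (count_pmf pp pm ap am a b n)%:E;
  abscissa_law : forall b k (B : set R), measurable B ->
    P [set w | B (abscissa b k w)%:num] = uniform_prob (@ltr01 R) B;
  ordinate_law : forall a k (B : set R), measurable B ->
    P [set w | B (ordinate a k w)%:num] = uniform_prob (@ltr01 R) B;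
  sources_independent : mutually_independent P (fun s : source =>
    match s with
    | Count a b => generated_by (npoints a b)
    | Abscissa b k => generated_by (fun w => (abscissa b k w)%:num)
    | Ordinate a k => generated_by (fun w => (ordinate a k w)%:num)
    end) }.

(* The k-th point in the product of the blocks [a] and [b]. *)
Definition site d (T : measurableType d) (R : realType)
    (P : probability T R) (pp pm : parameter_set R) (ap am : R)
    (M : extended_model P pp pm ap am) (w : T) (a b : block) (k : nat) :
    Omegap R * Omegap R :=
  (place a (abscissa M b k w), place b (ordinate M a k w)).

(* A multiset is given by its multiplicity function. *)
Definition random_multiset d (T : measurableType d) (R : realType)
    (P : probability T R) (pp pm : parameter_set R) (ap am : R)
    (M : extended_model P pp pm ap am) (w : T) (z : Omegap R * Omegap R) : nat :=
  let a := block_of z.1 in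
  let b := block_of z.2 in
  #|[pred k : 'I_(npoints M a b w) | site M w a b k == z]|.

Record admissible_order (R : realType) (le : rel (Omega R)) : Prop :=
  AdmissibleOrder {
  admissible_refl : reflexive le;
  admissible_anti : antisymmetric le;
  admissible_trans : transitive le;
  admissible_total : total le;
  admissible_seg : forall u v : {i01 R}, le (Seg u) (Seg v) = (u%:num <= v%:num) }.

Definition extend_order (R : realType) (le : rel (Omega R)) : rel (Omegap R) :=
  fun x y => match x, y with
  | None, _ => true
  | Some _, None => false
  | Some x', Some y' => le x' y'
  end.

Definition is_dot (R : realType) (x : Omegap R) : bool :=
  if x is Some (Dot _) then true else false.

Definition increasing_step (R : realType) (lep lem : rel (Omega R)) :
    rel (Omegap R * Omegap R) :=
  fun z z' =>
    [&& extend_order lep z.1 z'.1,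
        extend_order lem z.2 z'.2,
        (z.1 == z'.1) ==> ~~ is_dot z.1 &
        (z.2 == z'.2) ==> ~~ is_dot z.2].

Definition increasing_subsequence (R : realType) (lep lem : rel (Omega R))
    (M : Omegap R * Omegap R -> nat) (s : seq (Omegap R * Omegap R)) : Prop :=
  sorted (increasing_step lep lem) s /\ forall z, (count_mem z s <= M z)%N.

(* The maximal length of an increasing subsequence, or 0 if the lengths are
   unbounded (which has probability 0 for the random multisets above). *)
Definition lambda1 (R : realType) (lep lem : rel (Omega R))
    (M : Omegap R * Omegap R -> nat) : nat :=
  xget 0%N [set n |
    (exists2 s, increasing_subsequence lep lem M s & size s = n) /\
    (forall s, increasing_subsequence lep lem M s -> (size s <= n)%N)].

(* Main.v *)
(* For finitely many letters the statement is a form of Burke's theorem for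
   last passage percolation.  The length L is the sum of the increments along one
   axis of the lattice and of those across the opposite side.  Absorbing the factors
   (ap * am)^-1 of the former in the law of the axis gives the weights of the
   stationary model of parameter ap, for which the local rule sending the two
   incoming increments and the weight of a cell to the two outgoing increments and
   a new weight is a weight-preserving involution.  Sweeping the lattice cell by
   cell is therefore a bijection of configurations, which turns the expectation
   into a product over cells.

   The segment [0,1] is cut into N+1 strips, each treated as a letter i' of
   parameter t/(N+1).  Configurations in which a strip contains two points, or
   in which a strip through which a letter passes contains a point, have
   negligible weight (each point removed from such a configuration costs a
   factor of order 1/N), and on the others Poisson and geometric weights agree
   up to a constant.  Infinitely many letters are reached by truncation, almost
   all configurations being finite by Borel-Cantelli. *)

Require Import Defs.
From HB Require Import structures.
From mathcomp Require Import all_boot all_order all_algebra.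
From mathcomp Require Import all_classical all_reals all_analysis.
From mathcomp Require Import measurable_realfun zify ring lra.
Set Implicit Arguments.
Unset Strict Implicit.
Unset Printing Implicit Defensive.
Import Order.TTheory GRing.Theory Num.Theory.
Import numFieldNormedType.Exports.

(** On simple configurations the law of the discretized multiset is a product weight times one
    number, [config_constant]. Its product with the total weight of the valid configurations tends
    to 1: it is bounded below cell by cell, and above because the simple configurations have
    probability at most 1. The expectation therefore tends to the quotient of two sums over valid
    configurations, with tilted and with original weights. Inner cells cancel in this quotient, and
    the two axes leave the four values of E.

    The lower bounds on [ap] and [am] make the tilted geometric series on the axes converge, the
    upper bounds the original ones.

    If [ap * am < 1] the length factor is unbounded, so a set of small probability may not simply be
    dropped. Hence the removal of points is estimated on weights that include the length factor, and
    the expectation is first taken of the factor capped at a level m, which tends to infinity after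
    N. *)

(** * Longest chains of a multiset *)

(** This is [increasing_subsequence] over an arbitrary relation, so that chains of points of Omega
    and chains of letters fall under one notion. *)
Definition multichain (T : eqType) (e : rel T) (M : T -> nat) (s : seq T) : Prop :=
  sorted e s /\ forall z, (count_mem z s <= M z)%N.

(** A relation rather than a function, since the chains of the full random multiset may have
    unbounded length; [lambda1] then takes its default value 0. *)
Definition maximal_length (T : eqType) (e : rel T) (M : T -> nat) (n : nat) : Prop :=
  (exists2 s, multichain e M s & size s = n) /\
  (forall s, multichain e M s -> (size s <= n)%N).

Section MaximalLength.
Variables (T : eqType) (e : rel T).
Implicit Types (M : T -> nat) (s : seq T).

Lemma maximal_length_uniq M n m :
  maximal_length e M n -> maximal_length e M m -> n = m.
Proof.
move=> [[s sM <-] sn] [[t tM <-] tm].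
by apply/eqP; rewrite eqn_leq tm ?sn.
Qed.

Lemma eq_maximal_length M M' n :
  M =1 M' -> maximal_length e M n -> maximal_length e M' n.
Proof.
move=> MM' [[s [se sM] sn] H]; split.
  by exists s => //; split => // z; rewrite -MM'.
by move=> t [te tM]; apply: H; split => // z; rewrite MM'.
Qed.

Lemma multichain_sub M M' s : (forall z, M z <= M' z)%N ->
  multichain e M s -> multichain e M' s.
Proof. by move=> MM' [se sM]; split=> // z; apply: leq_trans (MM' z). Qed.

Lemma maximal_length_mono M M' n m : (forall z, M z <= M' z)%N ->
  maximal_length e M n -> maximal_length e M' m -> (n <= m)%N.
Proof.
by move=> MM' [[s sM <-] _] [_]; apply; apply: multichain_sub sM.
Qed.

Lemma multichain_behead M x s : multichain e M (x :: s) -> multichain e M s.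
Proof.
move=> [/path_sorted se sM]; split => // z.
by apply: leq_trans (sM z); rewrite /= leq_addl.
Qed.

Lemma multichain_drop M s k : multichain e M s -> multichain e M (drop k s).
Proof.
elim: k s => [|k IH] s; first by rewrite drop0.
by case: s => [|x s] //= /multichain_behead; exact: IH.
Qed.

Lemma multichain_of_size M n : maximal_length e M n ->
  forall k, (k <= n)%N -> exists2 s, multichain e M s & size s = k.
Proof.
move=> [[s sM sn] _] k kn; exists (drop (n - k) s); first exact: multichain_drop.
by rewrite size_drop sn subKn.
Qed.

End MaximalLength.

Section Lift.
Variables (I : eqType) (T : eqType) (f : I -> T).

(** Replaces the points of a chain by distinct labels. Two multisets that are images of the same
    labels, such as the points and the letters that approximate them, are compared in this way. *)
Lemma lift_indices (r : seq I) (s : seq T) : uniq r ->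
  (forall z, count_mem z s <= count_mem z (map f r))%N ->
  exists t, [/\ uniq t, {subset t <= r} & map f t = s].
Proof.
elim: s r => [|x s IH] r ur H; first by exists [::].
have xr : x \in map f r.
  by rewrite -has_pred1 has_count; apply: leq_trans (H x); rewrite /= eqxx.
case/mapP: xr => i ir xi.
have [|z|t [ut tr ts]] := IH (rem i r); first exact: rem_uniq.
  have := H z; rewrite (permP (perm_map f (perm_to_rem ir))) /= -xi; lia.
exists (i :: t); split => /=.
- rewrite ut andbT; apply/negP => /tr; by rewrite mem_rem_uniq // inE eqxx.
- by move=> j; rewrite inE => /orP[/eqP->//|/tr/mem_rem].
- by rewrite ts xi.
Qed.

Lemma count_map_sub (r t : seq I) z : uniq t -> {subset t <= r} ->
  (count_mem z (map f t) <= count_mem z (map f r))%N.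
Proof.
move=> ut tr; rewrite !count_map.
rewrite -!size_filter; apply: uniq_leq_size; first exact: filter_uniq.
by move=> i; rewrite !mem_filter => /andP[-> /tr].
Qed.

Lemma ex_maximal_length (e : rel T) (r : seq I) : uniq r ->
  exists n, maximal_length e (fun z => count_mem z (map f r)) n.
Proof.
move=> ur.
(* Decidable form of the existence of a chain of length n: a repetition-free list of labels taken
   from [r] is a permutation of a mask of [r]. *)
pose Q n := has (fun t => (sorted e (map f t)) && (size t == n))
   (flatten [seq permutations u | u <- [seq mask m r | m <- codom (fun m : (size r).-tuple bool
       => tval m)]]).
have Qle t : uniq t -> {subset t <= r} -> sorted e (map f t) -> Q (size t).
  move=> ut tr se; apply/hasP; exists t; last by rewrite se eqxx.
  apply/flattenP; exists (permutations [seq i <- r | i \in t]).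
    apply: map_f; apply/mapP; exists (map (mem t) r); last by rewrite filter_mask.
    have szm : size (map (mem t) r) == size r by rewrite size_map.
    by apply/codomP; exists (Tuple szm).
  rewrite mem_permutations; apply: uniq_perm => //; first exact: filter_uniq.
  by move=> i; rewrite mem_filter; case: (boolP (i \in t)) => //= /tr.
have Qs n : Q n -> exists t, [/\ uniq t, {subset t <= r}, sorted e (map f t) & size t = n].
  case/hasP => t /flattenP[p /mapP[u /mapP[m _ ->] ->]].
  rewrite mem_permutations => pt /andP[se /eqP sz]; exists t; split => //.
    by rewrite (perm_uniq pt) mask_uniq.
  by move=> i; rewrite (perm_mem pt) => /mem_mask.
have exQ : exists n, Q n by exists 0; apply: (Qle [::]).
have ubQ n : Q n -> n <= size r.
  by move=> /Qs[t [ut tr _ <-]]; apply: uniq_leq_size.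
case: (ex_maxnP exQ ubQ) => n /Qs[t [ut tr se <-]] Hn.
exists (size t); split.
  exists (map f t); last by rewrite size_map.
  by split => // z; exact: count_map_sub.
move=> s [ss sM]; have [u [uu ur' us]] := lift_indices ur sM.
by rewrite -us size_map; apply/Hn/Qle => //; rewrite us.
Qed.

End Lift.

Lemma sorted_map_eq (I T T' : eqType) (f : I -> T) (f' : I -> T') (e : rel T)
    (e' : rel T') (t : seq I) : uniq t ->
  {in t &, forall i j, i != j -> e (f i) (f j) = e' (f' i) (f' j)} ->
  sorted e (map f t) = sorted e' (map f' t).
Proof.
elim: t => [|i [|j t] IH] //= /andP[it ut] H.
rewrite H ?inE ?eqxx ?orbT //; last by move: it; rewrite inE negb_or => /andP[].
congr (_ && _); apply: IH => // a b at_ bt; apply: H; by rewrite inE ?at_ ?bt orbT.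
Qed.

(** Agreement is required for distinct labels only, because a chain lifted to distinct labels never
    compares a label with itself. Two copies of one point are still two labels. *)
Lemma maximal_length_map (I T T' : eqType) (f : I -> T) (f' : I -> T') (e : rel T)
    (e' : rel T') (r : seq I) n : uniq r ->
  {in r &, forall i j, i != j -> e (f i) (f j) = e' (f' i) (f' j)} ->
  maximal_length e (fun z => count_mem z (map f r)) n ->
  maximal_length e' (fun z => count_mem z (map f' r)) n.
Proof.
move=> ur H [[s [se sM] <-] Hs].
have tr (t : seq I) : uniq t -> {subset t <= r} -> sorted e (map f t) = sorted e' (map f' t).
  by move=> ut tr; apply: sorted_map_eq => // i j /tr ir /tr; exact: H.
split.
  have [t [ut tr' ts]] := lift_indices ur sM.
  exists (map f' t); last by rewrite -ts !size_map.
  by split; [rewrite -tr// ts | move=> z; exact: count_map_sub].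
move=> s' [se' sM'].
have [t [ut tr' ts]] := lift_indices ur sM'.
rewrite -ts size_map -(size_map f); apply: Hs; split; first by rewrite tr // ts.
by move=> z; exact: count_map_sub.
Qed.

(** * Last passage increments at a corner *)

(* Let l, l + U and l + V be the maximal lengths in a rectangle deprived of its last
   letters x and y, of y only, and of x only.  The maximal length of the rectangle is
   l + corner dx dy U V w, where w is the multiplicity of (x, y), and dx and dy tell
   whether x and y may occur only once. *)
Definition corner (dx dy : bool) (U V w : nat) : nat :=
  maxn (maxn U V)
    (maxn (if dx then 0 else U) (if dy then 0 else V)
     + (if dx || dy then minn w 1 else w)).

(* The new triple (t - V, t - U, U + V + w - t) has the same pairwise sums
   U + w and V + w as (U, V, w), hence the same weight as soon as the weight of
   the third entry is the product of the two others. *)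
Lemma corner_involutive (dx dy : bool) (U V w : nat) :
  (dx -> U <= 1) -> (dy -> V <= 1) -> (dx != dy -> w <= 1) ->
  let t := corner dx dy U V w in
  let t' := corner dx dy (t - V) (t - U) (U + V + w - t) in
  [/\ t' - (t - U) = U, t' - (t - V) = V,
      (t - V) + (t - U) + (U + V + w - t) - t' = w &
      [/\ dx -> t - V <= 1, dy -> t - U <= 1 &
       dx != dy -> U + V + w - t <= 1]].
Proof.
case: dx; case: dy => /= HU HV Hw; rewrite /corner /= ?max0n ?maxn0.
- move: (HU isT) (HV isT) => {HU HV Hw}; case: U => [|[|//]] _; case: V => [|[|//]] _;
    case: w => [|w]; (split; try (split=> // _); lia).
- move: (HU isT) (Hw isT) => {HU HV Hw}; case: U => [|[|//]] _; case: w => [|[|//]] _;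
    rewrite ?(max0n, maxn0, addn0, subn0, maxnn); (split; try (split=> // _); lia).
- move: (HV isT) (Hw isT) => {HU HV Hw}; case: V => [|[|//]] _; case: w => [|[|//]] _;
    rewrite ?(max0n, maxn0, addn0, subn0, maxnn); (split; try (split=> // _); lia).
- by clear; split; [lia|lia|lia|split].
Qed.

Lemma corner_ge (dx dy : bool) (U V w : nat) :
  [/\ U <= corner dx dy U V w, V <= corner dx dy U V w &
      corner dx dy U V w <= U + V + w].
Proof. by rewrite /corner; case: dx; case: dy => /=; split; lia. Qed.

(** * Longest chains of a rectangle *)

Definition grid_step (A B : eqType) (leA : rel A) (leB : rel B) (dA : pred A) (dB : pred B) :
    rel (A * B) :=
  fun z z' => [&& leA z.1 z'.1, leB z.2 z'.2,
    (z.1 == z'.1) ==> ~~ dA z.1 & (z.2 == z'.2) ==> ~~ dB z.2].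

Definition restrict (A B : eqType) (M : A * B -> nat) (X : seq A) (Y : seq B)
    (z : A * B) : nat := if (z.1 \in X) && (z.2 \in Y) then M z else 0.

Section Grid.
Variables (A B : eqType) (leA : rel A) (leB : rel B) (dA : pred A) (dB : pred B).
Hypotheses (leA_refl : reflexive leA) (leA_anti : antisymmetric leA)
  (leA_trans : transitive leA).
Hypotheses (leB_refl : reflexive leB) (leB_anti : antisymmetric leB)
  (leB_trans : transitive leB).
Implicit Types (M : A * B -> nat) (X : seq A) (Y : seq B).
Local Notation e := (grid_step leA leB dA dB).

Lemma grid_step_trans : transitive e.
Proof.
move=> y x z /and4P[a1 b1 c1 d1] /and4P[a2 b2 c2 d2]; apply/and4P; split.
- exact: leA_trans a2.
- exact: leB_trans b2.
- apply/implyP => /eqP xz; move: c1; rewrite (_ : x.1 = y.1) ?eqxx //.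
  by apply: leA_anti; rewrite a1 xz a2.
- apply/implyP => /eqP xz; move: d1; rewrite (_ : x.2 = y.2) ?eqxx //.
  by apply: leB_anti; rewrite b1 xz b2.
Qed.

Lemma multichain_restrict M X Y s :
  multichain e (restrict M X Y) s <->
  multichain e M s /\ all (fun z => (z.1 \in X) && (z.2 \in Y)) s.
Proof.
split=> [[se sM]|[[se sM] /allP sXY]].
  split; last first.
    apply/allP => z zs; have := sM z; rewrite /restrict; case: ifP => // _.
    by rewrite leqn0 => /eqP /count_memPn; rewrite zs.
  split=> // z; apply: leq_trans (sM z) _; rewrite /restrict; by case: ifP.
split=> // z; rewrite /restrict; case: ifPn => // zXY.
rewrite leqn0; apply/eqP/count_memPn; apply: contra zXY; exact: sXY.
Qed.

Lemma sorted_last_le s z : sorted e (rcons s z) -> {in s, forall z', e z' z}.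
Proof.
move=> se z' zs; have := se; rewrite -cats1 (sorted_pairwise grid_step_trans).
by rewrite pairwise_cat => /and3P[/allrelP /(_ z' z zs)]; rewrite inE eqxx => /(_ isT).
Qed.

Variables (M : A * B -> nat) (X : seq A) (Y : seq B) (x : A) (y : B).
Hypotheses (xX : {in X, forall x', leA x' x && (x' != x)})
           (yY : {in Y, forall y', leB y' y && (y' != y)}).

Let XYs (X : seq A) (Y : seq B) (s : seq (A * B)) := all (fun z => (z.1 \in X) && (z.2 \in Y)) s.

(** The last point of the chain decides. If its first coordinate is not the top letter x, no point
    of the chain has abscissa x; otherwise its ordinate is not y, and no point has ordinate y. *)
Lemma XYs_avoid s : sorted e s -> XYs (x :: X) (y :: Y) s -> (x, y) \notin s ->
  XYs X (y :: Y) s \/ XYs (x :: X) Y s.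
Proof.
case/lastP: s => [|s z]; first by left.
move=> se /allP sXY xys.
have zs : z \in rcons s z by rewrite mem_rcons inE eqxx.
have le z' : z' \in rcons s z -> leA z'.1 z.1 && leB z'.2 z.2.
  rewrite mem_rcons inE => /orP[/eqP->|/(sorted_last_le se)].
    by rewrite leA_refl leB_refl.
  by case/and4P => -> ->.
have [zx|zx] := eqVneq z.1 x; last first.
  left; apply/allP => z' z's; have /andP[] := sXY _ z's; rewrite inE => /orP[|-> -> //].
  move=> /eqP z'x; exfalso; move/negP: zx; apply; apply/eqP/leA_anti.
  have /andP[+ _] := le _ z's; rewrite z'x => ->; rewrite andbT.
  have /andP[+ _] := sXY _ zs; rewrite inE => /orP[/eqP ->|/xX /andP[]//]; exact: leA_refl.
have zy : z.2 != y.
  by apply: contra xys => /eqP zy; rewrite -zx -zy -surjective_pairing.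
right; apply/allP => z' z's; have /andP[-> ] := sXY _ z's; rewrite inE => /orP[|-> //].
move=> /eqP z'y; exfalso; move/negP: zy; apply; apply/eqP/leB_anti.
have /andP[_ +] := le _ z's; rewrite z'y => ->; rewrite andbT.
have /andP[_] := sXY _ zs; rewrite inE => /orP[/eqP ->|/yY /andP[]//]; exact: leB_refl.
Qed.

Lemma size_count s (z : A * B) : size s = size [seq z' <- s | z' != z] + count_mem z s.
Proof. by rewrite size_filter addnC count_predC. Qed.

(** If the chain contains (x, y), it ends with the copies of it. The part [t] before them avoids x
    if x may occur only once, likewise y, and always avoids one of the two, which bounds its length
    by [l0] plus the inner maximum of [corner]. *)
Lemma corner_upper l0 U V s :
  maximal_length e (restrict M X Y) l0 ->
  maximal_length e (restrict M (x :: X) Y) (l0 + U) ->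
  maximal_length e (restrict M X (y :: Y)) (l0 + V) ->
  multichain e (restrict M (x :: X) (y :: Y)) s ->
  size s <= l0 + corner (dA x) (dB y) U V (M (x, y)).
Proof.
move=> [_ H0] [_ HU] [_ HV] /multichain_restrict[[se sM] sXY].
have sub X1 Y1 t : subseq t s -> XYs X1 Y1 t -> multichain e (restrict M X1 Y1) t.
  move=> ts tXY; apply/multichain_restrict; split => //; split.
    exact: (subseq_sorted grid_step_trans ts se).
  by move=> z; apply: leq_trans (sM z); exact: leq_count_subseq.
have [cU cV _] := corner_ge (dA x) (dB y) U V (M (x, y)).
have [xys|xys] := boolP ((x, y) \in s); last first.
  case: (XYs_avoid se sXY xys) => /(sub _ _ _ (subseq_refl s)) => [/HV|/HU] sz.
    by apply: leq_trans sz _; rewrite leq_add2l.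
  by apply: leq_trans sz _; rewrite leq_add2l.
case/lastP: s => [//|s z] in se sM sXY sub xys *.
have zxy : z = (x, y).
  move: xys; rewrite mem_rcons inE => /orP[/eqP //|xys].
  have /and4P[lx ly _ _] := sorted_last_le se xys.
  have /allP /(_ z) := sXY; rewrite mem_rcons inE eqxx => /(_ isT) /andP[].
  case: z lx ly {se sM sXY sub} => z1 z2 /= lx ly.
  rewrite !inE => zX zY; congr (_, _).
    apply: leA_anti; rewrite lx andbT.
    by case/orP: zX => [/eqP->|/xX /andP[]//]; exact: leA_refl.
  apply: leB_anti; rewrite ly andbT.
  by case/orP: zY => [/eqP->|/yY /andP[]//]; exact: leB_refl.
rewrite {xys z}zxy in se sM sXY sub *.
set t := [seq z <- s | z != (x, y)].
have ts : subseq t (rcons s (x, y)).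
  apply: subseq_trans (filter_subseq _ _) _; exact: subseq_rcons.
have tse : sorted e t by exact: (subseq_sorted grid_step_trans ts se).
have txy : (x, y) \notin t by rewrite mem_filter /= eqxx.
have tXY : XYs (x :: X) (y :: Y) t.
  by apply/allP => z /(mem_subseq ts) zs; move/allP: sXY; exact.
have tlast z : z \in t -> e z (x, y).
  by rewrite mem_filter => /andP[_]; exact: sorted_last_le.
have tdx : dA x -> XYs X (y :: Y) t.
  move=> dx; apply/allP => z zt; have /and4P[_ _ + _] := tlast _ zt.
  move/allP: tXY => /(_ _ zt) /andP[]; rewrite inE => /orP[/eqP->|-> -> //].
  by rewrite eqxx dx.
have tdy : dB y -> XYs (x :: X) Y t.
  move=> dy; apply/allP => z zt; have /and4P[_ _ _ +] := tlast _ zt.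
  move/allP: tXY => /(_ _ zt) /andP[-> ]; rewrite inE => /orP[/eqP->|-> //].
  by rewrite eqxx dy.
have tU : XYs (x :: X) Y t -> size t <= l0 + U by move=> /(sub _ _ _ ts) /HU.
have tV : XYs X (y :: Y) t -> size t <= l0 + V by move=> /(sub _ _ _ ts) /HV.
have t0 : XYs X Y t -> size t <= l0 by move=> /(sub _ _ _ ts) /H0.
have szs : size (rcons s (x, y)) = size t + (count_mem (x, y) s).+1.
  by rewrite size_rcons (size_count s (x, y)) addnS.
have cM : (count_mem (x, y) s).+1 <= M (x, y).
  by have := sM (x, y); rewrite -cats1 count_cat /= eqxx addn1.
have c1 : dA x || dB y -> count_mem (x, y) s = 0.
  move=> dxy; apply/count_memPn; apply/negP => /(sorted_last_le se) /and4P[_ _].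
  by rewrite !eqxx /= ; case/orP: dxy => ->.
have szt : size t <= l0 + maxn (if dA x then 0 else U) (if dB y then 0 else V).
  case dx: (dA x) tdx => /= tdx; case dy: (dB y) tdy => /= tdy.
  - rewrite maxnn addn0; apply: t0; apply/allP => z zt.
    move/allP: (tdx isT) => /(_ _ zt) /andP[-> _].
    by move/allP: (tdy isT) => /(_ _ zt) /andP[_ ->].
  - by rewrite max0n; exact: tV (tdx isT).
  - by rewrite maxn0; exact: tU (tdy isT).
  - rewrite addn_maxr leq_max.
    by case: (XYs_avoid tse tXY txy) => [/tV ->|/tU ->]; rewrite ?orbT.
rewrite szs /corner; set bb := maxn (if _ then _ else _) _ in szt *.
apply: leq_trans (leq_add szt (leqnn _)) _; rewrite -addnA leq_add2l leq_max.
apply/orP; right; rewrite leq_add2l; case: ifPn cM c1 => // _ cM /(_ isT) ->.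
by rewrite leq_min ltnSn (leq_ltn_trans _ cM).
Qed.

Lemma corner_append X1 Y1 s k : {subset X1 <= x :: X} -> {subset Y1 <= y :: Y} ->
  (dA x -> x \notin X1) -> (dB y -> y \notin Y1) -> (x \notin X1) || (y \notin Y1) ->
  (dA x || dB y -> k <= 1) -> k <= M (x, y) ->
  multichain e (restrict M X1 Y1) s ->
  multichain e (restrict M (x :: X) (y :: Y)) (s ++ nseq k (x, y)).
Proof.
move=> X1X Y1Y dx dy xy k1 kM /multichain_restrict[[se sM] /allP sXY].
have xys : (x, y) \notin s.
  by apply/negP => /sXY /andP[/= xX1 yY1]; move: xy; rewrite xX1 yY1.
apply/multichain_restrict; split; last first.
  rewrite all_cat; apply/andP; split; last by rewrite all_nseq /= !inE !eqxx orbT.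
  by apply/allP => z /sXY /andP[/X1X -> /Y1Y ->].
split; last first.
  move=> z; rewrite count_cat count_nseq /=; have [<-|zxy] := eqVneq (x, y) z.
    by rewrite mul1n (count_memPn xys).
  by rewrite addn0.
rewrite (sorted_pairwise grid_step_trans) pairwise_cat -!(sorted_pairwise grid_step_trans) se /=.
apply/andP; split.
  apply/allrelP => z z' zs /nseqP[-> _].
  have /andP[z1 z2] := sXY _ zs; apply/and4P; split => /=.
  - have := X1X _ z1; rewrite inE => /orP[/eqP->|/xX/andP[]//]; exact: leA_refl.
  - have := Y1Y _ z2; rewrite inE => /orP[/eqP->|/yY/andP[]//]; exact: leB_refl.
  - by apply/implyP => /eqP zx; apply/negP => d; move: z1; rewrite zx; apply/negP/dx; rewrite -zx.
  - by apply/implyP => /eqP zx; apply/negP => d; move: z2; rewrite zx; apply/negP/dy; rewrite -zx.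
case: k k1 {kM} => [|[|k]] // k1.
have : ~~ (dA x || dB y) by apply/negP => /k1.
rewrite negb_or => /andP[dx' dy'].
have exy : e (x, y) (x, y) by rewrite /grid_step /= !eqxx leA_refl leB_refl dx' dy'.
by elim: k {k1} => [|k IH] /=; rewrite exy //; case/andP: IH.
Qed.

Lemma corner_maximal l0 U V :
  maximal_length e (restrict M X Y) l0 ->
  maximal_length e (restrict M (x :: X) Y) (l0 + U) ->
  maximal_length e (restrict M X (y :: Y)) (l0 + V) ->
  maximal_length e (restrict M (x :: X) (y :: Y))
    (l0 + corner (dA x) (dB y) U V (M (x, y))).
Proof.
move=> H0 HU HV; split; last by move=> s; exact: corner_upper.
have xnX : x \notin X by apply/negP => /xX; rewrite eqxx andbF.
have ynY : y \notin Y by apply/negP => /yY; rewrite eqxx andbF.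
have [[s0 s0M sz0] _] := H0; have [[sU sUM szU] _] := HU; have [[sV sVM szV] _] := HV.
have mono X1 Y1 s : {subset X1 <= x :: X} -> {subset Y1 <= y :: Y} ->
    multichain e (restrict M X1 Y1) s -> multichain e (restrict M (x :: X) (y :: Y)) s.
  move=> X1X Y1Y; apply: multichain_sub => z; rewrite /restrict.
  by case: ifP => // /andP[/X1X -> /Y1Y ->].
have sX : {subset X <= x :: X} by move=> z; rewrite inE orbC => ->.
have sY : {subset Y <= y :: Y} by move=> z; rewrite inE orbC => ->.
pose w' := if dA x || dB y then minn (M (x, y)) 1 else M (x, y).
have w'M : w' <= M (x, y) by rewrite /w'; case: ifP => // _; exact: geq_minl.
have w'1 : dA x || dB y -> w' <= 1 by rewrite /w' => ->; exact: geq_minr.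
pose b := maxn (if dA x then 0 else U) (if dB y then 0 else V).
have [s sM szs] : exists2 s, multichain e (restrict M (x :: X) (y :: Y)) s &
    size s = l0 + (b + w').
  have cs X1 Y1 t : {subset X1 <= x :: X} -> {subset Y1 <= y :: Y} ->
      (dA x -> x \notin X1) -> (dB y -> y \notin Y1) -> (x \notin X1) || (y \notin Y1) ->
      multichain e (restrict M X1 Y1) t -> size t = l0 + b ->
      exists2 s, multichain e (restrict M (x :: X) (y :: Y)) s & size s = l0 + (b + w').
    move=> X1X Y1Y dx dy xy tM st; exists (t ++ nseq w' (x, y)).
      exact: corner_append tM.
    by rewrite size_cat size_nseq st addnA.
  (* The copies of (x, y) are appended to a chain avoiding each letter that may occur only once; if
     both letters may repeat, to the longer of the two chains avoiding one of them. *)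
  rewrite /b in cs *; case dx: (dA x) cs; case dy: (dB y) => cs.
  - by apply: (cs X Y s0) => //; rewrite ?xnX // addn0.
  - by apply: (cs X (y :: Y) sV) => //; rewrite ?xnX // max0n.
  - by apply: (cs (x :: X) Y sU) => //; rewrite ?ynY ?orbT // maxn0.
  - case/orP: (leq_total U V) => UV.
      by apply: (cs X (y :: Y) sV) => //; rewrite ?xnX // (maxn_idPr UV).
    by apply: (cs (x :: X) Y sU) => //; rewrite ?ynY ?orbT // (maxn_idPl UV).
have [] : [\/ corner (dA x) (dB y) U V (M (x, y)) = U,
   corner (dA x) (dB y) U V (M (x, y)) = V |
   corner (dA x) (dB y) U V (M (x, y)) = b + w'].
  rewrite /corner -/b -/w'; case: (leqP (maxn U V) (b + w')) => _; first by apply: Or33.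
  case: (leqP U V) => _; [exact: Or32 | exact: Or31].
- by move=> ->; exists sU => //; exact: mono sUM.
- by move=> ->; exists sV => //; exact: mono sVM.
- by move=> ->; exists s.
Qed.

End Grid.

(** * Sweeping a rectangle with the corner rule *)

Section Sweep.
Variables (A B : finType) (dA : pred A) (dB : pred B) (sA : A) (sB : B).
Hypotheses (dsA : ~~ dA sA) (dsB : ~~ dB sB).
Local Notation config := {ffun A * B -> nat}.
Implicit Types (c : config) (x : A) (y : B) (X : seq A) (Y : seq B).

(* The increments are stored in place: the entries (x, sB) and (sA, y) hold the
   current increments across the row x and the column y, and the entry (x, y) is
   replaced by the third component of the corner rule. *)
Definition corner_update x y c : config :=
  let U := c (x, sB) in let V := c (sA, y) in
  let t := corner (dA x) (dB y) U V (c (x, y)) in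
  [ffun z => if z == (x, sB) then t - V else if z == (sA, y) then t - U
             else if z == (x, y) then U + V + c (x, y) - t else c z].

(** The support of the multiplicities: the corner is empty and a cell with exactly one dotted letter
    is Bernoulli. As [sA] and [sB] are not dotted, this also bounds the axis entries of dotted
    letters, as [corner_involutive] requires. *)
Definition valid c : bool :=
  (c (sA, sB) == 0) && [forall z, (dA z.1 != dB z.2) ==> (c z <= 1)].

(** [foldr] treats the tail of a list first. The lists will be decreasing, so suffixes are initial
    segments of the order and the cells are visited from the smallest letters upwards. *)
Definition sweep_column x Y c := foldr (corner_update x) c Y.
Definition sweep X Y c := foldr (fun x => sweep_column x Y) c X.

Lemma corner_update_valid x y c : x != sA -> y != sB -> valid c ->
  valid (corner_update x y c) /\ corner_update x y (corner_update x y c) = c.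
Proof.
move=> xs ys /andP[c00 /forallP c1].
have dU : dA x -> c (x, sB) <= 1.
  by move=> dx; have /implyP := c1 (x, sB); apply; rewrite /= dx (negPf dsB).
have dV : dB y -> c (sA, y) <= 1.
  by move=> dy; have /implyP := c1 (sA, y); apply; rewrite /= dy (negPf dsA).
have dW : dA x != dB y -> c (x, y) <= 1 by have /implyP := c1 (x, y).
have [t'V t'U t'W [dU' dV' dW']] := corner_involutive dU dV dW.
have e1 : ((sA, y) == (x, sB)) = false by rewrite xpair_eqE eq_sym (negPf xs).
have e2 : ((x, y) == (x, sB)) = false by rewrite xpair_eqE (negPf ys) andbF.
have e3 : ((x, y) == (sA, y)) = false by rewrite xpair_eqE (negPf xs).
have e4 : ((sA, sB) == (x, sB)) = false by rewrite xpair_eqE eq_sym (negPf xs).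
have e5 : ((sA, sB) == (sA, y)) = false.
  by rewrite xpair_eqE [sB == y]eq_sym (negPf ys) andbF.
have e6 : ((sA, sB) == (x, y)) = false by rewrite xpair_eqE eq_sym (negPf xs).
split.
  apply/andP; split; first by rewrite ffunE e4 e5 e6.
  apply/forallP => -[u v] /=; rewrite ffunE; apply/implyP => duv.
  case: eqP => [[uE vE]|_].
    by apply: dU'; move: duv; rewrite uE vE (negPf dsB); case: (dA x).
  case: eqP => [[uE vE]|_].
    by apply: dV'; move: duv; rewrite uE vE (negPf dsA); case: (dB y).
  case: eqP => [[uE vE]|_]; first by apply: dW'; rewrite -uE -vE.
  by move/implyP: (c1 (u, v)); apply.
apply/ffunP => z; rewrite !ffunE !eqxx /= e1 e2 e3.
case: eqP => [->|_]; first exact: t'V.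
case: eqP => [->|_]; first exact: t'U.
case: eqP => [->|_ //]; exact: t'W.
Qed.

Lemma sweep_column_id x Y c z : z != (x, sB) ->
  {in Y, forall y, (z != (sA, y)) && (z != (x, y))} -> sweep_column x Y c z = c z.
Proof.
move=> zx; elim: Y => [//|y Y IH] zY /=; rewrite ffunE (negPf zx).
have /andP[/negPf-> /negPf->] := zY y (mem_head _ _).
by apply: IH => y' y'Y; apply: zY; rewrite inE y'Y orbT.
Qed.

Lemma sweep_id X Y c z : z.1 != sA -> z.1 \notin X -> sweep X Y c z = c z.
Proof.
case: z => z1 z2 /= zs; elim: X => [//|x X IH]; rewrite inE negb_or => /andP[zx zX] /=.
rewrite sweep_column_id ?IH // ?xpair_eqE ?(negPf zx) //.
by move=> y _; rewrite !xpair_eqE (negPf zx) (negPf zs).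
Qed.

Variables (leA : rel A) (leB : rel B).
Hypotheses (leA_refl : reflexive leA) (leA_anti : antisymmetric leA)
  (leA_trans : transitive leA).
Hypotheses (leB_refl : reflexive leB) (leB_anti : antisymmetric leB)
  (leB_trans : transitive leB).
Local Notation e := (grid_step leA leB dA dB).
Local Notation gA := (fun x x' => leA x' x && (x' != x)).
Local Notation gB := (fun y y' => leB y' y && (y' != y)).
Local Notation L c X Y := (maximal_length e (restrict c X Y)).

Lemma maximal_length_nil c X Y : X = [::] \/ Y = [::] -> L c X Y 0.
Proof.
move=> XY; split; first by exists [::].
case=> [//|z s] [_ /(_ z)] /=; rewrite eqxx /restrict.
by case: XY => ->; rewrite ?in_nil ?andbF.
Qed.

Section Column.
Variables (c0 c : config) (x : A) (X : seq A) (S : nat) (Y : seq B).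
Hypotheses (xs : x != sA) (gx : all (gA x) X)
  (gY : pairwise gB (rcons Y sB)) (cx : forall y, c (x, y) = c0 (x, y))
  (LX : forall Y1 Y2, Y = Y2 ++ Y1 ->
     L c0 X (rcons Y1 sB) (S + \sum_(y <- Y1) c (sA, y)))
  (L0 : L c0 (x :: X) [:: sB] (S + c0 (x, sB))).

(** [S] is the length over the rows [X] and the single column [sB]. The second equation says that
    the length gained from there to the opposite corner is the same along both sides of the
    rectangle; each corner step preserves it, since V + (t - V) = U + (t - U). *)
Lemma sweep_column_maximal Y1 Y2 : Y = Y2 ++ Y1 ->
  let c1 := sweep_column x Y1 c in
  L c0 (x :: X) (rcons Y1 sB) (S + \sum_(y <- Y1) c (sA, y) + c1 (x, sB)) /\
  \sum_(y <- Y1) c (sA, y) + c1 (x, sB) = c0 (x, sB) + \sum_(y <- Y1) c1 (sA, y).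
Proof.
elim: Y1 Y2 => [|y Y1 IH] Y2 YE /=; first by rewrite !big_nil addn0 cx addn0.
have [] := IH (rcons Y2 y); first by rewrite cat_rcons.
set c1 := sweep_column x Y1 c => L1 S1.
have := gY; rewrite YE rcons_cat pairwise_cat /= => /and4P[_ _ gyY1 gY1].
have ys : y != sB by move/allP: gyY1 => /(_ sB); rewrite mem_rcons inE eqxx eq_sym => /(_
    isT)/andP[].
have yY1 : {in rcons Y1 sB, forall y', leB y' y && (y' != y)} by move=> y' /(allP gyY1).
have ynY1 : y \notin Y1.
  by apply/negP => yY; have := yY1 y; rewrite mem_rcons inE yY orbT eqxx andbF => /(_ isT).
have Y1s : sB \notin Y1.
  apply/negP => sY; have := gY1; rewrite pairwise_rcons => /andP[/allP /(_ _ sY)].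
  by rewrite eqxx andbF.
have c1x : c1 (x, y) = c0 (x, y).
  rewrite -cx; apply: sweep_column_id; first by rewrite xpair_eqE (negPf ys) andbF.
  move=> y' y'Y; rewrite !xpair_eqE (negPf xs) eqxx /=.
  by apply: contraNN ynY1 => /eqP->.
have c1s : c1 (sA, y) = c (sA, y).
  apply: sweep_column_id; first by rewrite xpair_eqE (negPf ys) andbF.
  move=> y' y'Y; rewrite !xpair_eqE eqxx [sA == _]eq_sym (negPf xs) /= andbT.
  by apply: contraNN ynY1 => /eqP->.
have sum' : \sum_(y' <- Y1) corner_update x y c1 (sA, y') = \sum_(y' <- Y1) c1 (sA, y').
  apply: eq_big_seq => y' y'Y; rewrite ffunE !xpair_eqE [sA == x]eq_sym (negPf xs) /= eqxx /=.
  by rewrite (_ : (y' == y) = false) //; apply/negbTE; apply: contraNN ynY1 => /eqP<-.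
have := corner_maximal (dA := dA) (dB := dB) leA_refl leA_anti leA_trans leB_refl leB_anti
    leB_trans
  (allP gx) yY1 (LX (Y2 := rcons Y2 y) _) L1 (V := c (sA, y)).
have /= LX2 := LX YE.
rewrite cat_rcons => /(_ YE); rewrite -addnA (addnC (\sum_(_ <- _) _)).
rewrite big_cons in LX2 => /(_ LX2).
rewrite !ffunE !eqxx /= c1x c1s => L2.
have [g1 g2 _] := corner_ge (dA x) (dB y) (c1 (x, sB)) (c (sA, y)) (c0 (x, y)).
rewrite !big_cons sum' ffunE !xpair_eqE eqxx [sA == x]eq_sym (negPf xs) /= eqxx c1s c1x.
move: L2 S1 g1 g2; set t := corner _ _ _ _ _ => L2 S1 g1 g2; split; last by clear -S1 g1 g2; lia.
by move: L2; congr maximal_length; clear -S1 g1 g2; lia.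
Qed.

End Column.

Lemma sweep_maximal (c0 : config) X Y :
  c0 (sA, sB) = 0 -> {in X, forall x, dA x -> c0 (x, sB) <= 1} ->
  {in Y, forall y, dB y -> c0 (sA, y) <= 1} ->
  pairwise gA (rcons X sA) -> pairwise gB (rcons Y sB) ->
  L c0 (rcons X sA) (rcons Y sB)
    (\sum_(x <- X) c0 (x, sB) + \sum_(y <- Y) sweep X Y c0 (sA, y)).
Proof.
move=> c00 cX cY gX gY.
have Lc := corner_maximal (dA := dA) (dB := dB) leA_refl leA_anti leA_trans leB_refl leB_anti
    leB_trans.
have L00 : L c0 [:: sA] [:: sB] 0.
  have := Lc c0 [::] [::] sA sB _ _ 0 0 0 (maximal_length_nil _ (or_introl erefl))
    (maximal_length_nil _ (or_intror erefl)) (maximal_length_nil _ (or_introl erefl)).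
  rewrite c00 /corner (negPf dsA) (negPf dsB) /= !maxnn addn0; by apply.
(* On the axis all points form one chain: Sigma may be repeated, and so may every letter except the
   dotted ones, whose axis entries are at most 1. *)
have L0 X1 X2 : X = X2 ++ X1 -> L c0 (rcons X1 sA) [:: sB] (\sum_(x <- X1) c0 (x, sB)).
  elim: X1 X2 => [|x X1 IH] X2 XE; first by rewrite big_nil.
  have := gX; rewrite XE rcons_cat pairwise_cat /= => /and4P[_ _ gx _].
  have := IH (rcons X2 x); rewrite cat_rcons => /(_ XE) L1.
  have := Lc c0 (rcons X1 sA) [::] x sB (allP gx) _ 0 0 _ (maximal_length_nil _ (or_intror erefl))
    (maximal_length_nil _ (or_intror erefl)) L1.
  rewrite add0n (negPf dsB) big_cons; have -> : corner (dA x) false 0 (\sum_(x0 <- X1) c0 (x0,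
      sB)) (c0 (x, sB)) =
    c0 (x, sB) + \sum_(x0 <- X1) c0 (x0, sB); last by apply.
  rewrite /corner; have := cX x; rewrite XE mem_cat inE eqxx orbT => /(_ isT).
  rewrite orbF; case: (dA x) => [/(_ isT) /minn_idPl -> | _]; rewrite !max0n addnC;
  by apply/maxn_idPr/leq_addl.
suff H : forall X1 X2, X = X2 ++ X1 -> forall Y1 Y2, Y = Y2 ++ Y1 ->
    L c0 (rcons X1 sA) (rcons Y1 sB)
    (\sum_(x <- X1) c0 (x, sB) + \sum_(y <- Y1) sweep X1 Y c0 (sA, y)).
  exact: (H X [::] erefl Y [::] erefl).
elim=> [|x X1 IH] X2 XE.
  elim=> [|y Y1 IH] Y2 YE; first by rewrite !big_nil.
  have := gY; rewrite YE rcons_cat pairwise_cat /= => /and4P[_ _ gy _].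
  have := IH (rcons Y2 y); rewrite cat_rcons => /(_ YE) L1.
  have := Lc c0 [::] (rcons Y1 sB) sA y _ (allP gy) 0 _ 0 (maximal_length_nil _ (or_introl erefl))
    L1 (maximal_length_nil _ (or_introl erefl)).
  rewrite add0n (negPf dsA) big_nil big_cons add0n /=.
  have -> : corner false (dB y) (\sum_(y0 <- Y1) c0 (sA, y0)) 0 (c0 (sA, y)) =
    c0 (sA, y) + \sum_(y0 <- Y1) c0 (sA, y0); last by apply.
  rewrite /corner; have := cY y; rewrite YE mem_cat inE eqxx orbT => /(_ isT).
  rewrite orFb; case: (dB y) => [/(_ isT) /minn_idPl -> | _]; rewrite !maxn0 addnC;
  by apply/maxn_idPr/leq_addl.
have := gX; rewrite XE rcons_cat pairwise_cat /= => /and4P[_ _ gx gX1].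
have xs : x != sA.
  by move/allP: gx => /(_ sA); rewrite mem_rcons inE eqxx eq_sym => /(_ isT)/andP[].
have XE' : X = rcons X2 x ++ X1 by rewrite cat_rcons.
set c := sweep X1 Y c0.
have cx y : c (x, y) = c0 (x, y).
  apply: sweep_id => //=; apply/negP => xX1.
  by move/allP: gx => /(_ x); rewrite mem_rcons inE xX1 orbT eqxx andbF => /(_ isT).
have Lx : L c0 (x :: rcons X1 sA) [:: sB] (\sum_(x <- X1) c0 (x, sB) + c0 (x, sB)).
  by have := L0 _ _ XE; rewrite big_cons addnC.
move=> Y1 Y2 YE.
have [L1 S1] := sweep_column_maximal xs gx gY cx (IH _ XE') Lx YE.
rewrite big_cons.
(* The rest of the row is swept later and does not touch the entries (sA, y) with y in [Y1]. *)
have -> : \sum_(y <- Y1) sweep_column x Y c (sA, y) = \sum_(y <- Y1) sweep_column x Y1 c (sA, y).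
  have uY : uniq (rcons Y sB).
    by apply: pairwise_uniq gY => y; rewrite eqxx andbF.
  apply: eq_big_seq => y yY1.
  rewrite YE /sweep_column foldr_cat -!/(sweep_column _ _ _); apply: sweep_column_id.
    by rewrite xpair_eqE [sA == x]eq_sym (negPf xs).
  move=> y' y'Y2; rewrite !xpair_eqE eqxx [sA == x]eq_sym (negPf xs) /= andbT.
  move: uY; rewrite YE rcons_cat cat_uniq => /and3P[_ /hasPn /(_ y)].
  rewrite mem_rcons inE yY1 orbT => /(_ isT) yY2 _; by apply: contraNN yY2 => /eqP->.
move: S1; rewrite -/c => S1; move: L1; congr maximal_length; clear -S1; lia.
Qed.

End Sweep.

Local Open Scope classical_set_scope.
Local Open Scope ring_scope.

Lemma corner_update_weight (K : comNzRingType) (A B : finType) (dA : pred A) (dB : pred B)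
    (sA : A) (sB : B) (s : A * B -> K) (x : A) (y : B) (c : {ffun A * B -> nat}) :
  x != sA -> y != sB -> s (x, sB) * s (sA, y) = s (x, y) ->
  \prod_z s z ^+ corner_update dA dB sA sB x y c z = \prod_z s z ^+ c z.
Proof.
move=> xs ys sxy.
have e1 : (sA, y) != (x, sB) by rewrite xpair_eqE eq_sym (negPf xs).
have e2 : (x, y) != (x, sB) by rewrite xpair_eqE (negPf ys) andbF.
have e3 : (x, y) != (sA, y) by rewrite xpair_eqE (negPf xs).
have split3 (F : A * B -> K) : \prod_z F z = F (x, sB) * (F (sA, y) * (F (x, y) *
    \prod_(z | (z != (x, sB)) && (z != (sA, y)) && (z != (x, y))) F z)).
  rewrite (bigD1 (x, sB)) //=; congr (_ * _).
  rewrite (bigD1 (sA, y)) //=; congr (_ * _).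
  by rewrite (bigD1 (x, y)) //= e2 e3.
rewrite !split3 !ffunE !eqxx (negPf e1) (negPf e2) (negPf e3).
under eq_bigr => z /andP[/andP[/negPf z1 /negPf z2] /negPf z3].
  rewrite ffunE z1 z2 z3; over.
rewrite !mulrA; congr (_ * _).
have := corner_ge (dA x) (dB y) (c (x, sB)) (c (sA, y)) (c (x, y)).
set t := corner _ _ _ _ _; set U := c _; set V := c _; set w := c _ => -[tU tV tW].
rewrite -sxy !exprMn.
have -> : s (x, sB) ^+ (t - V) * s (sA, y) ^+ (t - U) *
  (s (x, sB) ^+ (U + V + w - t) * s (sA, y) ^+ (U + V + w - t)) =
  s (x, sB) ^+ (t - V + (U + V + w - t)) * s (sA, y) ^+ (t - U + (U + V + w - t)).
  by rewrite !exprD mulrACA.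
have -> : s (x, sB) ^+ U * s (sA, y) ^+ V * (s (x, sB) ^+ w * s (sA, y) ^+ w) =
  s (x, sB) ^+ (U + w) * s (sA, y) ^+ (V + w).
  by rewrite !exprD mulrACA.
by congr (_ ^+ _ * _ ^+ _); clear -tU tV tW; lia.
Qed.

(** * Sums over configurations *)

Section Esum.
Variable R : realType.

Lemma le_esum_scale (T : choiceType) (I : set T) (k : R) (a : T -> \bar R) :
  0 <= k -> (forall i, I i -> 0 <= a i)%E ->
  (\esum_(i in I) (k%:E * a i) <= k%:E * \esum_(i in I) a i)%E.
Proof.
move=> k0 a0; apply: ge_ereal_sup => _ [X [finX XI] <-].
rewrite fsbig_finite //= big_seq -ge0_sume_distrr; last first.
  by move=> i; rewrite in_fset_set // inE => /XI; exact: a0.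
rewrite -big_seq; apply: lee_wpmul2l; first by rewrite lee_fin.
by apply: esum_ge; exists X => //; rewrite fsbig_finite.
Qed.

Lemma esumZl (T : choiceType) (I : set T) (k : R) (a : T -> \bar R) :
  0 <= k -> (forall i, I i -> 0 <= a i)%E ->
  (\esum_(i in I) (k%:E * a i) = k%:E * \esum_(i in I) a i)%E.
Proof.
move=> k0 a0; apply/eqP; rewrite eq_le le_esum_scale //=.
have [->|kn0] := eqVneq k 0.
  by rewrite mul0e; apply: esum_ge0 => i _; rewrite mul0e.
have {kn0}k0 : 0 < k by rewrite lt_neqAle eq_sym kn0.
rewrite -lee_pdivlMl //; apply: le_trans (le_esum_scale _ _); last 2 first.
- by rewrite invr_ge0 ltW.
- by move=> i Ii; apply: mule_ge0; [rewrite lee_fin ltW|exact: a0].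
by apply: le_esum => i Ii; rewrite muleA -EFinM mulVf ?gt_eqF // mul1e.
Qed.

Lemma esum_geometric (s : R) : 0 <= s < 1 ->
  (\esum_(k in [set: nat]) (s ^+ k)%:E = ((1 - s)^-1)%:E)%E.
Proof.
move=> /andP[s0 s1]; rewrite -nneseries_esumT; last by move=> k; rewrite lee_fin exprn_ge0.
apply/cvg_lim => //.
have -> : (fun n => (\sum_(0 <= i < n) (s ^+ i)%:E)%E) = EFin \o series (geometric 1 s).
  by apply/funext => n /=; rewrite sumEFin; congr EFin; apply: eq_bigr => i _; rewrite /= mul1r.
apply/cvg_EFin; first exact: nearW.
have -> : (1 - s)^-1 = 1 * (1 - s)^-1 by rewrite mul1r.
by apply: cvg_geometric_series; rewrite ger0_norm.
Qed.

Lemma esum_le1 (s : R) : 0 <= s ->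
  (\esum_(k in [set k | (k <= 1)%N]) (s ^+ k)%:E = (1 + s)%:E)%E.
Proof.
move=> s0; have -> : [set k | (k <= 1)%N] = `I_2 by apply/seteqP; split=> k /=.
rewrite esum_mkcond -nneseries_esumT; last first.
  by move=> k; case: ifP => //; rewrite lee_fin exprn_ge0.
rewrite (nneseries_split _ 2); last by move=> k _; case: ifP => //; rewrite lee_fin exprn_ge0.
rewrite eseries0 ?adde0; last first.
  by move=> k k2 _; rewrite memNset //=; apply/negP; rewrite -leqNgt.
by rewrite !big_nat_recl //= big_nil !mem_set //= adde0 expr0 expr1.
Qed.

Lemma esum_at0 (s : R) : (\esum_(k in [set 0%N]) (s ^+ k)%:E = 1%:E :> \bar R)%E.
Proof. by rewrite esum_set1 expr0 // lee_fin. Qed.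

Lemma esum_ffun_prod (D : finType) (K : D -> set nat) (g : D -> nat -> R) (G : D -> R) :
  (forall z k, 0 <= g z k) ->
  (forall z, \esum_(k in K z) (g z k)%:E = (G z)%:E)%E ->
  (\esum_(c in [set c : {ffun D -> nat} | forall z, K z (c z)]) (\prod_z g z (c z))%:E =
   (\prod_z G z)%:E)%E.
Proof.
move=> g0 gG.
(* Induction on the cells that are free to vary: all other entries are frozen at 0, and [h] inserts
   the value of a new cell. *)
pose C (r : seq D) := [set c : {ffun D -> nat} | forall z, if z \in r then K z (c z) else c z =
    0%N].
have -> : [set c : {ffun D -> nat} | forall z, K z (c z)] = C (index_enum D).
  by apply/seteqP; split=> c /= cK z; have := cK z; rewrite mem_index_enum.
suff H : forall r, uniq r ->
  (\esum_(c in C r) (\prod_(z <- r) g z (c z))%:E = (\prod_(z <- r) G z)%:E)%E.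
  by apply: H; exact: index_enum_uniq.
elim=> [_|z r IH /= /andP[zr ur]].
  have -> : C [::] = [set [ffun => 0%N]].
    apply/seteqP; split=> c /=; first by move=> c0; apply/ffunP => z; rewrite ffunE c0.
    by move=> -> z; rewrite ffunE.
  by rewrite esum_set1 ?big_nil // lee_fin.
pose h (kc : nat * {ffun D -> nat}) := [ffun z' => if z' == z then kc.1 else kc.2 z'].
have hr kc z' : z' \in r -> h kc z' = kc.2 z'.
  by move=> z'r; rewrite ffunE; case: eqP z'r zr => // -> ->.
rewrite (reindex_esum (K z `*`` fun=> C r) _ h); last first.
  split.
  - move=> [k c] [/= Kk Cc] z'; rewrite ffunE inE; case: eqVneq => [->//|_] /=; exact: Cc.
  - move=> [k c] [k' c']; rewrite !inE /= => -[_ Cc] [_ Cc'] /ffunP hh.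
    have := hh z; rewrite !ffunE eqxx /= => ->; congr (_, _); apply/ffunP => z'.
    have [->|z'z] := eqVneq z' z; last by have := hh z'; rewrite !ffunE (negPf z'z).
    by have := Cc z; have := Cc' z; rewrite /= (negPf zr) => -> ->.
  - move=> c /= Cc; exists (c z, [ffun z' => if z' == z then 0%N else c z']).
      split => /= [|z']; first by have := Cc z; rewrite mem_head.
      rewrite ffunE; have := Cc z'; rewrite inE; case: eqVneq => [->|_] //=.
      by rewrite (negPf zr).
    by apply/ffunP => z'; rewrite !ffunE /=; case: eqP => [->|] //.
rewrite (eq_esum (b := fun kc : nat * {ffun D -> nat} => (g z kc.1 * \prod_(z' <- r) g z' (kc.2
    z'))%:E)); last first.
  move=> [k c] _; rewrite big_cons /= ffunE eqxx; congr (_ * _)%:E.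
  by apply: eq_big_seq => z' z'r; rewrite hr.
rewrite -(esum_esum (a := fun k (c : {ffun D -> nat}) => (g z k * \prod_(z' <- r) g z' (c
    z'))%:E)); last first.
  by move=> k c _ _; rewrite lee_fin mulr_ge0 // prodr_ge0.
transitivity (\esum_(k in K z) ((\prod_(z <- r) G z)%:E * (g z k)%:E))%E.
  apply: eq_esum => k _; rewrite muleC -IH //.
  rewrite -esumZl //; last by move=> c _; rewrite lee_fin prodr_ge0.
have PG0 : 0 <= \prod_(z <- r) G z.
  rewrite -lee_fin -IH //; apply: esum_ge0 => c _; by rewrite lee_fin prodr_ge0.
rewrite esumZl //; last by move=> k _; rewrite lee_fin.
by rewrite gG muleC -EFinM big_cons.
Qed.

End Esum.

Lemma set_bij_involution (T : Type) (V : set T) (f : T -> T) :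
  (forall c, V c -> V (f c) /\ f (f c) = c) -> set_bij V V f.
Proof.
move=> fV; split.
- by move=> c /fV[].
- by move=> c c'; rewrite !inE => /fV[_ fc] /fV[_ fc'] cc'; rewrite -fc cc'.
- by move=> c Vc; exists (f c); [apply: (fV c Vc).1 | apply: (fV c Vc).2].
Qed.

Lemma set_bij_foldr (T I : Type) (V : set T) (f : I -> T -> T) (r : seq I) :
  (forall i, set_bij V V (f i)) -> set_bij V V (fun c => foldr f c r).
Proof.
move=> fV; elim: r => [|i r [H1 H2 H3]]; first by split=> // c Vc; exists c.
have [F1 F2 F3] := fV i; split => /=.
- by move=> c /H1 /F1.
- move=> c c'; rewrite !inE => Vc Vc' /F2; rewrite !inE => /(_ (H1 _ Vc) (H1 _ Vc')) /H2.
  by rewrite !inE; apply.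
- by move=> c /F3[d Vd <-]; have [b Vb <-] := H3 _ Vd; exists b.
Qed.

Lemma prod_expn_indicator (K : comNzRingType) (D : finType) (Q : pred D) (x : K) (c : D -> nat) :
  \prod_z (if Q z then x else 1) ^+ c z = x ^+ (\sum_(z | Q z) c z)%N.
Proof.
rewrite (bigID Q) /= [X in _ * X]big1 ?mulr1; last by move=> z /negPf->; rewrite expr1n.
by rewrite expr_sum; apply: eq_bigr => z ->.
Qed.

(** * The sum over configurations of a finite alphabet *)

Section Burke.
Variables (R : realType) (A B : finType) (dA : pred A) (dB : pred B) (sA : A) (sB : B).
Hypotheses (dsA : ~~ dA sA) (dsB : ~~ dB sB).
Variables (leA : rel A) (leB : rel B).
Hypotheses (leA_refl : reflexive leA) (leA_anti : antisymmetric leA)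
  (leA_trans : transitive leA) (leA_total : total leA) (sA_min : forall x, leA sA x).
Hypotheses (leB_refl : reflexive leB) (leB_anti : antisymmetric leB)
  (leB_trans : transitive leB) (leB_total : total leB) (sB_min : forall y, leB sB y).
Local Notation config := {ffun A * B -> nat}.
Local Notation e := (grid_step leA leB dA dB).

Definition cell_range (z : A * B) : set nat :=
  if z == (sA, sB) then [set 0%N]
  else if dA z.1 != dB z.2 then [set k | (k <= 1)%N] else setT.

(** The sum of the powers of [s z] over [cell_range z], that is, the inverse of the normalizing
    factor of a Bernoulli or geometric law of parameter [s z]. *)
Definition cell_sum (s : A * B -> R) (z : A * B) : R :=
  if z == (sA, sB) then 1 else if dA z.1 != dB z.2 then 1 + s z else (1 - s z)^-1.

Lemma validE (c : config) : valid dA dB sA sB c <-> forall z, cell_range z (c z).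
Proof.
rewrite /cell_range; split=> [/andP[/eqP c0 /forallP c1] z|H].
  case: eqP => [->//|_]; case: ifPn => // d.
  by have /implyP := c1 z; apply.
apply/andP; split; first by have := H (sA, sB); rewrite eqxx /= => ->.
apply/forallP => z; apply/implyP => d; have := H z; rewrite d.
by case: eqP => [zE|//]; move: d; rewrite zE /= (negPf dsA) (negPf dsB).
Qed.

Lemma esum_valid (s : A * B -> R) :
  (forall z, 0 <= s z) ->
  (forall z, z != (sA, sB) -> dA z.1 = dB z.2 -> s z < 1) ->
  (\esum_(c in [set c : config | valid dA dB sA sB c]) (\prod_z s z ^+ c z)%:E =
   (\prod_z cell_sum s z)%:E)%E.
Proof.
move=> s0 s1.
have -> : [set c : config | valid dA dB sA sB c] = [set c : config | forall z, cell_range z (c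
    z)].
  by apply/seteqP; split=> c /= /validE.
apply: (esum_ffun_prod (g := fun z k => s z ^+ k)); first by move=> z k; rewrite exprn_ge0.
move=> z; rewrite /cell_range /cell_sum; case: ifPn => [_|zs]; first exact: esum_at0.
case: ifPn => [_|]; first exact: esum_le1.
by rewrite negbK => /eqP dz; apply: esum_geometric; rewrite s0 s1.
Qed.

Lemma decreasing_enum (T : finType) (le : rel T) (m : T) :
  reflexive le -> antisymmetric le -> transitive le -> total le -> (forall x, le m x) ->
  exists X : seq T, [/\ uniq X, X =i [pred x | x != m] &
    pairwise (fun x x' => le x' x && (x' != x)) (rcons X m)].
Proof.
move=> re an tr tot mi; exists (sort (fun x x' => le x' x) [seq x <- enum T | x != m]).
set X := sort _ _.
have uX : uniq X by rewrite sort_uniq filter_uniq // enum_uniq.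
have mX : X =i [pred x | x != m].
  by move=> x; rewrite mem_sort mem_filter mem_enum andbT.
split => //.
have -> : (fun x x' => le x' x && (x' != x)) = [rel x x' | le x' x && (x != x')].
  by apply/funext => x; apply/funext => x' /=; rewrite eq_sym.
have uXm : uniq (rcons X m) by rewrite rcons_uniq uX mX inE eqxx.
have := uXm; rewrite uniq_pairwise => pu.
suff ps : pairwise (fun x x' => le x' x) (rcons X m).
  by rewrite pairwise_relI ps pu.
rewrite pairwise_rcons; apply/andP; split; first by apply/allP => x _; exact: mi.
rewrite -sorted_pairwise; last by move=> y x z yx zy; exact: tr zy yx.
by apply: sort_sorted => x x'; exact: tot.
Qed.

Variables (a : A -> R) (b : B -> R) (Lc : config -> nat).
Hypotheses (a0 : forall x, 0 <= a x) (b0 : forall y, 0 <= b y) (asA : 0 < a sA) (bsB : 0 < b sB).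
Hypothesis LcP : forall c : config, maximal_length e c (Lc c).

Definition pair_weight (z : A * B) : R := a z.1 * b z.2.

(** The weights once both axes have absorbed the length factor. The first branch gives the corner
    the value 1, which is harmless because valid configurations are empty there. *)
Definition tilted_weight (z : A * B) : R :=
  if z.2 == sB then a z.1 / a sA else if z.1 == sA then b z.2 / b sB else a z.1 * b z.2.

Lemma sum_row (X : seq A) (c : config) : uniq X -> X =i [pred x | x != sA] ->
  (\sum_(x <- X) c (x, sB) = \sum_(z | (z.1 != sA) && (z.2 == sB)) c z)%N.
Proof.
move=> uX mX; transitivity (\sum_(x | x != sA) \sum_(y | y == sB) c (x, y))%N.
  rewrite big_uniq //=; apply: eq_big => x; first by rewrite mX.
  by rewrite big_pred1_eq.
by rewrite pair_big; apply: eq_bigr => -[].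
Qed.

Lemma sum_column (Y : seq B) (c : config) : uniq Y -> Y =i [pred y | y != sB] ->
  (\sum_(y <- Y) c (sA, y) = \sum_(z | (z.1 == sA) && (z.2 != sB)) c z)%N.
Proof.
move=> uY mY; transitivity (\sum_(x | x == sA) \sum_(y | y != sB) c (x, y))%N.
  by rewrite big_pred1_eq big_uniq //=; apply: eq_bigl => y; rewrite mY.
by rewrite pair_big; apply: eq_bigr => -[].
Qed.

Lemma prod_valid_eq (s s' : A * B -> R) (c : config) :
  valid dA dB sA sB c -> (forall z, z != (sA, sB) -> s z = s' z) ->
  \prod_z s z ^+ c z = \prod_z s' z ^+ c z.
Proof.
move=> /andP[/eqP c0 _] ss'; apply: eq_bigr => z _.
by have [->|/ss' ->//] := eqVneq z (sA, sB); rewrite c0 !expr0.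
Qed.

(* Each unit of length carries a factor 1 / (a sA * b sB).  Those of the first
   axis tilt its weights to a x / a sA, which makes the weights compatible with the
   corner rule; the others are read off the second axis after the sweep. *)
Lemma burke_sum :
  (forall z, z != (sA, sB) -> dA z.1 = dB z.2 -> tilted_weight z < 1) ->
  (\esum_(c in [set c : config | valid dA dB sA sB c])
     (\prod_z pair_weight z ^+ c z * (a sA * b sB) ^- Lc c)%:E =
   (\prod_z cell_sum tilted_weight z)%:E)%E.
Proof.
move=> tw1.
have [X [uX mX gX]] := decreasing_enum leA_refl leA_anti leA_trans leA_total sA_min.
have [Y [uY mY gY]] := decreasing_enum leB_refl leB_anti leB_trans leB_total sB_min.
pose V := [set c : config | valid dA dB sA sB c].
pose sw := sweep dA dB sA sB X Y.
have mX' x : x \in rcons X sA by rewrite mem_rcons inE mX inE; case: eqP.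
have mY' y : y \in rcons Y sB by rewrite mem_rcons inE mY inE; case: eqP.
have upV x y : x \in X -> y \in Y -> set_bij V V (corner_update dA dB sA sB x y).
  rewrite mX mY !inE => xs ys; apply: set_bij_involution => c /= Vc.
  exact: corner_update_valid.
have bijV : set_bij V V sw.
  have -> : sw = fun c => foldr (fun x => sweep_column dA dB sA sB x Y) c X by [].
  (* [set_bij_foldr] needs a bijection for every index, so the steps are extended by the identity
     outside [X], and below outside [Y]. *)
  pose f x := if x \in X then sweep_column dA dB sA sB x Y else id.
  have -> : (fun c => foldr (fun x => sweep_column dA dB sA sB x Y) c X) = (fun c => foldr f c X).
    apply/funext => c; rewrite /f.
    suff H : forall X', {subset X' <= X} ->
       foldr (fun x => sweep_column dA dB sA sB x Y) c X' =
       foldr (fun x => if x \in X then sweep_column dA dB sA sB x Y else id) c X' by exact: H.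
    elim=> [//|x X' IH] XX /=; rewrite XX ?mem_head // IH // => x' x'X.
    by apply: XX; rewrite inE x'X orbT.
  apply: set_bij_foldr => x; rewrite /f; case: ifPn => xX; last by split => // c Vc; exists c.
  pose g y := if y \in Y then corner_update dA dB sA sB x y else id.
  have -> : sweep_column dA dB sA sB x Y = (fun c => foldr g c Y).
    apply/funext => c; rewrite /g /sweep_column.
    suff H : forall Y', {subset Y' <= Y} ->
       foldr (corner_update dA dB sA sB x) c Y' =
       foldr (fun y => if y \in Y then corner_update dA dB sA sB x y else id) c Y' by exact: H.
    elim=> [//|y Y' IH] YY /=; rewrite YY ?mem_head // IH // => y' y'Y.
    by apply: YY; rewrite inE y'Y orbT.
  apply: set_bij_foldr => y; rewrite /g; case: ifPn => yY; last by split => // c Vc; exists c.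
  exact: upV.
have LcE c : V c -> Lc c = (\sum_(z | (z.1 != sA) && (z.2 == sB)) c z +
    \sum_(z | (z.1 == sA) && (z.2 != sB)) sw c z)%N.
  move=> Vc; rewrite -(sum_row _ uX mX) -(sum_column _ uY mY).
  have /andP[/eqP c0 /forallP c1] := Vc.
  have := sweep_maximal dsA dsB leA_refl leA_anti leA_trans leB_refl leB_anti leB_trans c0 _ _
      gX gY.
  move=> /(_ _ _) Lsw; apply: (maximal_length_uniq (LcP c)); apply: eq_maximal_length (Lsw _ _).
  - by move=> z; rewrite /restrict mX' mY'.
  - by move=> x _ dx; have /implyP := c1 (x, sB); apply; rewrite /= dx (negPf dsB).
  - by move=> y _ dy; have /implyP := c1 (sA, y); apply; rewrite /= dy (negPf dsA).
set x := (a sA * b sB)^-1.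
have an0 : a sA != 0 by rewrite gt_eqF.
have bn0 : b sB != 0 by rewrite gt_eqF.
(* [s1] absorbs the factors of the axis (x, sB). It satisfies the product rule s1 (x, sB) * s1 (sA,
   y) = s1 (x, y), hence is invariant under the sweep. [s2] also absorbs the factors of the other
   axis, read after the sweep. *)
pose s1 z := pair_weight z * (if (z.1 != sA) && (z.2 == sB) then x else 1).
pose s2 z := s1 z * (if (z.1 == sA) && (z.2 != sB) then x else 1).
have s1sw c : \prod_z s1 z ^+ sw c z = \prod_z s1 z ^+ c z.
  have colw x' Y' (c' : config) : x' \in X -> {subset Y' <= Y} ->
      \prod_z s1 z ^+ sweep_column dA dB sA sB x' Y' c' z = \prod_z s1 z ^+ c' z.
    move=> x'X; elim: Y' => [//|y Y' IH] YY.
    have yY : y \in Y by apply: YY; rewrite mem_head.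
    rewrite /sweep_column /= corner_update_weight; first by apply: IH => y' y'Y; apply: YY;
        rewrite inE y'Y orbT.
    - by move: x'X; rewrite mX.
    - by move: yY; rewrite mY.
    - move: x'X yY; rewrite mX mY !inE => xs ys.
      rewrite /s1 /pair_weight /= !eqxx (negPf xs) (negPf ys) /= /x.
      by field; rewrite an0 bn0.
  rewrite /sw; suff H : forall X', {subset X' <= X} ->
     \prod_z s1 z ^+ sweep dA dB sA sB X' Y c z = \prod_z s1 z ^+ c z by exact: H.
  elim=> [//|x' X' IH] XX; rewrite /sweep /= colw //; last by apply: XX; rewrite mem_head.
  by apply: IH => y' y'X; apply: XX; rewrite inE y'X orbT.
transitivity (\esum_(c in V) (\prod_z s2 z ^+ sw c z)%:E)%E.
  apply: eq_esum => c Vc; congr EFin.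
  rewrite -exprVn -/x LcE // exprD mulrA -!prod_expn_indicator -!big_split /=.
  rewrite (eq_bigr (fun z => s1 z ^+ c z * (if (z.1 == sA) && (z.2 != sB) then x else 1) ^+ sw c
      z)).
    rewrite big_split /= -s1sw -big_split /=; apply: eq_bigr => z _.
    by rewrite -exprMn.
  by move=> z _; rewrite -exprMn.
rewrite -(reindex_esum V V sw (fun c => (\prod_z s2 z ^+ c z)%:E) bijV).
rewrite -esum_valid; last 2 first.
- move=> z; rewrite /tilted_weight; case: ifP => _; first by rewrite divr_ge0.
  by case: ifP => _; rewrite ?divr_ge0 ?mulr_ge0.
- exact: tw1.
apply: eq_esum => c Vc; congr EFin; apply: prod_valid_eq => // -[z1 z2].
rewrite xpair_eqE negb_and /s2 /s1 /tilted_weight /pair_weight /x /=.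
case: (eqVneq z1 sA) => [->|_]; case: (eqVneq z2 sB) => [->|_] //= _; rewrite ?mulr1 //.
- by field; rewrite an0 bn0.
- by field; rewrite an0 bn0.
Qed.

End Burke.

(** * Removing points from configurations *)

Definition unit_config (D : finType) (d : D) : {ffun D -> nat} := [ffun z => (z == d) : nat].

Definition add_config (D : finType) (c e : {ffun D -> nat}) : {ffun D -> nat} :=
  [ffun z => (c z + e z)%N].

Definition le_config (D : finType) (e c : {ffun D -> nat}) : bool := [forall z, (e z <= c z)%N].

Definition config_weight (K : comNzRingType) (D : finType) (s : D -> K) (c : {ffun D -> nat}) :
    K :=
  \prod_z s z ^+ c z.

Lemma config_weight_add (K : comNzRingType) (D : finType) (s : D -> K) c e :
  config_weight s (add_config c e) = config_weight s c * config_weight s e.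
Proof. by rewrite -big_split; apply: eq_bigr => z _; rewrite ffunE exprD. Qed.

Lemma config_weight_unit (K : comNzRingType) (D : finType) (s : D -> K) d :
  config_weight s (unit_config d) = s d.
Proof.
rewrite /config_weight (bigD1 d) //= ffunE eqxx big1 ?mulr1 // => z zd.
by rewrite ffunE (negPf zd).
Qed.

Section Peierls.
Variables (R : realType) (D : finType).
Local Notation config := {ffun D -> nat}.

Lemma config_weight_ge0 (s : D -> R) (c : config) : (forall z, 0 <= s z) -> 0 <= config_weight s
    c.
Proof. by move=> s0; apply: prodr_ge0 => z _; rewrite exprn_ge0. Qed.

Lemma esum_subset (T : choiceType) (A B : set T) (f : T -> \bar R) :
  A `<=` B -> (forall x, B x -> 0 <= f x)%E -> (\esum_(x in A) f x <= \esum_(x in B) f x)%E.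
Proof.
move=> AB f0; apply: ge_ereal_sup => _ [X [finX XA] <-].
by apply: esum_ge; exists X => //; split=> // x /XA /AB.
Qed.

Variables (V : set config) (s : D -> R) (f : config -> R).
Hypotheses (V_down : forall c c', le_config c c' -> V c' -> V c)
  (s0 : forall z, 0 <= s z) (f0 : forall c, 0 <= f c).

Let F (c : config) : \bar R := (config_weight s c * f c)%:E.

Let F0 c : (0 <= F c)%E.
Proof. by rewrite lee_fin mulr_ge0 // config_weight_ge0. Qed.

(** Removing [e] is injective on the configurations that contain it, divides the weight by that of
    [e], and leaves a member of [V] since [V] is closed downwards. *)
Lemma esum_shift (e : config) (y : R) : 0 <= y ->
  (forall c, f (add_config c e) <= y * f c) ->
  (\esum_(c in V `&` [set c | le_config e c]) F c <=
   (config_weight s e * y)%:E * \esum_(c in V) F c)%E.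
Proof.
move=> y0 fe; pose V' := [set c | V (add_config c e)].
rewrite (reindex_esum V' _ (fun c => add_config c e)); last first.
  split=> [c Vc|c c' _ _ /ffunP cc'|c [Vc /forallP ec]].
  - by split=> //; apply/forallP => z; rewrite ffunE leq_addl.
  - by apply/ffunP => z; have := cc' z; rewrite !ffunE => /addIn.
  - have cE : add_config [ffun z => (c z - e z)%N] e = c.
      by apply/ffunP => z; rewrite !ffunE subnK.
    by exists [ffun z => (c z - e z)%N] => //; rewrite /V' /= cE.
rewrite -esumZl; last 2 first.
- by rewrite mulr_ge0 // config_weight_ge0.
- by move=> c _; exact: F0.
apply: (@le_trans _ _ (\esum_(c in V') ((config_weight s e * y)%:E * F c))%E).
  apply: le_esum => c _; rewrite /F config_weight_add -EFinM lee_fin.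
  rewrite mulrACA [config_weight s e * _]mulrC.
  by rewrite ler_wpM2l // mulr_ge0 // config_weight_ge0.
apply: esum_subset => [c|c _]; last first.
  by rewrite mule_ge0 // lee_fin mulr_ge0 // config_weight_ge0.
apply: V_down; by apply/forallP => z; rewrite ffunE leq_addr.
Qed.

(** A union bound over the forbidden patterns [E], each estimated by [esum_shift]. It bounds the
    whole sum by its restricted part plus a small multiple of itself. *)
Lemma esum_peierls (E : seq config) (y : R) : 0 <= y ->
  (forall c e, e \in E -> f (add_config c e) <= y * f c) ->
  (\esum_(c in V) F c <= \esum_(c in V `&` [set c | ~~ has (fun e => le_config e c) E]) F c
    + ((\sum_(e <- E) config_weight s e) * y)%:E * \esum_(c in V) F c)%E.
Proof.
move=> y0; elim: E => [|e E IH] fE.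
  by rewrite big_nil mul0r mul0e adde0; apply: esum_subset => // c Vc; split.
apply: (le_trans (IH _)); first by move=> c e' e'E; apply: fE; rewrite inE e'E orbT.
rewrite big_cons mulrDl EFinD ge0_muleDl; last 2 first.
- by rewrite lee_fin mulr_ge0 // config_weight_ge0.
- by rewrite lee_fin mulr_ge0 // sumr_ge0 // => *; rewrite config_weight_ge0.
rewrite addeA leeD2r // (esumID [set c | ~~ le_config e c]) //.
apply: leeD.
  apply: esum_subset => // c [[Vc /= cE] ce]; split=> //=.
  by rewrite negb_or ce.
apply: le_trans (esum_shift y0 _); last by move=> c; apply: fE; rewrite mem_head.
by apply: esum_subset => // c [[Vc _] /= /negP]; rewrite negbK.
Qed.

End Peierls.

(** Deleting one occurrence of d turns a chain of [M'] into a chain of [M]. *)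
Lemma maximal_length_unit (T : eqType) (e : rel T) (M M' : T -> nat) d n n' :
  transitive e -> (forall z, M' z = (M z + (z == d))%N) ->
  maximal_length e M n -> maximal_length e M' n' -> (n <= n' <= n.+1)%N.
Proof.
move=> tr MM' Ln Ln'; apply/andP; split.
  by apply: maximal_length_mono Ln Ln' => z; rewrite MM' leq_addr.
case: Ln' => -[s [se sM] <-] _; have [_ Hn] := Ln.
have [ds|ds] := boolP (d \in s); last first.
  apply: leqW; apply: Hn; split => // z; have := sM z; rewrite MM'.
  by case: eqP => [->|_]; rewrite ?addn0 // (count_memPn ds).
have := size_rem ds; case: s se sM ds => [//|x s] se sM ds sz.
rewrite -[size _]/(size (x :: s)).-1.+1 -sz ltnS; apply: Hn; split.
  exact: (subseq_sorted tr (rem_subseq _ _) se).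
move=> z; have := sM z; rewrite MM' (permP (perm_to_rem ds)) /= [d == z]eq_sym; case: eqP => _ /=.
  by rewrite addnC leq_add2r.
by rewrite addn0.
Qed.

Section GrowthBound.
Variables (R : realType) (D : finType) (e : rel D) (Lc : {ffun D -> nat} -> nat).
Hypotheses (e_tr : transitive e)
  (LcP : forall c : {ffun D -> nat}, maximal_length e c (Lc c)).

Lemma expr_length_unit (x : R) c d : 0 < x ->
  x ^+ Lc (add_config c (unit_config d)) <= Num.max 1 x * x ^+ Lc c.
Proof.
move=> x0.
have /andP[l1 l2] : (Lc c <= Lc (add_config c (unit_config d)) <= (Lc c).+1)%N.
  by apply: (maximal_length_unit (d := d) e_tr _ (LcP _) (LcP _)) => z; rewrite !ffunE.
have [|/eqP E] : Lc (add_config c (unit_config d)) = Lc c \/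
  (Lc (add_config c (unit_config d)) == (Lc c).+1).
- by move: l2; rewrite leq_eqVlt => /orP[->|]; [right|rewrite ltnS => l3; left; apply/eqP;
    rewrite eqn_leq l3].
- by move=> ->; rewrite ler_peMl ?exprn_ge0 ?(ltW x0) // le_max lexx.
- by rewrite E exprS ler_wpM2r ?exprn_ge0 ?(ltW x0) // le_max lexx orbT.
Qed.

End GrowthBound.

(** * Letters and strips *)

(** Makes blocks countable: the measurability arguments take unions over finite lists of labels, and
    Borel-Cantelli enumerates the pairs of blocks. *)
Definition block_code (a : block) : nat + nat + bool :=
  match a with
  | BDot i => inl (inl i)
  | BPrime i => inl (inr i)
  | BSeg => inr true
  | BSigma => inr false
  end.

Definition block_decode (x : nat + nat + bool) : block :=
  match x with
  | inl (inl i) => BDot i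
  | inl (inr i) => BPrime i
  | inr true => BSeg
  | inr false => BSigma
  end.

Lemma block_codeK : cancel block_code block_decode. Proof. by case. Qed.

HB.instance Definition _ := Countable.copy block (can_type block_codeK).

Section Strips.
Variables (R : realType) (N : nat).

(** The minimum with N puts the endpoint 1 in the last strip; accordingly [strip_itv] closes that
    strip on the right. *)
Definition strip_index (x : R) : 'I_N.+1 := inord (minn (Num.truncn (x * N.+1%:R)) N).

Definition strip_itv (k : 'I_N.+1) : set R :=
  [set` Interval (BLeft (k%:R / N.+1%:R)) (BSide (k < N)%N (k.+1%:R / N.+1%:R))].

Lemma strip_point_subproof (k : 'I_N.+1) : 0 <= k%:R / N.+1%:R :> R /\ k%:R / N.+1%:R <= 1 :> R.
Proof. by rewrite divr_ge0 // ler_pdivrMr ?ltr0n // mul1r ler_nat ltnW. Qed.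

Definition strip_point (k : 'I_N.+1) : {i01 R} :=
  Itv01 (strip_point_subproof k).1 (strip_point_subproof k).2.

Lemma strip_index_point k : strip_index (strip_point k)%:num = k.
Proof.
rewrite /strip_index /= divfK ?pnatr_eq0 // natrK; apply: val_inj.
by rewrite (minn_idPl _) /= ?inordK // -ltnS.
Qed.

Lemma le_strip_index (x y : R) : x <= y -> (strip_index x <= strip_index y)%N.
Proof.
move=> xy; rewrite /strip_index !inordK ?ltnS ?geq_minr //.
by rewrite leq_min geq_minr andbT geq_min le_truncn // ler_wpM2r.
Qed.

Lemma strip_indexE (x : R) k : 0 <= x <= 1 -> (strip_index x == k) = (x \in strip_itv k).
Proof.
move=> /andP[u0 u1].
have N0 : 0 < N.+1%:R :> R by rewrite ltr0n.
rewrite /strip_itv mem_setE in_itv /= ler_pdivrMr // -truncn_ge_nat ?mulr_ge0 //.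
rewrite -val_eqE /= /strip_index inordK ?ltnS ?geq_minr //.
case: ltnP => kN /=.
  rewrite ltr_pdivlMr // -truncn_lt_nat ?mulr_ge0 //.
  set t := Num.truncn _; case: (leqP t N) => tN.
    by rewrite ltnS andbC -eqn_leq.
  by rewrite gtn_eqF // ltnS (leqNgt t) (ltn_trans kN tN) andbF.
have -> : k = N :> nat by apply/eqP; rewrite eqn_leq kN -ltnS ltn_ord.
rewrite divff ?pnatr_eq0 // u1 andbT; case: leqP => tN; rewrite ?eqxx // ltn_eqF //.
Qed.

Lemma uniform_strip k : uniform_prob (@ltr01 R) (strip_itv k) = (N.+1%:R^-1)%:E.
Proof.
have N0 : 0 < N.+1%:R :> R by rewrite ltr0n.
rewrite /uniform_prob (eq_integral (fun=> 1%E)).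
  rewrite integral_cst /strip_itv //= mul1e lebesgue_measure_itv /= lte_fin.
  rewrite ltr_pM2r ?invr_gt0 // ltr_nat ltnSn -EFinB -mulrBl; congr EFin.
  by rewrite -natrB // subSnn mul1r.
move=> x; rewrite inE /strip_itv /= in_itv /= /uniform_pdf => /andP[x0 x1].
have kN : k.+1%:R / N.+1%:R <= 1 :> R.
  by rewrite ler_pdivrMr // mul1r ler_nat.
rewrite subr0 invr1 (le_trans _ x0) ?divr_ge0 //= ifT //.
by case: (k < N)%N x1 => /= [/ltW|] x1; apply: le_trans x1 _.
Qed.

End Strips.

Section Letters.
Variables (R : realType) (n N : nat).

(* The letters are Sigma, the first n letters of each kind and N.+1 strips. *)
Definition letter := option ('I_n + 'I_n + 'I_N.+1).

Definition letter_block (x : letter) : block :=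
  match x with
  | None => BSigma
  | Some (inl (inl i)) => BDot i
  | Some (inl (inr i)) => BPrime i
  | Some (inr _) => BSeg
  end.

Definition letter_point (x : letter) : Omegap R :=
  match x with
  | None => None
  | Some (inl (inl i)) => Some (Defs.Dot i)
  | Some (inl (inr i)) => Some (Prime i)
  | Some (inr k) => Some (Seg (strip_point R k))
  end.

(** Dots and primes of index n or more fall back on Sigma; the lemmas below assume the block to be
    in [small_blocks n], where this does not happen. *)
Definition letter_of (a : block) (u : {i01 R}) : letter :=
  match a with
  | BSigma => None
  | BSeg => Some (inr (strip_index N u%:num))
  | BDot i => omap (fun i => inl (inl i)) (insub i)
  | BPrime i => omap (fun i => inl (inr i)) (insub i)
  end.

Definition letter_param (p : parameter_set R) (al : R) (x : letter) : R :=
  match x with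
  | None => al
  | Some (inl (inl i)) => par_q p i
  | Some (inl (inr i)) => par_r p i
  | Some (inr _) => par_t p / N.+1%:R
  end.

Definition small_blocks : seq block :=
  [:: BSeg; BSigma] ++ [seq BDot i | i <- iota 0 n] ++ [seq BPrime i | i <- iota 0 n].

Lemma small_blocks_uniq : uniq small_blocks.
Proof.
rewrite /small_blocks /= !inE /= !mem_cat.
have nd (b : block) : (forall i, b != BDot i) -> b \notin [seq BDot i | i <- iota 0 n].
  by move=> H; apply/negP => /mapP[i _ E]; move: (H i); rewrite E eqxx.
have np (b : block) : (forall i, b != BPrime i) -> b \notin [seq BPrime i | i <- iota 0 n].
  by move=> H; apply/negP => /mapP[i _ E]; move: (H i); rewrite E eqxx.
rewrite !negb_or !nd // !np //= cat_uniq !map_inj_uniq ?iota_uniq //=; last by move=> i j [].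
  by rewrite andbT; apply/hasPn => b /mapP[i _ ->]; exact: nd.
by move=> i j [].
Qed.

Lemma mem_small_blocks a : a \in small_blocks =
  match a with BDot i | BPrime i => (i < n)%N | _ => true end.
Proof.
rewrite /small_blocks !inE mem_cat; case: a => [|i|i|] //.
  have -> : (BDot i \in [seq BPrime i | i <- iota 0 n]) = false by apply/negP => /mapP[].
  by rewrite orbF mem_map ?mem_iota //= => j k [].
have -> : (BPrime i \in [seq BDot i | i <- iota 0 n]) = false by apply/negP => /mapP[].
by rewrite mem_map ?mem_iota //= => j k [].
Qed.

Lemma letter_block_small x : letter_block x \in small_blocks.
Proof. by rewrite mem_small_blocks; case: x => [[[i|i]|k]|] /=. Qed.

Lemma letter_block_of a u : a \in small_blocks -> letter_block (letter_of a u) = a.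
Proof.
rewrite mem_small_blocks; case: a => //= i iN; rewrite insubT //=.
Qed.

Lemma letter_point_inj : injective letter_point.
Proof.
move=> [[[i|i]|k]|] [[[j|j]|l]|] //=.
- by move=> [/val_inj->].
- by move=> [/val_inj->].
- move=> /(congr1 (fun x => if x is Some (Seg u) then strip_index N u%:num else ord0)).
  by rewrite !strip_index_point => ->.
Qed.

Lemma letter_of_point a u : a \in small_blocks -> a != BSeg ->
  letter_point (letter_of a u) = place a u.
Proof.
by rewrite mem_small_blocks; case: a => //= i iN _; rewrite insubT.
Qed.

Section Order.
Variables (le : rel (Omega R)) (hle : admissible_order le).

Definition le_letter : rel letter := fun x y =>
  extend_order le (letter_point x) (letter_point y).

Definition dot_letter : pred letter := fun x => is_dot (letter_point x).

Lemma extend_order_refl : reflexive (extend_order le).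
Proof. case=> //= x; exact: admissible_refl hle x. Qed.

Lemma extend_order_anti : antisymmetric (extend_order le).
Proof. by move=> [x|] [y|] //= /(admissible_anti hle) ->. Qed.

Lemma extend_order_trans : transitive (extend_order le).
Proof. move=> [y|] [x|] [z|] //=; exact: admissible_trans hle _ _ _. Qed.

Lemma extend_order_total : total (extend_order le).
Proof. by move=> [x|] [y|] //=; exact: admissible_total hle _ _. Qed.

Lemma le_letter_refl : reflexive le_letter.
Proof. by move=> x; exact: extend_order_refl. Qed.

Lemma le_letter_anti : antisymmetric le_letter.
Proof. by move=> x y /extend_order_anti /letter_point_inj. Qed.

Lemma le_letter_trans : transitive le_letter.
Proof. by move=> y x z; exact: extend_order_trans. Qed.

Lemma le_letter_total : total le_letter.
Proof. by move=> x y; exact: extend_order_total. Qed.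

(* The position of x in the order is inside the strip k. *)
Definition cuts (x : letter) (k : 'I_N.+1) : Prop :=
  exists u v : {i01 R}, [/\ strip_index N u%:num = k, strip_index N v%:num = k &
    extend_order le (Some (Seg u)) (letter_point x) !=
    extend_order le (Some (Seg v)) (letter_point x)].

Definition ambiguous (k : 'I_N.+1) : bool :=
  `[< exists2 x : letter, ~~ (letter_block x == BSeg) & cuts x k >].

(** The points of the segment below x form an initial segment of it. If strip k comes before strip l
    and some point of l is below x, then so is all of k. *)
Lemma cuts_uniq x k l : cuts x k -> cuts x l -> k = l.
Proof.
case: x => [x|]; last by move=> [u [v []]].
wlog kl : k l / (k < l)%N => [H ck cl|].
  case: (ltngtP k l) => [kl|lk|/val_inj//]; first exact: H ck cl.
  by apply/esym/(H _ _ lk cl ck).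
have up j : cuts (Some x) j -> (exists u : {i01 R}, strip_index N u%:num = j /\
     extend_order le (Some (Seg u)) (letter_point (Some x))) /\
   (exists u : {i01 R}, strip_index N u%:num = j /\
     ~~ extend_order le (Some (Seg u)) (letter_point (Some x))).
  move=> [u [v [uj vj]]]; case E: (extend_order le (Some (Seg u)) _);
  case F: (extend_order le (Some (Seg v)) _) => // _.
    by split; [exists u | exists v; rewrite F].
  by split; [exists v | exists u; rewrite E].
move=> /up[_ [v [vk nv]]] /up[[u [ul ux]] _].
case/negP: nv; apply: extend_order_trans ux => /=; rewrite (admissible_seg hle).
have [//|uv] := leP v%:num u%:num.
by have := le_strip_index N (ltW uv); rewrite ul vk leqNgt kl.
Qed.

Lemma card_ambiguous : (#|[pred k | ambiguous k]| <= (n + n).+1)%N.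
Proof.
have choice_cut k : exists x : letter, ambiguous k -> ~~ (letter_block x == BSeg) /\ cuts x k.
  case: (boolP (ambiguous k)) => [/asboolP[x bx cx]|_]; first by exists x.
  by exists None.
have [f fP] := choice choice_cut.
(* Neither Sigma nor a strip is the chosen letter of an ambiguous strip, so [g] is injective on
   these. The default [None] accounts for the +1 in the bound. *)
pose g (k : 'I_N.+1) : option ('I_n + 'I_n) := if f k is Some (inl x) then Some x else None.
have fg k : ambiguous k -> f k = omap inl (g k).
  by rewrite /g => /fP[]; case: (f k) => [[x|l]|].
rewrite -(card_in_imset (f := g)); last first.
  move=> k l ak al gkl; apply: (cuts_uniq (fP k ak).2).
  by rewrite (fg k) // gkl -fg //; exact: (fP l al).2.
apply: (leq_trans (max_card _)).
by rewrite card_option card_sum card_ord.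
Qed.

(** Each point of the segment is replaced by the left end of its strip. Two points in different
    strips keep their order, and a letter that does not cut the strip is on the same side of
    both. *)
Lemma compare_letter_of a a' (u u' : {i01 R}) :
  a \in small_blocks -> a' \in small_blocks ->
  (a = BSeg -> a' = BSeg -> strip_index N u%:num <> strip_index N u'%:num) ->
  (a = BSeg -> ~~ ambiguous (strip_index N u%:num)) ->
  (a' = BSeg -> ~~ ambiguous (strip_index N u'%:num)) ->
  extend_order le (place a u) (place a' u') = le_letter (letter_of a u) (letter_of a' u') /\
  ((place a u == place a' u') ==> ~~ is_dot (place a u)) =
  ((letter_of a u == letter_of a' u') ==> ~~ dot_letter (letter_of a u)).
Proof.
move=> sa sa' ss am am'; rewrite /dot_letter /le_letter.
have cmp (v v' : {i01 R}) x : x \in small_blocks -> x != BSeg ->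
    ~~ ambiguous (strip_index N v%:num) ->
    extend_order le (Some (Seg v)) (place x v') =
    extend_order le (Some (Seg (strip_point R (strip_index N v%:num)))) (place x v').
  move=> sx xS /asboolPn H; rewrite -(letter_of_point v' sx xS).
  apply/eqP; apply/negPn/negP => neq.
  apply: H; exists (letter_of x v'); first by rewrite letter_block_of.
  exists v, (strip_point R (strip_index N v%:num)).
  by rewrite strip_index_point.
(* Reduces comparisons whose second term is in the segment to those of [cmp], by totality and
   antisymmetry. *)
have flip (x y : Omegap R) : x != y -> extend_order le x y = ~~ extend_order le y x.
  move=> xy; have := extend_order_total x y; have := @extend_order_anti x y.
  case: (extend_order le x y); case: (extend_order le y x) => //= /(_ isT) E _.
  by rewrite E eqxx in xy.
have [aS|aS] := eqVneq a BSeg; have [a'S|a'S] := eqVneq a' BSeg.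
- move: ss; rewrite aS a'S /= => /(_ erefl erefl) ss; rewrite !implybT; split => //.
  rewrite !(admissible_seg hle) /=.
  case: (ltgtP (u%:num : R) u'%:num) => [uu'|u'u|E]; last by rewrite E in ss.
  + have : (strip_index N u%:num < strip_index N u'%:num)%N.
      by rewrite ltn_neqAle (le_strip_index _ (ltW uu')) andbT; apply/eqP => /val_inj.
    by rewrite ler_pM2r ?invr_gt0 ?ltr0n // ler_nat => /ltnW ->.
  + have : (strip_index N u'%:num < strip_index N u%:num)%N.
      by rewrite ltn_neqAle (le_strip_index _ (ltW u'u)) andbT; apply/eqP => /val_inj /esym.
    move=> lt; by rewrite ler_pM2r ?invr_gt0 ?ltr0n // ler_nat leqNgt lt.
- rewrite aS in am *; rewrite (letter_of_point u' sa' a'S) /= implybT implybT; split => //.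
  by apply: cmp => //; exact: am.
- rewrite a'S in am' *; rewrite (letter_of_point u sa aS).
  have pn v : place a u != Some (Seg v) by apply/eqP; case: (a) aS.
  have ln : (letter_of a u == letter_of BSeg u') = false.
    apply/negP => /eqP /(congr1 letter_block); rewrite letter_block_of //= => E.
    by rewrite E eqxx in aS.
  rewrite ln (negPf (pn _)) /=; split => //.
  rewrite (flip _ (Some (Seg u'))) ?pn // [in RHS](flip (place a u)) ?pn //.
  by rewrite (cmp _ u) //; exact: am'.
- rewrite !letter_of_point //; split => //; rewrite -(inj_eq letter_point_inj).
  by rewrite !letter_of_point.
Qed.

End Order.
End Letters.

(** * Discretization of the random multiset *)

Lemma lambda1_maximal (R : realType) (lep lem : rel (Omega R)) M m :
  maximal_length (increasing_step lep lem) M m -> lambda1 lep lem M = m.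
Proof.
move=> Mm; rewrite /lambda1; apply: (maximal_length_uniq _ Mm).
exact: (@xgetPex _ 0%N _ (ex_intro _ m Mm)).
Qed.

Lemma count_sum (T : Type) (P : pred T) (s : seq T) : count P s = (\sum_(i <- s) P i)%N.
Proof. by rewrite -sum1_count big_mkcond; apply: eq_bigr => i _; case: (P i). Qed.

Lemma ex_config_maximal_length (D : finType) (e : rel D) (c : {ffun D -> nat}) :
  exists m, maximal_length e c m.
Proof.
pose r := [seq (d, k) | d <- enum D, k <- iota 0 (c d)].
have ur : uniq r.
  apply: allpairs_uniq_dep; [exact: enum_uniq | by move=> d _; exact: iota_uniq|].
  by move=> [d k] [d' k'] _ _ [-> ->].
have [m Hm] := ex_maximal_length fst e ur; exists m.
apply: eq_maximal_length Hm => z; rewrite count_map count_sum big_allpairs_dep big_enum /=.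
rewrite (bigD1 z) //= [X in (_ + X)%N]big1 ?addn0.
  by rewrite -[RHS](size_iota 0) -sum1_size; apply: eq_bigr => k _; rewrite eqxx.
by move=> d /negPf dz; rewrite big1 // => k _; rewrite dz.
Qed.

Section Discretization.
Variables (d : measure_display) (T : measurableType d) (R : realType) (P : probability T R)
  (pp pm : parameter_set R) (ap am : R) (M : extended_model P pp pm ap am).

Definition block_pairs (n : nat) : seq (block * block) :=
  [seq (a, b) | a <- small_blocks n, b <- small_blocks n].

Lemma block_pairs_uniq n : uniq (block_pairs n).
Proof. by apply: allpairs_uniq => [||[a b] [a' b'] _ _ /= [-> ->] //]; exact: small_blocks_uniq.
    Qed.

Lemma mem_block_pairs n ab :
  (ab \in block_pairs n) = (ab.1 \in small_blocks n) && (ab.2 \in small_blocks n).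
Proof.
apply/allpairsP/andP => [[[a b] [/= sa sb ->]] //|[sa sb]].
by exists ab; rewrite -surjective_pairing.
Qed.

Lemma block_pairs_sub m n : (m <= n)%N -> {subset block_pairs m <= block_pairs n}.
Proof.
move=> mn [a b]; rewrite !mem_block_pairs !mem_small_blocks /= => /andP[ha hb]; apply/andP; split.
  by case: a ha => // i /leq_trans; apply.
by case: b hb => // i /leq_trans; apply.
Qed.

Definition points_in (bl : seq (block * block)) (w : T) : seq (block * block * nat) :=
  [seq (ab, k) | ab <- bl, k <- iota 0 (npoints M ab.1 ab.2 w)].

Definition point_site (w : T) (i : block * block * nat) : Omegap R * Omegap R :=
  site M w i.1.1 i.1.2 i.2.

(** The list of products of blocks is arbitrary because the measurability of [lambda1] uses a union
    over all such lists, whereas the truncation uses [block_pairs n]. *)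
Definition restricted_multiset (bl : seq (block * block)) (w : T) (z : Omegap R * Omegap R) :
    nat :=
  if (block_of z.1, block_of z.2) \in bl then random_multiset M w z else 0.

Lemma points_in_uniq bl w : uniq bl -> uniq (points_in bl w).
Proof.
move=> ubl; apply: allpairs_uniq_dep => [//|ab _|]; first exact: iota_uniq.
by move=> [ab k] [ab' k'] _ _ /= [-> ->].
Qed.

Lemma mem_points_in bl w i :
  (i \in points_in bl w) = (i.1 \in bl) && (i.2 < npoints M i.1.1 i.1.2 w)%N.
Proof.
case: i => ab k /=; apply/allpairsPdep/andP => [[ab' [k' [abs]]]|[abs kM]].
  by rewrite mem_iota /= => kM [-> ->].
by exists ab, k; rewrite mem_iota.
Qed.

Lemma block_of_place (a : block) (u : {i01 R}) : block_of (place a u) = a.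
Proof. by case: a. Qed.

Lemma restricted_multisetE bl w z : uniq bl ->
  restricted_multiset bl w z = count_mem z [seq point_site w i | i <- points_in bl w].
Proof.
move=> ubl; rewrite count_map count_sum big_allpairs_dep /= /restricted_multiset.
have out ab k : ab != (block_of z.1, block_of z.2) -> (point_site w (ab, k) == z) = false.
  move=> abz; apply: contraNF abz => /eqP <-.
  by case: ab => a b; rewrite /point_site /site /= !block_of_place.
case: ifPn => [zn|zn]; last first.
  rewrite big_seq big1 // => ab abn; rewrite big1 // => k _; rewrite out //.
  by apply: contraNN zn => /eqP<-.
rewrite (bigD1_seq _ zn) //= [X in (_ + X)%N]big1 ?addn0; last first.
  by move=> ab abz; rewrite big1 // => k _; rewrite out.
rewrite /random_multiset -sum1_card big_mkcond /=.
set m := npoints _ _ _ _; have -> : iota 0 m = index_iota 0 m by rewrite /index_iota subn0.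
by rewrite big_mkord; apply: eq_bigr => k _; rewrite inE; case: ifP.
Qed.

Variables (n N : nat) (lep lem : rel (Omega R)).

Lemma lambda1_restrictedP bl w : uniq bl ->
  maximal_length (increasing_step lep lem) (restricted_multiset bl w)
    (lambda1 lep lem (restricted_multiset bl w)).
Proof.
move=> ubl.
have [m Hm] := ex_maximal_length (point_site w) (increasing_step lep lem) (points_in_uniq w ubl).
suff Hm' : maximal_length (increasing_step lep lem) (restricted_multiset bl w) m.
  by rewrite (lambda1_maximal Hm').
by apply: eq_maximal_length Hm => z; rewrite restricted_multisetE.
Qed.

Definition points : T -> seq (block * block * nat) := points_in (block_pairs n).

Definition truncated_multiset := restricted_multiset (block_pairs n).

Lemma points_uniq w : uniq (points w).
Proof. exact/points_in_uniq/block_pairs_uniq. Qed.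

Lemma mem_points w i : (i \in points w) =
  [&& i.1.1 \in small_blocks n, i.1.2 \in small_blocks n & (i.2 < npoints M i.1.1 i.1.2 w)%N].
Proof. by rewrite mem_points_in mem_block_pairs andbA. Qed.

Local Notation letter := (letter n N).
Local Notation letter_of := (letter_of n N).

Definition point_cell (w : T) (i : block * block * nat) : letter * letter :=
  (letter_of i.1.1 (abscissa M i.1.2 i.2 w), letter_of i.1.2 (ordinate M i.1.1 i.2 w)).

Definition cell_config (w : T) : {ffun letter * letter -> nat} :=
  [ffun z => count_mem z [seq point_cell w i | i <- points w]].

Hypotheses (hlep : admissible_order lep) (hlem : admissible_order lem).

Definition strip_letter (k : 'I_N.+1) : letter := Some (inr k).

(* A configuration is simple when no strip holds two points and no strip cut by
   a letter holds a point; the order of its points is then that of the letters. *)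
Definition forbidden : seq {ffun letter * letter -> nat} :=
  [seq add_config (unit_config (strip_letter p.1.1, p.1.2)) (unit_config (strip_letter p.1.1,
      p.2))
     | p <- enum {: 'I_N.+1 * letter * letter}] ++
  [seq add_config (unit_config (p.1.2, strip_letter p.1.1)) (unit_config (p.2, strip_letter
      p.1.1))
     | p <- enum {: 'I_N.+1 * letter * letter}] ++
  [seq unit_config (strip_letter p.1, p.2)
     | p <- enum {: 'I_N.+1 * letter} & ambiguous n lep p.1] ++
  [seq unit_config (p.2, strip_letter p.1)
     | p <- enum {: 'I_N.+1 * letter} & ambiguous n lem p.1].

Definition simple_config (c : {ffun letter * letter -> nat}) : bool :=
  ~~ has (fun e => le_config e c) forbidden.

Lemma simple_configP c : simple_config c ->
  [/\ forall k y y', ~~ le_config (add_config (unit_config (strip_letter k, y))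
                                     (unit_config (strip_letter k, y'))) c,
      forall k x x', ~~ le_config (add_config (unit_config (x, strip_letter k))
                                     (unit_config (x', strip_letter k))) c,
      forall k y, ambiguous n lep k -> ~~ le_config (unit_config (strip_letter k, y)) c &
      forall k x, ambiguous n lem k -> ~~ le_config (unit_config (x, strip_letter k)) c].
Proof.
move=> /hasPn H; split=> [k y y'|k x x'|k y ak|k x ak]; apply: H; rewrite !mem_cat.
- by apply/orP; left; apply/mapP; exists (k, y, y'); rewrite ?mem_enum.
- by apply/orP; right; apply/orP; left; apply/mapP; exists (k, x, x'); rewrite ?mem_enum.
- apply/orP; right; apply/orP; right; apply/orP; left; apply/mapP; exists (k, y) => //.
  by rewrite mem_filter ak mem_enum.
- apply/orP; right; apply/orP; right; apply/orP; right; apply/mapP; exists (k, x) => //.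
  by rewrite mem_filter ak mem_enum.
Qed.

Lemma le_unit_cell_config w i : i \in points w ->
  le_config (unit_config (point_cell w i)) (cell_config w).
Proof.
move=> ip; apply/forallP => z; rewrite !ffunE.
have := @count_map_sub _ _ (point_cell w) (points w) [:: i] z isT.
rewrite /= addn0 eq_sym; apply => j; by rewrite inE => /eqP->.
Qed.

Lemma le_units_cell_config w i j : i \in points w -> j \in points w -> i != j ->
  le_config (add_config (unit_config (point_cell w i)) (unit_config (point_cell w j)))
    (cell_config w).
Proof.
move=> ip jp ij; apply/forallP => z; rewrite !ffunE.
have := @count_map_sub _ _ (point_cell w) (points w) [:: i; j] z.
rewrite /= addn0 ![_ == z]eq_sym inE ij => /(_ isT); apply => k.
by rewrite !inE => /orP[] /eqP->.
Qed.

Local Notation letter_step := (grid_step (@le_letter R n N lep) (@le_letter R n N lem)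
  (@dot_letter R n N) (@dot_letter R n N)).

Lemma simple_step w : simple_config (cell_config w) ->
  {in points w &, forall i j, i != j ->
    increasing_step lep lem (point_site w i) (point_site w j) =
    letter_step (point_cell w i) (point_cell w j)}.
Proof.
move=> /simple_configP[s1 s2 s3 s4] i j ip jp ij.
have := ip; rewrite mem_points => /and3P[i1 i2 _].
have := jp; rewrite mem_points => /and3P[j1 j2 _].
have lij := le_units_cell_config ip jp ij.
have li := le_unit_cell_config ip; have lj := le_unit_cell_config jp.
have [] := @compare_letter_of R n N lep hlep i.1.1 j.1.1 (abscissa M i.1.2 i.2 w)
   (abscissa M j.1.2 j.2 w) i1 j1.
- move=> iS jS E; move: lij; rewrite /point_cell iS jS /= E; exact/negP/s1.
- move=> iS; apply/negP => amb; move: li; rewrite /point_cell iS /=; exact/negP/s3.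
- move=> jS; apply/negP => amb; move: lj; rewrite /point_cell jS /=; exact/negP/s3.
move=> c1 c2.
have [] := @compare_letter_of R n N lem hlem i.1.2 j.1.2 (ordinate M i.1.1 i.2 w)
   (ordinate M j.1.1 j.2 w) i2 j2.
- move=> iS jS E; move: lij; rewrite /point_cell iS jS /= E; exact/negP/s2.
- move=> iS; apply/negP => amb; move: li; rewrite /point_cell iS /=; exact/negP/s4.
- move=> jS; apply/negP => amb; move: lj; rewrite /point_cell jS /=; exact/negP/s4.
by move=> c3 c4; rewrite /increasing_step /grid_step /point_site /site /= c1 c2 c3 c4.
Qed.

Lemma simple_maximal_length w : simple_config (cell_config w) ->
  maximal_length letter_step (cell_config w) (lambda1 lep lem (truncated_multiset w)).
Proof.
move=> sc; apply: (eq_maximal_length (M := fun z => count_mem z (map (point_cell w) (points w)))).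
  by move=> z; rewrite ffunE.
apply: maximal_length_map (points_uniq w) (simple_step sc) _.
apply: eq_maximal_length (lambda1_restrictedP w (block_pairs_uniq n)) => z.
by rewrite restricted_multisetE // block_pairs_uniq.
Qed.

End Discretization.

(** * Law of the discretized configuration *)

Lemma in_bigsetI (I : eqType) (T : Type) (J : seq I) (A : I -> set T) w :
  (\big[setI/setT]_(i <- J) A i) w <-> forall i, i \in J -> A i w.
Proof.
elim: J => [|i J IH]; first by rewrite big_nil; split.
rewrite big_cons; split=> [[Ai /IH AJ] j|H].
  by rewrite inE => /orP[/eqP->//|/AJ].
split; first by apply: H; rewrite mem_head.
by apply/IH => j jJ; apply: H; rewrite inE jJ orbT.
Qed.

Lemma in_bigsetU (I : eqType) (T : Type) (J : seq I) (A : I -> set T) w :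
  (\big[setU/set0]_(i <- J) A i) w <-> exists2 i, i \in J & A i w.
Proof.
elim: J => [|i J IH]; first by rewrite big_nil; split => // -[].
rewrite big_cons; split=> [[Ai|/IH[j jJ Aj]]|[j]].
- by exists i; rewrite ?mem_head.
- by exists j; rewrite // inE jJ orbT.
- by rewrite inE => /orP[/eqP->|jJ] Aj; [left|right; apply/IH; exists j].
Qed.

Section ProductOfUnions.
Variables (d : measure_display) (T : measurableType d) (R : realType) (P : probability T R).
Variables (I L : eqType).

Lemma measure_bigsetU_seq (S : seq L) (F : L -> set T) : uniq S ->
  {in S, forall l, measurable (F l)} ->
  (forall l l', l != l' -> F l `&` F l' = set0) ->
  (P (\big[setU/set0]_(l <- S) F l) = \sum_(l <- S) P (F l))%E.
Proof.
move=> + + dF; elim: S => [|l S IH] /=; first by rewrite !big_nil measure0.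
move=> /andP[lS uS] mF.
have mFS : {in S, forall l, measurable (F l)} by move=> l' l'S; apply: mF; rewrite inE l'S orbT.
rewrite !big_cons measureU.
- by congr (_ + _)%E; exact: IH.
- by apply: mF; rewrite mem_head.
- by rewrite big_seq; exact: bigsetU_measurable.
- rewrite -subset0 => w [Fl /in_bigsetU[l' l'S Fl']].
  by rewrite -(dF l l') //; apply: contraNneq lS => ->.
Qed.

(** Independence is known for one event per index. Each union is disjoint, so distributing it over
    the intersection, one index at a time, extends the product formula to the unions. *)
Lemma prob_bigsetI_bigsetU (E : I -> L -> set T) (S : I -> seq L) (J : seq I) (p : I -> L -> R) :
  (forall i l, i \in J -> l \in S i -> measurable (E i l)) ->
  (forall i l l', l != l' -> E i l `&` E i l' = set0) ->
  (forall i, uniq (S i)) ->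
  (forall K (f : I -> L), uniq K -> {subset K <= J} -> (forall i, i \in K -> f i \in S i) ->
     P (\big[setI/setT]_(i <- K) E i (f i)) = (\prod_(i <- K) p i (f i))%:E) ->
  uniq J ->
  P (\big[setI/setT]_(i <- J) \big[setU/set0]_(l <- S i) E i l) =
  (\prod_(i <- J) \sum_(l <- S i) p i l)%:E.
Proof.
move=> mE dE uS pE uJ.
(* On [J1] the unions are still present; on [J2] one event [f i] has already been chosen in each of
   them. *)
suff H : forall J1 J2 (f : I -> L), uniq (J1 ++ J2) -> {subset J1 ++ J2 <= J} ->
   (forall i, i \in J2 -> f i \in S i) ->
   P ((\big[setI/setT]_(i <- J1) \big[setU/set0]_(l <- S i) E i l) `&`
      \big[setI/setT]_(i <- J2) E i (f i)) =
   ((\prod_(i <- J1) \sum_(l <- S i) p i l) * \prod_(i <- J2) p i (f i))%:E.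
  have [-> | [i0 i0J]] : J = [::] \/ exists i, i \in J.
  - by case: (J) => [|i J']; [left|right; exists i; rewrite mem_head].
  - by rewrite !big_nil probability_setT.
  (* A value in [L] is needed to start with some [f]. If [L] is empty, all lists [S i] are empty and
     both sides vanish. *)
  have [l0 |nl] := pselect (exists l : L, True).
    have := H J [::] (fun=> projT1 (cid l0)); rewrite cats0 !big_nil setIT mulr1.
    by apply.
  have S0 i : S i = [::] by case: (S i) => // l s; exfalso; apply: nl; exists l.
  rewrite (perm_big _ (perm_to_rem i0J)) [in RHS](perm_big _ (perm_to_rem i0J)) /=.
  by rewrite !big_cons S0 !big_nil set0I measure0 mul0r.
elim=> [|i J1 IH] J2 f uJ12 sJ fS.
  by rewrite !big_nil setTI mul1r pE.
have iJ2 : i \notin J2 by move: uJ12 => /= /andP[]; rewrite mem_cat negb_or => /andP[].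
pose f' l j := if j == i then l else f j.
have f'E l j : j \in J2 -> f' l j = f j.
  by rewrite /f' => jJ; case: eqP jJ iJ2 => // -> ->.
have setE : (\big[setI/setT]_(i <- i :: J1) \big[setU/set0]_(l <- S i) E i l) `&`
      \big[setI/setT]_(i <- J2) E i (f i) =
   \big[setU/set0]_(l <- S i) ((\big[setI/setT]_(i <- J1) \big[setU/set0]_(l <- S i) E i l) `&`
      \big[setI/setT]_(j <- i :: J2) E j (f' l j)).
  have E2 l : \big[setI/setT]_(j <- i :: J2) E j (f' l j) = E i l `&` \big[setI/setT]_(j <- J2)
      E j (f j).
    rewrite big_cons {1}/f' eqxx; congr (_ `&` _).
    by apply: eq_big_seq => j jJ2; rewrite f'E.
  apply/seteqP; split=> w.
    rewrite big_cons => -[[/in_bigsetU[l lS El] H1] H2]; apply/in_bigsetU; exists l => //.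
    by split => //; rewrite E2.
  move=> /in_bigsetU[l lS [H1]]; rewrite E2 => -[El H2]; split => //.
  by rewrite big_cons; split => //; apply/in_bigsetU; exists l.
rewrite setE measure_bigsetU_seq //; last 2 first.
- move=> l lS; apply: measurableI; rewrite big_seq; apply: bigsetI_measurable => j jJ.
    rewrite big_seq; apply: bigsetU_measurable => l' l'S; apply: mE => //.
    by apply: sJ; rewrite /= inE mem_cat jJ orbT.
  apply: mE; first by apply: sJ; move: jJ; rewrite /= !inE mem_cat => /orP[->//|->]; rewrite
      !orbT.
  by move: jJ; rewrite inE /f'; case: eqP => [->//|_] /= /fS.
- move=> l l' ll'; rewrite -subset0 => w [[_ /in_bigsetI Hl] [_ /in_bigsetI Hl']].
  rewrite -(dE i _ _ ll'); have := Hl i (mem_head _ _); have := Hl' i (mem_head _ _).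
  by rewrite /f' eqxx.
transitivity (\sum_(l <- S i) ((\prod_(i <- J1) \sum_(l <- S i) p i l) *
    (p i l * \prod_(i <- J2) p i (f i)))%:E)%E.
  apply: eq_big_seq => l lS; rewrite IH.
  - rewrite big_cons {1}/f' eqxx; congr (_ * (_ * _))%:E.
    by apply: eq_big_seq => j jJ2; rewrite f'E.
  - by rewrite -(perm_uniq (s1 := i :: J1 ++ J2)) // perm_sym -cat_cons perm_catC /= perm_cons
      perm_catC.
  - by move=> j; rewrite mem_cat inE orbCA -mem_cat -in_cons => /sJ.
  - by move=> j; rewrite inE /f'; case: eqP => [->//|_] /= /fS.
rewrite sumEFin -mulr_sumr -mulr_suml big_cons; congr EFin; by rewrite mulrCA mulrA.
Qed.

End ProductOfUnions.

Section LetterSum.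
Variables (n N : nat).

Lemma big_letter (S : Type) (idx : S) (op : Monoid.com_law idx) (F : letter n N -> S) :
  \big[op/idx]_x F x = op (F None)
    (op (op (\big[op/idx]_(i < n) F (Some (inl (inl i)))) (\big[op/idx]_(i < n) F (Some (inl
        (inr i)))))
      (\big[op/idx]_(k < N.+1) F (Some (inr k)))).
Proof.
rewrite (bigD1 None) //=; congr (op _ _).
rewrite (reindex_omap Some id) /=; last by case.
rewrite (eq_bigl xpredT) ?big_sumType ?big_sumType //=.
by move=> x; rewrite eqxx.
Qed.

End LetterSum.

Section CellProbability.
Variables (d : measure_display) (T : measurableType d) (R : realType) (P : probability T R)
  (pp pm : parameter_set R) (ap am : R) (M : extended_model P pp pm ap am) (n N : nat).
Local Notation letter := (letter n N).
Local Notation cell := (letter * letter)%type.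
Local Notation letter_of := (letter_of n N).

Definition letter_strip (x : letter) : 'I_N.+1 := if x is Some (inr k) then k else ord0.

Definition block_cells (w : T) (ab : block * block) : seq cell :=
  [seq point_cell M n N w (ab, k) | k <- iota 0 (npoints M ab.1 ab.2 w)].

Definition cell_block (z : cell) : block * block := (letter_block z.1, letter_block z.2).

(** The random variables that determine the cells of the first m points of a product of blocks; a
    coordinate is random only along the segment. *)
Definition block_sources (ab : block * block) (m : nat) : seq source :=
  Count ab.1 ab.2 :: [seq Abscissa ab.2 k | k <- iota 0 m & ab.1 == BSeg] ++
                     [seq Ordinate ab.1 k | k <- iota 0 m & ab.2 == BSeg].

Definition source_event (f : block * block -> seq cell) (s : source) : set T :=
  match s with
  | Count a b => [set w | npoints M a b w = size (f (a, b))]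
  | Abscissa b k => [set w | strip_itv
      (letter_strip (nth (None, None) (f (BSeg, b)) k).1) (abscissa M b k w)%:num]
  | Ordinate a k => [set w | strip_itv
      (letter_strip (nth (None, None) (f (a, BSeg)) k).2) (ordinate M a k w)%:num]
  end.

Lemma measurable_strip_itv k : measurable (@strip_itv R N k).
Proof. exact: measurable_itv. Qed.

Lemma source_event_generated f s :
  match s with
  | Count a b => generated_by (npoints M a b)
  | Abscissa b k => generated_by (fun w => (abscissa M b k w)%:num)
  | Ordinate a k => generated_by (fun w => (ordinate M a k w)%:num)
  end (source_event f s).
Proof.
case: s => [a b|b k|a k] /=.
- exists [set size (f (a, b))]; [by []|by rewrite setTI].
- exists (strip_itv (letter_strip (nth (None, None) (f (BSeg, b)) k).1)).
    exact: measurable_strip_itv.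
  by rewrite setTI.
- exists (strip_itv (letter_strip (nth (None, None) (f (a, BSeg)) k).2)).
    exact: measurable_strip_itv.
  by rewrite setTI.
Qed.

Lemma letter_strip_of a (u : {i01 R}) x : a \in small_blocks n -> a = BSeg -> letter_block x = a
    ->
  (letter_of a u == x) = (u%:num \in strip_itv (letter_strip x)).
Proof.
move=> sa ->; case: x => [[[i|i]|k]|] //= _; rewrite -strip_indexE; last by apply/andP; split.
by apply/eqP/eqP => [[->]|->].
Qed.

Lemma letter_ofE a (u : {i01 R}) x : a \in small_blocks n -> a != BSeg -> letter_block x = a ->
  letter_of a u = x.
Proof.
move=> sa aS; case: x => [[[i|i]|k]|] /= xa; rewrite -xa in aS * => //=.
- by have -> : insub (nat_of_ord i) = Some i := valK i.
- by have -> : insub (nat_of_ord i) = Some i := valK i.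
Qed.

(** The points are labelled, so the list of cells fixes the number of points and the strip of each
    random coordinate. The other coordinates are forced by the assumption that the cells lie in the
    right blocks. *)
Lemma block_event f ab : ab \in block_pairs n ->
  {in f ab, forall z, cell_block z = ab} ->
  [set w | block_cells w ab = f ab] =
  \big[setI/setT]_(s <- block_sources ab (size (f ab))) source_event f s.
Proof.
case: ab => a b; rewrite mem_block_pairs /= => /andP[sa sb] fab.
have fa k : (k < size (f (a, b)))%N -> letter_block (nth (None, None) (f (a, b)) k).1 = a.
  by move=> kf; have [] := fab _ (mem_nth (None, None) kf).
have fb k : (k < size (f (a, b)))%N -> letter_block (nth (None, None) (f (a, b)) k).2 = b.
  by move=> kf; have [] := fab _ (mem_nth (None, None) kf).
apply/seteqP; split=> w /=.
  move=> E; apply/in_bigsetI => s; rewrite inE mem_cat => /orP[/eqP->|/orP[]].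
  - by rewrite /= -E size_map size_iota.
  - case/mapP => k; rewrite mem_filter mem_iota /= => /andP[/eqP aS kf] -> /=.
    have /= := congr1 (fun l => (nth (None, None) l k).1) E.
    rewrite (nth_map 0%N); last by have := kf; rewrite -E size_map.
    rewrite nth_iota; last by have := kf; rewrite -E size_map size_iota.
    rewrite add0n /= => /eqP; rewrite letter_strip_of ?fa // -aS.
    by move=> /set_mem.
  - case/mapP => k; rewrite mem_filter mem_iota /= => /andP[/eqP bS kf] -> /=.
    have /= := congr1 (fun l => (nth (None, None) l k).2) E.
    rewrite (nth_map 0%N); last by have := kf; rewrite -E size_map.
    rewrite nth_iota; last by have := kf; rewrite -E size_map size_iota.
    rewrite add0n /= => /eqP; rewrite letter_strip_of ?fb // -bS.
    by move=> /set_mem.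
move=> /in_bigsetI H.
have /= sz := H (Count a b) (mem_head _ _).
apply: (@eq_from_nth _ (None, None)); first by rewrite size_map size_iota.
rewrite size_map size_iota /= sz => k kf.
rewrite (nth_map 0%N) ?size_iota ?sz // nth_iota // add0n.
rewrite [RHS]surjective_pairing /point_cell /=; congr (_, _).
  have [aS|aS] := eqVneq a BSeg; last exact: (letter_ofE _ sa aS (fa _ kf)).
  apply/eqP; rewrite letter_strip_of ?fa //; apply/mem_set.
  have := H (Abscissa b k); rewrite /= aS; apply.
  by rewrite inE mem_cat map_f ?orbT // mem_filter eqxx mem_iota -aS.
have [bS|bS] := eqVneq b BSeg; last exact: (letter_ofE _ sb bS (fb _ kf)).
apply/eqP; rewrite letter_strip_of ?fb //; apply/mem_set.
have := H (Ordinate a k); rewrite /= bS; apply.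
by rewrite inE mem_cat [X in _ || (_ || X)]map_f ?orbT // mem_filter eqxx mem_iota -bS.
Qed.

Definition strip_prob (a : block) (m : nat) : R :=
  if a == BSeg then N.+1%:R ^- m else 1.

Definition block_prob (ab : block * block) (l : seq cell) : R :=
  count_pmf pp pm ap am ab.1 ab.2 (size l) * (strip_prob ab.1 (size l) * strip_prob ab.2 (size
      l)).

(** An abscissa [Abscissa b k] serves the pair (BSeg, b) only and an ordinate [Ordinate a k] the
    pair (a, BSeg) only. Different pairs thus share no source, which makes their points
    independent. *)
Lemma block_sources_uniq (K : seq (block * block)) (m : block * block -> nat) : uniq K ->
  uniq (flatten [seq block_sources ab (m ab) | ab <- K]).
Proof.
pose own (s : source) : block * block := match s with
  | Count a b => (a, b) | Abscissa b _ => (BSeg, b) | Ordinate a _ => (a, BSeg) end.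
have ownE ab s : s \in block_sources ab (m ab) -> own s = ab.
  case: ab => a b; rewrite inE mem_cat => /orP[/eqP->//|/orP[]] /mapP[k];
  by rewrite mem_filter => /andP[/eqP /= -> _ ->].
elim: K => [//|ab K IH] /= /andP[abK uK].
change (uniq (block_sources ab (m ab) ++ flatten [seq block_sources ab (m ab) | ab <- K])).
rewrite cat_uniq IH // andbT; apply/andP; split.
  rewrite /= mem_cat negb_or -andbA; apply/and3P; split.
  - by apply/negP => /mapP[].
  - by apply/negP => /mapP[].
  rewrite cat_uniq !map_inj_uniq; last 2 first.
  - by move=> i j [].
  - by move=> i j [].
  rewrite !filter_uniq ?iota_uniq //= andbT.
  by apply/hasPn => s /mapP[k _ ->]; apply/negP => /mapP[].
apply/hasPn => s /flattenP[t /mapP[ab' ab'K ->]] /ownE sab'.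
by apply/negP => /ownE sab; move: abK; rewrite -sab sab' ab'K.
Qed.

Definition source_prob (f : block * block -> seq cell) (s : source) : R :=
  if s is Count a b then count_pmf pp pm ap am a b (size (f (a, b))) else N.+1%:R^-1.

Lemma source_event_prob f s : P (source_event f s) = (source_prob f s)%:E.
Proof.
case: s => [a b|b k|a k] /=; first exact: npoints_law.
- by rewrite abscissa_law ?uniform_strip //; exact: measurable_strip_itv.
- by rewrite ordinate_law ?uniform_strip //; exact: measurable_strip_itv.
Qed.

Lemma prod_block_sources f ab :
  \prod_(s <- block_sources ab (size (f ab))) source_prob f s = block_prob ab (f ab).
Proof.
rewrite big_cons big_cat /= !big_map !big_filter /block_prob /= -surjective_pairing.
have cst (b : bool) m : \prod_(k <- iota 0 m | b) (N.+1%:R^-1 : R) = if b then N.+1%:R ^- m else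
    1.
  case: b => /=; last by rewrite big_pred0_eq.
  by rewrite big_const_seq count_predT size_iota -Monoid.iteropE -exprVn exprnP.
by rewrite !cst.
Qed.

Lemma block_event_indep (K : seq (block * block)) (f : block * block -> seq cell) :
  uniq K -> {subset K <= block_pairs n} ->
  (forall ab, ab \in K -> {in f ab, forall z, cell_block z = ab}) ->
  P (\big[setI/setT]_(ab <- K) [set w | block_cells w ab = f ab]) =
  (\prod_(ab <- K) block_prob ab (f ab))%:E.
Proof.
move=> uK sK fK.
transitivity (P (\big[setI/setT]_(s <- flatten [seq block_sources ab (size (f ab)) | ab <- K])
    source_event f s)).
  congr (P _); rewrite big_flatten /= big_map; apply: eq_big_seq => ab abK.
  by apply: block_event; [exact: sK | exact: fK].
rewrite (sources_independent (e := M)); last 2 first.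
- exact: (block_sources_uniq (fun ab => size (f ab)) uK).
- by move=> s _; exact: source_event_generated.
rewrite (eq_bigr (fun s => (source_prob f s)%:E)); last by move=> s _; exact: source_event_prob.
rewrite prodEFin big_flatten /= big_map.
by congr EFin; apply: eq_bigr => ab _; rewrite prod_block_sources.
Qed.

End CellProbability.

Lemma permutations_nseq (T : eqType) (m : nat) (x : T) :
  permutations (nseq m x) = [:: nseq m x].
Proof.
apply: perm_small_eq => //; apply: uniq_perm; rewrite ?permutations_uniq // => t.
rewrite mem_permutations inE; apply/idP/eqP => [pt|->//].
have := perm_all (pred1 x) pt; rewrite all_pred1_nseq => /all_pred1P ->.
by rewrite (perm_size pt) size_nseq.
Qed.

Lemma count_flatten_nseq (T : eqType) (c : T -> nat) (r : seq T) z : uniq r ->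
  count_mem z (flatten [seq nseq (c i) i | i <- r]) = if z \in r then c z else 0.
Proof.
elim: r => [//|i r IH] /= /andP[ir ur]; rewrite count_cat count_nseq IH // inE [z == i]eq_sym /=.
by case: eqP ir => [->|_] ir; rewrite ?mul1n ?mul0n // (negPf ir) addn0.
Qed.

Lemma size_flatten_nseq (T : eqType) (c : T -> nat) (r : seq T) :
  size (flatten [seq nseq (c i) i | i <- r]) = (\sum_(i <- r) c i)%N.
Proof.
by elim: r => [|i r IH] /=; rewrite ?big_nil // big_cons size_cat size_nseq IH.
Qed.

Lemma uniq_flatten_nseq (T : eqType) (c : T -> nat) (r : seq T) : uniq r ->
  {in r, forall i, (c i <= 1)%N} -> uniq (flatten [seq nseq (c i) i | i <- r]).
Proof.
move=> ur c1; have -> : flatten [seq nseq (c i) i | i <- r] = [seq i <- r | c i == 1%N].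
  elim: r {ur} c1 => [//|i r IH] c1 /=.
  rewrite IH; last by move=> j jr; apply: c1; rewrite inE jr orbT.
  by have := c1 i (mem_head _ _); case: (c i) => [|[|k]].
exact: filter_uniq.
Qed.

Section BlockParam.
Variables (R : realType) (n N : nat).

Definition block_param (p : parameter_set R) (al : R) (a : block) : R :=
  match a with
  | BSigma => al
  | BDot i => par_q p i
  | BPrime i => par_r p i
  | BSeg => par_t p
  end.

Lemma letter_paramE p al (x : letter n N) : letter_param p al x =
  block_param p al (letter_block x) * (if letter_block x == BSeg then N.+1%:R^-1 else 1).
Proof. by case: x => [[[i|i]|k]|] /=; rewrite ?eqxx ?mulr1. Qed.

Lemma sum_letter_param p al a : a \in small_blocks n ->
  \sum_(x : letter n N | letter_block x == a) letter_param p al x = block_param p al a.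
Proof.
move=> sa; have [->|aS] := eqVneq a BSeg.
  rewrite big_mkcond big_letter /=.
  rewrite [X in _ + (X + _ + _)]big1; last by [].
  rewrite [X in _ + (_ + X + _)]big1; last by [].
  rewrite (eq_bigr (fun=> par_t p / N.+1%:R)); last by [].
  rewrite sumr_const card_ord !add0r -[LHS]mulr_natr divfK ?pnatr_eq0 //.
have u := strip_point R (@ord0 N).
rewrite (big_pred1 (letter_of n N a u)) => [|x]; last first.
  apply/eqP/eqP => [xa|->]; last by rewrite letter_block_of.
  by apply/esym/letter_ofE.
by rewrite letter_paramE letter_block_of // (negPf aS) mulr1.
Qed.

End BlockParam.

Section ConfigProbability.
Variables (d : measure_display) (T : measurableType d) (R : realType) (P : probability T R)
  (pp pm : parameter_set R) (ap am : R) (M : extended_model P pp pm ap am) (n N : nat).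
Local Notation letter := (letter n N).
Local Notation cell := (letter * letter)%type.
Local Notation config := {ffun cell -> nat}.
Local Notation cell_block := (@cell_block n N).

(* The cells met by the points of a block, in the order of their labels, can be any
   permutation of this list. *)
Definition block_list (c : config) (ab : block * block) : seq cell :=
  flatten [seq nseq (c z) z | z <- enum [pred z : cell | cell_block z == ab]].

Lemma point_cell_block w ab k : ab \in block_pairs n -> cell_block (point_cell M n N w (ab, k))
    = ab.
Proof.
by case: ab => a b; rewrite mem_block_pairs /cell_block /= => /andP[sa sb]; rewrite
    !letter_block_of.
Qed.

Lemma cell_block_pairs z : cell_block z \in block_pairs n.
Proof. by rewrite mem_block_pairs !letter_block_small. Qed.

Lemma cell_config_count w z :
  cell_config M n N w z = count_mem z (block_cells M n N w (cell_block z)).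
Proof.
rewrite ffunE count_map count_sum /points /points_in big_allpairs_dep /=.
rewrite (bigD1_seq _ (cell_block_pairs z)) ?block_pairs_uniq //= [X in (_ + X)%N]big1_seq ?addn0.
  by rewrite count_map count_sum.
move=> ab /andP[abz abn]; rewrite big1 // => k _.
by apply/eqP; rewrite eqb0; apply: contra abz => /eqP <-; rewrite point_cell_block.
Qed.

Lemma perm_block_list w c ab : ab \in block_pairs n ->
  perm_eq (block_cells M n N w ab) (block_list c ab) <->
  (forall z, cell_block z = ab -> cell_config M n N w z = c z).
Proof.
move=> abn; have cl z : count_mem z (block_list c ab) = if cell_block z == ab then c z else 0.
  by rewrite count_flatten_nseq ?enum_uniq // mem_enum.
split=> [pe z zab|H].
  by rewrite cell_config_count zab (permP pe) cl zab eqxx.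
apply/allP => z _; apply/eqP; rewrite cl; case: eqP => [zab|zab].
  by rewrite -H // cell_config_count zab.
apply/count_memPn/negP => /mapP[k _ zE]; apply: zab; by rewrite zE point_cell_block.
Qed.

Lemma cell_config_event c : [set w | cell_config M n N w = c] =
  \big[setI/setT]_(ab <- block_pairs n) \big[setU/set0]_(l <- permutations (block_list c ab))
    [set w | block_cells M n N w ab = l].
Proof.
apply/seteqP; split=> w /=.
  move=> wc; apply/in_bigsetI => ab abn; apply/in_bigsetU.
  exists (block_cells M n N w ab) => //.
  by rewrite mem_permutations; apply/perm_block_list => // z _; rewrite wc.
move=> /in_bigsetI H; apply/ffunP => z.
have /in_bigsetU[l + wl] := H _ (cell_block_pairs z).
by rewrite mem_permutations -wl => /perm_block_list; apply => //; exact: cell_block_pairs.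
Qed.

Lemma block_list_block c ab l : l \in permutations (block_list c ab) ->
  {in l, forall z, cell_block z = ab}.
Proof.
rewrite mem_permutations => pl z; rewrite (perm_mem pl) => /flattenP[s /mapP[z' + ->]].
by rewrite mem_enum => /eqP z'ab /nseqP[->].
Qed.

Lemma measurable_block_cells ab (l : seq cell) : ab \in block_pairs n ->
  {in l, forall z, cell_block z = ab} -> measurable [set w | block_cells M n N w ab = l].
Proof.
move=> abn lab; have := @block_event _ _ _ _ _ _ _ _ M n N (fun=> l) ab abn lab => ->.
apply: bigsetI_measurable => s _; have := source_event_generated M (fun=> l) s.
case: s => [a b|b k|a k] [B mB <-].
- exact: npoints_meas.
- exact: abscissa_meas.
- exact: ordinate_meas.
Qed.

Lemma measurable_cell_config c : measurable [set w | cell_config M n N w = c].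
Proof.
rewrite cell_config_event big_seq; apply: bigsetI_measurable => ab abn.
rewrite big_seq; apply: bigsetU_measurable => l lp.
by apply: measurable_block_cells => //; exact: block_list_block lp.
Qed.

Lemma cell_config_prob_blocks c : P [set w | cell_config M n N w = c] =
  (\prod_(ab <- block_pairs n) \sum_(l <- permutations (block_list c ab))
     block_prob pp pm ap am ab l)%:E.
Proof.
rewrite cell_config_event; apply: prob_bigsetI_bigsetU; last exact: block_pairs_uniq.
- move=> ab l abn lp; apply: measurable_block_cells => //; exact: block_list_block lp.
- move=> ab l l' ll'; rewrite -subset0 => w [/= -> E]; by rewrite E eqxx in ll'.
- by move=> ab; exact: permutations_uniq.
- move=> K f uK sK fK; apply: block_event_indep => // ab abK.
  exact: block_list_block (fK _ abK).
Qed.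

Definition cell_weight (z : cell) : R := letter_param pp ap z.1 * letter_param pm am z.2.

Definition strip_cell (z : cell) : bool := (letter_block z.1 == BSeg) || (letter_block z.2 ==
    BSeg).

(** On strip cells this is a Poisson law without the factorial, hence the true law only for k at
    most 1. In this form it is proportional to a geometric weight. *)
Definition cell_pmf (z : cell) (k : nat) : R :=
  if strip_cell z then expR (- cell_weight z) * cell_weight z ^+ k
  else count_pmf pp pm ap am (letter_block z.1) (letter_block z.2) k.

Lemma count_pmf_seg a b k : (a == BSeg) || (b == BSeg) ->
  count_pmf pp pm ap am a b k = pmf_P (block_param pp ap a * block_param pm am b) k.
Proof. by case: a => [|i|i|]; case: b => [|j|j|] // _; rewrite /= mulrC. Qed.

(** Splitting of a Poisson variable among the strips. With at most one point per strip cell, the m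
    points can be labelled in m! ways, which cancels the m! of the Poisson law, and the cell weights
    add up to its mean. Away from the segment the product of blocks is a single cell and there is
    one labelling. *)
Lemma block_list_prob (c : config) ab : (forall z, strip_cell z -> (c z <= 1)%N) -> ab \in
    block_pairs n ->
  \sum_(l <- permutations (block_list c ab)) block_prob pp pm ap am ab l =
  \prod_(z | cell_block z == ab) cell_pmf z (c z).
Proof.
case: ab => a b c1; rewrite mem_block_pairs /= => /andP[sa sb].
have [seg|] := boolP ((a == BSeg) || (b == BSeg)); last first.
  rewrite negb_or => /andP[aS bS].
  have u := strip_point R (@ord0 N).
  pose z0 : cell := (letter_of n N a u, letter_of n N b u).
  have zE z : (cell_block z == (a, b)) = (z == z0).
    apply/eqP/eqP => [[za zb]|->]; last by rewrite /cell_block !letter_block_of.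
    by rewrite [z]surjective_pairing /z0 (letter_ofE u sa aS za) (letter_ofE u sb bS zb).
  rewrite (big_pred1 z0) // /block_list (eq_enum (B := pred1 z0)) => [|z]; last by rewrite !inE
      zE.
  rewrite enum1 /= cats0 permutations_nseq big_seq1 /block_prob /cell_pmf /strip_cell.
  rewrite /strip_prob !letter_block_of // (negPf aS) (negPf bS) /= size_nseq.
  by rewrite !mulr1.
have sz l : l \in permutations (block_list c (a, b)) ->
    size l = (\sum_(z | cell_block z == (a, b)) c z)%N.
  by rewrite mem_permutations => /perm_size ->; rewrite size_flatten_nseq big_enum.
set m := (\sum_(z | _) c z)%N in sz.
rewrite big_seq (eq_bigr (fun=> pmf_P (block_param pp ap a * block_param pm am b) m *
   (strip_prob R N a m * strip_prob R N b m))); last first.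
  by move=> l /sz E; rewrite /block_prob E /= count_pmf_seg.
rewrite -big_seq big_const_seq count_predT iter_addr_0 size_permutations; last first.
  apply: uniq_flatten_nseq; first exact: enum_uniq.
  by move=> z; rewrite mem_enum => /eqP[za zb]; apply: c1; rewrite /strip_cell za zb.
have -> : size (block_list c (a, b)) = m by rewrite size_flatten_nseq big_enum.
pose f a := if a == BSeg then N.+1%:R^-1 : R else 1.
pose s := (block_param pp ap a * f a) * (block_param pm am b * f b).
have sE z : cell_block z == (a, b) -> cell_weight z = s.
  by move=> /eqP[za zb]; rewrite /cell_weight !letter_paramE za zb.
rewrite (eq_bigr (fun z => expR (- cell_weight z) * s ^+ c z)); last first.
  by move=> z zab; rewrite /cell_pmf -(sE z) //; case/eqP: zab => za zb; rewrite /strip_cell za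
      zb seg.
rewrite big_split /= -expR_sum sumrN prodrXr -/m.
have -> : \sum_(z | cell_block z == (a, b)) cell_weight z = block_param pp ap a * block_param pm
    am b.
  rewrite -(sum_letter_param N pp ap sa) -(sum_letter_param N pm am sb).
  rewrite big_distrlr /= pair_big /=; apply: eq_bigl => z.
  by rewrite /cell_block xpair_eqE.
have pE x : strip_prob R N x m = f x ^+ m.
  by rewrite /strip_prob /f; case: eqP => _; rewrite ?expr1n // exprVn.
rewrite !pE /pmf_P -[LHS]mulr_natr /s !exprMn.
have : (m`!)%:R != 0 :> R by rewrite pnatr_eq0 -lt0n fact_gt0.
move: (expR _) (m`!)%:R (block_param pp ap a ^+ m) (block_param pm am b ^+ m) (f a ^+ m) (f b ^+
    m) => e F x1 x2 y1 y2 F0.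
by field.
Qed.

Lemma cell_config_prob (c : config) : (forall z, strip_cell z -> (c z <= 1)%N) ->
  P [set w | cell_config M n N w = c] = (\prod_z cell_pmf z (c z))%:E.
Proof.
move=> c1; rewrite cell_config_prob_blocks; congr EFin.
rewrite (eq_big_seq _ (fun ab abn => block_list_prob c1 abn)).
under eq_bigr do rewrite big_mkcond.
rewrite exchange_big /=; apply: eq_bigr => z _.
rewrite (bigD1_seq _ (cell_block_pairs z)) ?block_pairs_uniq //= eqxx big1 ?mulr1 //.
by move=> ab abz; rewrite eq_sym (negPf abz).
Qed.

End ConfigProbability.

(** * Integrals of functions of a countable-valued variable *)

Section CountableValued.
Variables (d : measure_display) (T : measurableType d) (R : realType) (P : probability T R).
Variables (K : countType) (C : T -> K).
Hypothesis mC : forall c, measurable [set w | C w = c].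

Let fiber (G : set K) (k : nat) : set T :=
  [set w | G (C w) /\ pickle (C w) = k].

Let fiberE G k : fiber G k = if unpickle k is Some c then
  (if c \in G then (if pickle c == k then [set w | C w = c] else set0) else set0) else set0.
Proof.
apply/seteqP; split=> w; rewrite /fiber /=.
  by move=> [Gw <-]; rewrite pickleK mem_set // eqxx.
case E: (unpickle k) => [c|//]; case: ifPn => // /set_mem Gc; case: eqP => // ck /= Cw.
by rewrite Cw ck.
Qed.

Lemma measurable_countable_preimage (G : set K) : measurable [set w | G (C w)].
Proof.
have -> : [set w | G (C w)] = \bigcup_k fiber G k.
  by apply/seteqP; split=> w /= => [Gw|[k _ []]//]; exists (pickle (C w)).
apply: bigcupT_measurable => k; rewrite fiberE; case: unpickle => // c.
by case: ifP => // _; case: ifP.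
Qed.

Lemma measurable_fun_countable d' (T' : measurableType d') (h : K -> T') (D : set T) :
  measurable D -> measurable_fun D (fun w => h (C w)).
Proof.
move=> mD _ Y mY; apply: measurableI => //.
exact: (measurable_countable_preimage (fun c => Y (h c))).
Qed.

Lemma integral_countable_valued (G : set K) (h : K -> R) : (forall c, 0 <= h c) ->
  (\int[P]_(w in [set w | G (C w)]) (h (C w))%:E =
   \esum_(c in G) ((h c)%:E * P [set w | C w = c]))%E.
Proof.
move=> h0.
have Ga c : (0 <= (h c)%:E * P [set w | C w = c])%E by rewrite mule_ge0 // lee_fin.
have GE : [set w | G (C w)] = \bigcup_k fiber G k.
  by apply/seteqP; split=> w /= => [Gw|[k _ []]//]; exists (pickle (C w)).
have mF k : measurable (fiber G k).
  rewrite fiberE; case: unpickle => // c.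
  by case: ifP => // _; case: ifP.
rewrite GE ge0_integral_bigcup //=; last 3 first.
- apply/measurable_EFinP; apply: (@measurable_fun_countable _ (measurableTypeR R) h).
  exact: bigcupT_measurable.
- by move=> w _; rewrite lee_fin.
- by move=> i j _ _ [w [[_ <-] [_ <-]]].
pose b k := (if unpickle k is Some c then (h c)%:E * P [set w | C w = c] else 0)%E.
have b0 k : (0 <= b k)%E by rewrite /b; case: unpickle.
have -> : (\esum_(c in G) ((h c)%:E * P [set w | C w = c]) = \esum_(k in pickle @` G) b k)%E.
  rewrite esum_image; first by apply: eq_esum => c _; rewrite /b pickleK.
  by move=> c c' _ _ /(pcan_inj pickleK).
rewrite esum_mkcond -nneseries_esumT; last by move=> k; case: ifP.
apply: eq_eseriesr => k _; case: ifPn => [/set_mem[c Gc <-]|kG].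
  rewrite /b pickleK (eq_integral (fun=> (h c)%:E)).
    by rewrite integral_cst // fiberE pickleK mem_set // eqxx //.
  by move=> w /set_mem[_ /(pcan_inj pickleK) ->].
rewrite (_ : fiber G k = set0) ?integral_set0 // -subset0 => w [Gw wk].
by move/negP: kG; apply; apply/mem_set; exists (C w).
Qed.

End CountableValued.

Lemma prod_1B_ge (R : realDomainType) (I : Type) (r : seq I) (u : I -> R) :
  (forall i, 0 <= u i <= 1) -> 1 - \sum_(i <- r) u i <= \prod_(i <- r) (1 - u i).
Proof.
move=> u01; elim: r => [|i r IH]; first by rewrite !big_nil subr0.
have /andP[u0 u1] := u01 i; rewrite !big_cons.
have s0 : 0 <= \sum_(j <- r) u j by apply: sumr_ge0 => j _; have /andP[] := u01 j.
apply: (@le_trans _ _ ((1 - u i) * (1 - \sum_(j <- r) u j))); last first.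
  by rewrite ler_wpM2l // subr_ge0.
have := mulr_ge0 u0 s0; lra.
Qed.

(** * Integrals over simple configurations *)

Section SimpleConfigurations.
Variables (d : measure_display) (T : measurableType d) (R : realType) (P : probability T R)
  (pp pm : parameter_set R) (ap am : R) (M : extended_model P pp pm ap am) (n N : nat)
  (lep lem : rel (Omega R)).
Hypotheses (hlep : admissible_order lep) (hlem : admissible_order lem).
Hypotheses (ap0 : 0 < ap) (am0 : 0 < am).
Local Notation letter := (letter n N).
Local Notation cell := (letter * letter)%type.
Local Notation config := {ffun cell -> nat}.
Local Notation dot := (@dot_letter R n N).
Local Notation root := ((None, None) : cell).
Local Notation range := (@cell_range letter letter dot dot None None).
Local Notation csum := (@cell_sum R letter letter dot dot None None).
Local Notation s := (@cell_weight R pp pm ap am n N).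
Local Notation tw := (tilted_weight None None (@letter_param R n N pp ap) (@letter_param R n N
    pm am)).
Local Notation V := [set c : config | valid dot dot None None c].
Local Notation simple := (@simple_config R n N lep lem).
Local Notation letter_step := (grid_step (@le_letter R n N lep) (@le_letter R n N lem) dot dot).

Hypothesis s_lt1 : forall z, z != root -> dot z.1 = dot z.2 -> s z < 1.
Hypothesis tw_lt1 : forall z, z != root -> dot z.1 = dot z.2 -> tw z < 1.

Lemma letter_param_ge0 (p : parameter_set R) (al : R) (x : letter) : 0 < al ->
  0 <= letter_param p al x.
Proof.
move=> al0; case: x => [[[i|i]|k]|] /=; rewrite ?par_q_ge0 ?par_r_ge0 ?(ltW al0) //.
by rewrite divr_ge0 // par_t_ge0.
Qed.

Lemma cell_weight_ge0 z : 0 <= s z.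
Proof. by rewrite mulr_ge0 // letter_param_ge0. Qed.

Lemma valid_down (c c' : config) : le_config c c' -> V c' -> V c.
Proof.
move=> /forallP cc' /andP[/eqP c0 /forallP c1]; apply/andP; split.
  by have := cc' root; rewrite c0 leqn0.
apply/forallP => z; apply/implyP => dz; have /implyP/(_ dz) := c1 z; exact: leq_trans.
Qed.

(* Ratio of the law of the number of points of the cell z to the geometric weight
   s z ^+ k, valid for k <= 1 if z is part of a strip. *)
Definition cell_constant (z : cell) : R := if strip_cell z then expR (- s z) else (csum s z)^-1.

Lemma strip_cell_root z : strip_cell z -> z != root.
Proof. by apply: contraTneq => ->. Qed.

Lemma cell_pmfE z k : (strip_cell z -> (k <= 1)%N) ->
  cell_pmf pp pm ap am z k = if k \in range z then cell_constant z * s z ^+ k else 0.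
Proof.
rewrite /cell_pmf /cell_constant; case: ifPn => [sz /(_ isT) k1|ns _].
  rewrite ifT //; apply/mem_set; rewrite /cell_range (negPf (strip_cell_root sz)).
  by case: ifP.
have gE r j : pmf_g r j = if j \in (setT : set nat) then (1 - r)^-1^-1 * r ^+ j else 0.
  by rewrite mem_setT invrK.
have bE r j : pmf_b r j = if j \in [set k | (k <= 1)%N] then (1 + r)^-1 * r ^+ j else 0.
  case: j => [|[|j]].
  - by rewrite mem_set //= div1r expr0 mulr1.
  - by rewrite mem_set //= expr1 mulrC.
  - by rewrite memNset.
rewrite /cell_range /cell_sum /cell_weight.
case: z ns => -[[[i|i]|k1]|] [[[j|j]|k2]|] //= ns; rewrite ?[am * _]mulrC.
all: try exact: gE.
all: try exact: bE.
rewrite invr1 mul1r; case: k => [|k]; first by rewrite mem_set.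
by rewrite memNset // => -[].
Qed.

Definition config_constant : R := \prod_z cell_constant z.

Lemma simple_strip_le1 (c : config) : simple c -> forall z, strip_cell z -> (c z <= 1)%N.
Proof.
move=> /simple_configP[s1 s2 _ _] [x y] sz; rewrite leqNgt; apply/negP => c2.
have le2 : le_config (add_config (unit_config (x, y)) (unit_config (x, y))) c.
  by apply/forallP => z; rewrite !ffunE; case: eqP => [->|].
move: sz; rewrite /strip_cell /= => /orP[xS|yS].
  case: x xS le2 {c2} => [[[i|i]|k]|] //= _ le2.
  by have := s1 k y y; rewrite le2.
case: y yS le2 {c2} => [[[i|i]|k]|] //= _ le2.
by have := s2 k x x; rewrite le2.
Qed.

Lemma simple_config_prob (c : config) : simple c ->
  P [set w | cell_config M n N w = c] =
  (if c \in V then config_constant * config_weight s c else 0)%:E.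
Proof.
move=> sc; rewrite cell_config_prob; last exact: simple_strip_le1.
congr EFin; rewrite (eq_bigr (fun z => if c z \in range z then cell_constant z * s z ^+ c z else
    0)).
  case: ifPn => [/set_mem Vc|Vc].
    rewrite /config_constant /config_weight -big_split; apply: eq_bigr => z _.
    rewrite ifT //; apply/mem_set; exact: (validE (dA := dot) (dB := dot) (sA := None) (sB :=
        None) isT isT c).1.
  have [z zc] : exists z, ~ range z (c z).
    apply/existsNP => H; move/negP: Vc; apply; apply/mem_set.
    exact: (validE (dA := dot) (dB := dot) (sA := None) (sB := None) isT isT c).2.
  by rewrite (bigD1 z) //= memNset // mul0r.
by move=> z _; rewrite cell_pmfE //; exact: simple_strip_le1.
Qed.

Lemma csum_gt0 z : 0 < csum s z.
Proof.
rewrite /cell_sum; case: eqP => // /eqP zr; case: ifPn => [_|].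
  by rewrite ltr_wpDr // cell_weight_ge0.
by rewrite negbK => /eqP dz; rewrite invr_gt0 subr_gt0 s_lt1.
Qed.

Lemma cell_constant_gt0 z : 0 < cell_constant z.
Proof. by rewrite /cell_constant; case: ifP => _; rewrite ?expR_gt0 // invr_gt0 csum_gt0. Qed.

Lemma config_constant_gt0 : 0 < config_constant.
Proof. by apply: prodr_gt0 => z _; exact: cell_constant_gt0. Qed.

Lemma simple_integral (h : config -> R) : (forall c, 0 <= h c) ->
  (\int[P]_(w in [set w | simple (cell_config M n N w)]) (h (cell_config M n N w))%:E =
   config_constant%:E * \esum_(c in V `&` [set c | simple c]) (config_weight s c * h c)%:E)%E.
Proof.
move=> h0.
rewrite (integral_countable_valued P (C := cell_config M n N) (@measurable_cell_config _ _ _ _ _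
    _ _ _ M n N) (fun c => simple c)) //.
rewrite setIC esum_mkcondr -esumZl ?(ltW config_constant_gt0) //; last first.
  by move=> c _; case: ifP => // _; rewrite lee_fin mulr_ge0 // config_weight_ge0 // => z;
      exact: cell_weight_ge0.
apply: eq_esum => c sc; rewrite simple_config_prob //.
by case: ifP => _; rewrite ?mule0 // -!EFinM; congr EFin; rewrite mulrC mulrA.
Qed.

Definition forbidden_weight : R := \sum_(e <- forbidden n N lep lem) config_weight s e.

(** Applied twice: with the length factor, to bound the expectation, and with h = 1, where the
    integral is a probability and yields an upper bound on [config_constant]. *)
Lemma simple_integral_bounds (h : config -> R) (y F : R) : (forall c, 0 <= h c) -> 0 <= y ->
  (forall c e, e \in forbidden n N lep lem -> h (add_config c e) <= y * h c) ->
  (\esum_(c in V) (config_weight s c * h c)%:E = F%:E)%E ->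
  ((config_constant * ((1 - forbidden_weight * y) * F))%:E <=
   \int[P]_(w in [set w | simple (cell_config M n N w)]) (h (cell_config M n N w))%:E <=
   (config_constant * F)%:E)%E.
Proof.
move=> h0 y0 hE FE; rewrite simple_integral //.
have wh0 c : (0 <= (config_weight s c * h c)%:E)%E.
  by rewrite lee_fin mulr_ge0 // config_weight_ge0 // => z; exact: cell_weight_ge0.
set G := esum _ _.
have : (F%:E <= G + (forbidden_weight * y)%:E * F%:E)%E.
  by rewrite -FE; exact: (esum_peierls valid_down cell_weight_ge0 h0 y0 hE).
have : (G <= F%:E)%E by rewrite -FE; apply: esum_subset => // c [].
have : (0 <= G)%E by exact: esum_ge0.
case: G => [g| |] //.
rewrite -!EFinM -EFinD !lee_fin => g0 gF Fg.
have k0 := ltW config_constant_gt0.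
apply/andP; split; apply: ler_wpM2l => //; lra.
Qed.

End SimpleConfigurations.

(** * Errors of the discretization *)

Section Estimates.
Variables (R : realType) (pp pm : parameter_set R) (ap am : R) (n N : nat)
  (lep lem : rel (Omega R)).
Hypotheses (hlep : admissible_order lep) (hlem : admissible_order lem).
Hypotheses (ap0 : 0 < ap) (am0 : 0 < am).
Local Notation letter := (letter n N).
Local Notation cell := (letter * letter)%type.
Local Notation config := {ffun cell -> nat}.
Local Notation dot := (@dot_letter R n N).
Local Notation root := ((None, None) : cell).
Local Notation csum := (@cell_sum R letter letter dot dot None None).
Local Notation s := (@cell_weight R pp pm ap am n N).
Local Notation tw := (tilted_weight None None (@letter_param R n N pp ap) (@letter_param R n N
    pm am)).

Definition param_sum (p : parameter_set R) (al : R) : R :=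
  al + (\sum_(i < n) par_q p i + \sum_(i < n) par_r p i + par_t p).

Lemma sum_letters (p : parameter_set R) (al : R) :
  \sum_(x : letter) letter_param p al x = param_sum p al.
Proof.
rewrite big_letter /= sumr_const card_ord -[_ *+ N.+1]mulr_natr divfK ?pnatr_eq0 //.
Qed.

Lemma param_sum_gt0 (p : parameter_set R) (al : R) : 0 < al -> 0 < param_sum p al.
Proof.
move=> al0; rewrite ltr_wpDr // !addr_ge0 ?par_t_ge0 ?sumr_ge0 // => i _.
- exact: par_q_ge0.
- exact: par_r_ge0.
Qed.

Lemma le_param_sum (p : parameter_set R) (al : R) (x : letter) : 0 < al ->
  letter_param p al x <= param_sum p al.
Proof.
move=> al0; rewrite -sum_letters (bigD1 x) //= lerDl sumr_ge0 // => y _.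
exact: letter_param_ge0.
Qed.

Local Notation Sp := (param_sum pp ap).
Local Notation Sm := (param_sum pm am).

(** One term for each family in [forbidden]. Two points in one of the N+1 strips cost the square of
    t / (N+1) times a sum of parameters; a point in one of at most 2n+1 ambiguous strips costs this
    once. *)
Definition discretization_error : R :=
  par_t pp ^+ 2 * Sm ^+ 2 + par_t pm ^+ 2 * Sp ^+ 2 +
  (n + n).+1%:R * (par_t pp * Sm) + (n + n).+1%:R * (par_t pm * Sp).

Lemma forbidden_weight_le :
  forbidden_weight pp pm ap am n N lep lem <= discretization_error / N.+1%:R.
Proof.
have N0 : N.+1%:R != 0 :> R by rewrite pnatr_eq0.
have b0 := fun p al x => @letter_param_ge0 R n N p al x.
rewrite /forbidden_weight /forbidden !big_cat /= !big_map !big_filter !big_enum_cond /=.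
rewrite (eq_bigr (fun p : 'I_N.+1 * letter * letter =>
  (par_t pp / N.+1%:R * letter_param pm am p.1.2) * (par_t pp / N.+1%:R * letter_param pm am
      p.2))); last first.
  by move=> p _; rewrite config_weight_add !config_weight_unit.
rewrite [X in _ + (X + _)](eq_bigr (fun p : 'I_N.+1 * letter * letter =>
  (letter_param pp ap p.1.2 * (par_t pm / N.+1%:R)) * (letter_param pp ap p.2 * (par_t pm /
      N.+1%:R)))); last first.
  by move=> p _; rewrite config_weight_add !config_weight_unit.
rewrite [X in _ + (_ + (X + _))](eq_bigr (fun p : 'I_N.+1 * letter =>
  par_t pp / N.+1%:R * letter_param pm am p.2)); last by move=> p _; rewrite config_weight_unit.
rewrite [X in _ + (_ + (_ + X))](eq_bigr (fun p : 'I_N.+1 * letter =>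
  letter_param pp ap p.2 * (par_t pm / N.+1%:R))); last by move=> p _; rewrite config_weight_unit.
have pairs (g : letter -> R) : \sum_(p : 'I_N.+1 * letter * letter) g p.1.2 * g p.2 =
    N.+1%:R * (\sum_x g x) ^+ 2.
  rewrite -(pair_bigA _ (fun (kx : 'I_N.+1 * letter) y => g kx.2 * g y)) /=.
  rewrite -(pair_bigA _ (fun (k : 'I_N.+1) x => \sum_y g x * g y)) /=.
  by rewrite -big_distrlr /= sumr_const card_ord -[LHS]mulr_natl expr2.
have single (a : pred 'I_N.+1) (g : letter -> R) : (#|a| <= (n + n).+1)%N -> (forall x, 0 <= g
    x) ->
    \sum_(p : 'I_N.+1 * letter | a p.1) g p.2 <= (n + n).+1%:R * \sum_x g x.
  move=> an g0; rewrite (eq_bigl (fun p => a p.1 && xpredT p.2)); last by move=> p; rewrite andbT.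
  rewrite -(pair_big a xpredT (fun (k : 'I_N.+1) x => g x)) /=.
  by rewrite sumr_const -[leLHS]mulr_natl ler_wpM2r ?ler_nat // sumr_ge0.
rewrite (pairs (fun x => par_t pp / N.+1%:R * letter_param pm am x)).
rewrite (pairs (fun x => letter_param pp ap x * (par_t pm / N.+1%:R))).
have h1 := single _ (fun x => par_t pp / N.+1%:R * letter_param pm am x) (card_ambiguous n N
    hlep).
have h2 := single _ (fun x => letter_param pp ap x * (par_t pm / N.+1%:R)) (card_ambiguous n N
    hlem).
rewrite -!mulr_suml -!mulr_sumr !sum_letters in h1 h2 *.
apply: le_trans (lerD (lexx _) (lerD (lexx _) (lerD (h1 _) (h2 _)))) _.
- by move=> x; rewrite mulr_ge0 ?b0 // divr_ge0 ?par_t_ge0.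
- by move=> x; rewrite mulr_ge0 ?b0 // divr_ge0 ?par_t_ge0.
rewrite le_eqVlt; apply/orP; left; apply/eqP; rewrite /discretization_error.
by field; rewrite -natr1 in N0.
Qed.

(** N+1 times a bound on the sum of the squared weights of the strip cells: each weight is at most
    Sp * Sm / (N+1), and all weights add up to Sp * Sm. *)
Definition strip_bound : R := (Sp * Sm) ^+ 2.

Lemma strip_weight_le z : strip_cell z -> s z <= Sp * Sm / N.+1%:R.
Proof.
have Sp0 := param_sum_gt0 pp ap0; have Sm0 := param_sum_gt0 pm am0.
have tp : par_t pp <= Sp.
  by rewrite /param_sum addrA lerDr addr_ge0 ?(ltW ap0) // addr_ge0 // sumr_ge0 // => i _;
      [exact: par_q_ge0|exact: par_r_ge0].
have tm : par_t pm <= Sm.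
  by rewrite /param_sum addrA lerDr addr_ge0 ?(ltW am0) // addr_ge0 // sumr_ge0 // => i _;
      [exact: par_q_ge0|exact: par_r_ge0].
case: z => x y; rewrite /strip_cell /cell_weight /= => /orP[xS|yS].
  case: x xS => [[[i|i]|k]|] //= _; rewrite mulrAC ler_pM2r ?invr_gt0 ?ltr0n //.
  by apply: ler_pM; rewrite ?par_t_ge0 ?letter_param_ge0 // le_param_sum.
case: y yS => [[[i|i]|k]|] //= _; rewrite mulrA ler_pM2r ?invr_gt0 ?ltr0n //.
by apply: ler_pM; rewrite ?par_t_ge0 ?letter_param_ge0 // le_param_sum.
Qed.

Lemma sum_cell_weight : \sum_z s z = Sp * Sm.
Proof.
rewrite -(pair_bigA _ (fun x y => letter_param pp ap x * letter_param pm am y)) /=.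
by rewrite -big_distrlr /= !sum_letters.
Qed.

Hypothesis s_lt1 : forall z, z != root -> dot z.1 = dot z.2 -> s z < 1.
Hypothesis tw_lt1 : forall z, z != root -> dot z.1 = dot z.2 -> tw z < 1.
Hypothesis N_large : Sp * Sm <= N.+1%:R.

(** A cell outside the strips contributes exactly 1. A strip cell of weight s contributes exp(-s) (1
    + s) or exp(-s) / (1 - s), both at least 1 - s^2, and the product is bounded below by 1 minus
    the sum of the squares. *)
Lemma config_constant_sum_ge :
  1 - strip_bound / N.+1%:R <= config_constant pp pm ap am n N * \prod_z csum s z.
Proof.
have N0 : 0 < N.+1%:R :> R by rewrite ltr0n.
rewrite /config_constant -big_split /=.
pose u (z : cell) := if strip_cell z then s z ^+ 2 else 0.
have s0 z : 0 <= s z by exact: cell_weight_ge0.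
have s1 z : strip_cell z -> s z <= 1.
  by move=> /strip_weight_le /le_trans; apply; rewrite ler_pdivrMr // mul1r.
have u01 z : 0 <= u z <= 1.
  by rewrite /u; case: ifP => [/s1 sz|_]; rewrite ?lexx ?ler01 // exprn_ge0 // expr_le1.
apply: (@le_trans _ _ (\prod_z (1 - u z))).
  apply: le_trans (prod_1B_ge _ u01); rewrite lerB //.
  apply: (@le_trans _ _ (\sum_z (Sp * Sm / N.+1%:R) * s z)).
    apply: ler_sum => z _; rewrite /u; case: ifP => [/strip_weight_le sz|_].
      by rewrite expr2 ler_wpM2r.
    by rewrite mulr_ge0 // divr_ge0 // mulr_ge0 // ltW // param_sum_gt0.
  rewrite -mulr_sumr sum_cell_weight /strip_bound expr2 -!mulrA.
  by rewrite ler_wpM2l ?(ltW (param_sum_gt0 _ _)) // mulrCA mulrC -!mulrA mulrCA.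
apply: ler_prod => z _; have /andP[u0 u1] := u01 z; rewrite subr_ge0 u1 /=.
rewrite /cell_constant /u; case: ifPn => [sz|_]; last first.
  by rewrite subr0 mulVf // gt_eqF // csum_gt0.
rewrite /cell_sum (negPf (strip_cell_root sz)); have := s0 z; have := s1 z sz.
have := expR_ge1Dx (- s z); case: ifPn => [_ e1 z1 z0|].
  have -> : 1 - s z ^+ 2 = (1 - s z) * (1 + s z) by ring.
  by rewrite ler_wpM2r // addr_ge0.
rewrite negbK => /eqP dz; have := s_lt1 (strip_cell_root sz) dz => lt1 e1 _ z0.
rewrite ler_pdivlMr ?subr_gt0 //; apply: le_trans e1.
by apply: ler_piMl; rewrite ?subr_ge0 ?(ltW lt1) // gerBl exprn_ge0.
Qed.

Definition side_product (p : parameter_set R) (al be : R) : R :=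
  \prod_(i < n) ((1 + par_q p i / al) / (1 + par_q p i * be)) *
  \prod_(i < n) ((1 - par_r p i * be) / (1 - par_r p i / al)) *
  ((1 - par_t p / N.+1%:R * be) / (1 - par_t p / N.+1%:R / al)) ^+ N.+1.

(** The tilt changes the two axes only, so all other cells cancel. On the axis of [pp], for
    instance, the weight passes from a * am to a / ap, which prepares the quotient E(1/ap; pp) /
    E(am; pp). *)
Lemma prod_cell_sum_ratio :
  \prod_z csum tw z = side_product pp ap am * side_product pm am ap * \prod_z csum s z.
Proof.
have cs0 z : csum s z != 0 by rewrite gt_eqF // csum_gt0.
pose h z := csum tw z / csum s z.
have -> : \prod_z csum tw z = \prod_z h z * \prod_z csum s z.
  by rewrite -big_split; apply: eq_bigr => z _; rewrite /h /= divfK.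
congr (_ * _).
have h1 x y : (x != None) && (y != None) -> h (x, y) = 1.
  move=> /andP[/negPf x0 /negPf y0]; rewrite /h.
  have -> : csum tw (x, y) = csum s (x, y); last by rewrite divff.
  by rewrite /cell_sum /tilted_weight /= x0 y0.
have h0 : h root = 1 by rewrite /h /cell_sum eqxx divr1.
rewrite -(pair_bigA _ (fun x y => h (x, y))) /= (bigD1 None) //= mulrC.
have side p al be (g : letter -> R) : g None = 1 ->
   (forall x, x != None -> g x = if dot x then (1 + letter_param p al x / al) / (1 +
       letter_param p al x * be)
      else (1 - letter_param p al x * be) / (1 - letter_param p al x / al)) ->
   \prod_x g x = side_product p al be.
  move=> g0 gE; rewrite big_letter /= g0 mul1r /side_product; congr (_ * _ * _).
  - by apply: eq_bigr => i _; rewrite gE.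
  - by apply: eq_bigr => i _; rewrite gE.
  - by rewrite (eq_bigr (fun=> ((1 - par_t p / N.+1%:R * be) / (1 - par_t p / N.+1%:R / al))))
      ?prodr_const ?card_ord // => k _; rewrite gE.
congr (_ * _); last first.
  apply: side => // y y0; rewrite /h /cell_sum /tilted_weight /= xpair_eqE eqxx (negPf y0) /=.
  rewrite /cell_weight /= /dot_letter /= [ap * _]mulrC.
  by case: (is_dot _) => //=; rewrite invrK mulrC.
rewrite -(side pp ap am (fun x => h (x, None)) h0).
  rewrite [RHS](bigD1 None) //= h0 mul1r; apply: eq_bigr => x x0.
  by rewrite (bigD1 None) //= big1 ?mulr1 // => y y0; rewrite h1 // x0.
move=> x x0; rewrite /h /cell_sum /tilted_weight /= xpair_eqE eqxx (negPf x0) /=.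
rewrite /cell_weight /= /dot_letter /=.
by case: (is_dot _) => //=; rewrite invrK mulrC.
Qed.

End Estimates.

(** * Refining the strips *)

Section AnalyticLimits.
Variable R : realType.

Lemma cvg_div_succ (c : R) : c / N.+1%:R @[N --> \oo] --> (0 : R).
Proof.
rewrite -(mulr0 c); apply: cvgM; first exact: cvg_cst.
exact: cvg_harmonic.
Qed.

Lemma near_succ_gt (c : R) : \forall N \near \oo, c < N.+1%:R.
Proof.
near=> N; apply: (@le_lt_trans _ _ `|c|); first exact: ler_norm.
have : (Num.truncn `|c| < N)%N by near: N; exact: nbhs_infty_gt.
by rewrite truncn_lt_nat // => /lt_trans; apply; rewrite ltr_nat.
Unshelve. all: by end_near. Qed.

(** With y = c / (N+1), the lower bound rests on exp(-y) (1 + y) <= 1, which gives exp(-y) (1 - y^2)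
    <= 1 - y; the factors 1 - y^2 are then multiplied by means of [prod_1B_ge]. *)
Lemma expr_1B_bounds (c : R) (N : nat) : 0 <= c -> c <= N.+1%:R ->
  expR (- c) * (1 - c ^+ 2 / N.+1%:R) <= (1 - c / N.+1%:R) ^+ N.+1 <= expR (- c).
Proof.
move=> c0 cN; set y := c / N.+1%:R.
have N0 : 0 < N.+1%:R :> R by rewrite ltr0n.
have y0 : 0 <= y by rewrite divr_ge0.
have y1 : y <= 1 by rewrite ler_pdivrMr // mul1r.
have eE : expR (- c) = expR (- y) ^+ N.+1.
  by rewrite -expRM_natl mulrN mulrC divfK // gt_eqF.
have e1 := expR_ge1Dx (- y).
apply/andP; split; last by rewrite eE lerXn2r ?nnegrE ?subr_ge0 ?expR_ge0.
rewrite eE; apply: (@le_trans _ _ (expR (- y) ^+ N.+1 * (1 - y ^+ 2) ^+ N.+1)).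
  rewrite ler_wpM2l ?exprn_ge0 ?expR_ge0 //.
  have := @prod_1B_ge R 'I_N.+1 (index_enum _) (fun=> y ^+ 2).
  rewrite sumr_const prodr_const card_ord => /(_ _) H; apply: le_trans (H _).
    rewrite lerB // -[leLHS]mulr_natr /y expr_div_n.
    by rewrite [N.+1%:R ^+ 2]expr2 invfM mulrA divfK // gt_eqF.
  by move=> _; rewrite exprn_ge0 // expr_le1.
rewrite -exprMn lerXn2r ?nnegrE ?subr_ge0 ?mulr_ge0 ?expR_ge0 ?subr_ge0 ?expr_le1 //.
have -> : expR (- y) * (1 - y ^+ 2) = (expR (- y) * (1 + y)) * (1 - y) by ring.
rewrite ler_piMl ?subr_ge0 //.
rewrite -(ler_pM2l (expR_gt0 y)) mulrA -expRD subrr expR0 mul1r mulr1.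
exact: expR_ge1Dx.
Qed.

Lemma cvg_expr_1B (c : R) : 0 <= c ->
  (1 - c / N.+1%:R) ^+ N.+1 @[N --> \oo] --> expR (- c).
Proof.
move=> c0.
apply: (squeeze_cvgr (f := fun N : nat => expR (- c) * (1 - c ^+ 2 / N.+1%:R)) (h := fun=> expR
    (- c))).
- near=> N; apply: expr_1B_bounds => //; apply: ltW; near: N; exact: near_succ_gt.
- rewrite -[X in _ --> X]mulr1 -[X in _ * X]subr0.
  by apply: cvgM; [exact: cvg_cst|apply: cvgB; [exact: cvg_cst|exact: cvg_div_succ]].
- exact: cvg_cst.
Unshelve. all: by end_near. Qed.

End AnalyticLimits.

(** * Expectations known on almost full events *)

Section SqueezeExpectation.
Variables (d : measure_display) (T : measurableType d) (R : realType) (P : probability T R).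

(** The lower bound follows by restriction to [D N]. For the upper bound f may be large off [D N],
    so it is capped at m, which makes the missing part at most m (1 - pr N). Letting N and then m
    tend to infinity concludes, the latter by monotone convergence. *)
Lemma integral_squeeze (f : T -> R) (D : nat -> set T) (lo up pr : nat -> R) (r : R) :
  measurable_fun setT f -> (forall w, 0 <= f w) -> (forall N, measurable (D N)) ->
  (\forall N \near \oo, ((lo N)%:E <= \int[P]_(w in D N) (f w)%:E <= (up N)%:E)%E) ->
  (\forall N \near \oo, ((pr N)%:E <= P (D N))%E) ->
  lo @ \oo --> r -> up @ \oo --> r -> pr @ \oo --> (1 : R) ->
  (\int[P]_w (f w)%:E = r%:E)%E.
Proof.
move=> mf f0 mD bounds prob clo cup cpr.
have mfE : measurable_fun setT (fun w => (f w)%:E) by apply/measurable_EFinP.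
apply/eqP; rewrite eq_le; apply/andP; split; last first.
  have clo' : (EFin \o lo) @ \oo --> r%:E by apply: cvg_EFin => //; exact: nearW.
  rewrite -(cvg_lim _ clo') //; apply: lime_le; first by apply/cvg_ex; exists r%:E.
  near=> N.
  have /andP[lN _] : ((lo N)%:E <= \int[P]_(w in D N) (f w)%:E <= (up N)%:E)%E by near: N.
  apply: (le_trans lN); apply: ge0_subset_integral => //.
  by move=> w _; rewrite lee_fin.
pose g (m : nat) w := Order.min (f w)%:E (m%:R)%:E.
have mg m : measurable_fun setT (g m).
  exact: measurable_mine.
have g0 m w : (0 <= g m w)%E by rewrite le_min !lee_fin f0 ler0n.
have gf m w : (g m w <= (f w)%:E)%E by rewrite ge_min lexx.
have gr m : (\int[P]_w g m w <= r%:E)%E.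
  pose u N := up N + m%:R * (1 - pr N).
  have cu : (EFin \o u) @ \oo --> r%:E.
    apply: cvg_EFin; first exact: nearW.
    rewrite -[X in _ --> X]addr0 -(mulr0 m%:R) -(subrr 1).
    by apply: cvgD => //; apply: cvgM; [exact: cvg_cst|apply: cvgB => //; exact: cvg_cst].
  rewrite -(cvg_lim _ cu) //; apply: lime_ge; first by apply/cvg_ex; exists r%:E.
  near=> N.
  have /andP[_ uN] : ((lo N)%:E <= \int[P]_(w in D N) (f w)%:E <= (up N)%:E)%E by near: N.
  have pN : ((pr N)%:E <= P (D N))%E by near: N.
  have mC := measurableC (mD N).
  have -> : (\int[P]_w g m w = \int[P]_(w in D N) g m w + \int[P]_(w in ~` D N) g m w)%E.
    rewrite -(ge0_integral_setU P (mD N) mC) ?setUv //.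
    by rewrite disj_set2E setICr.
  rewrite /u /= EFinD; apply: leeD.
    apply: le_trans uN; apply: ge0_le_integral => //; try exact: measurable_funTS.
  apply: (@le_trans _ _ (\int[P]_(w in ~` D N) (m%:R)%:E)%E).
    apply: ge0_le_integral => //; first exact: measurable_funTS.
    by move=> w _; rewrite ge_min lexx orbT.
  rewrite integral_cst //.
  rewrite EFinM; apply: lee_wpmul2l; first by rewrite lee_fin.
  have : (P (~` D N) <= (1 - pr N)%:E)%E by rewrite probability_setC // EFinB leeB.
  exact.
have nd w : nondecreasing_seq (g^~ w).
  move=> m m' mm'; rewrite /g le_min ge_min lexx /= ge_min.
  by rewrite [X in _ || X]lee_fin ler_nat mm' orbT.
have cv := cvg_monotone_convergence measurableT mg (fun m w _ => g0 m w) (fun w _ => nd w).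
have gE : (fun w => limn (g^~ w)) = (fun w => (f w)%:E).
  apply/funext => w; apply/cvg_lim => //; apply: cvg_near_cst.
  near=> m; apply/min_idPl; rewrite lee_fin ltW // -truncn_lt_nat //.
  by near: m; exact: nbhs_infty_gt.
rewrite gE in cv; have {}cv := cv P; rewrite -(cvg_lim _ cv) //.
by apply: lime_le; [apply/cvg_ex; eexists; exact: cv |exact: nearW].
Unshelve. all: by end_near. Qed.

End SqueezeExpectation.

(** * Measurability of the maximal length *)

Lemma countable_bigcup_measurable (d : measure_display) (T : measurableType d) (K : countType)
    (Q : K -> Prop) (F : K -> set T) :
  (forall k, Q k -> measurable (F k)) -> measurable [set w | exists2 k, Q k & F k w].
Proof.
move=> mF; pose G i := if unpickle i is Some k then [set w | Q k /\ F k w] else set0.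
have -> : [set w | exists2 k, Q k & F k w] = \bigcup_i G i.
  apply/seteqP; split=> w /= => [[k Qk Fk]|[i _]].
    by exists (pickle k) => //; rewrite /G pickleK.
  by rewrite /G; case: unpickle => [k [Qk Fk]|//]; exists k.
apply: bigcupT_measurable => i; rewrite /G; case: unpickle => // k.
have [Qk|nQ] := pselect (Q k).
  rewrite (_ : [set w | _] = F k); first exact: mF.
  by apply/seteqP; split=> w /= => [[]|].
by rewrite (_ : [set w | _] = set0) // -subset0 => w /= [/nQ].
Qed.

Lemma measurable_Prop (d : measure_display) (T : measurableType d) (Q : Prop) :
  measurable [set _ : T | Q].
Proof.
have [q|nq] := pselect Q.
  by rewrite (_ : [set _ : T | Q] = setT) //; apply/seteqP; split.
by rewrite (_ : [set _ : T | Q] = set0) // -subset0.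
Qed.

Section Measurability.
Variables (d : measure_display) (T : measurableType d) (R : realType).

(** An admissible order is arbitrary between the segment and the other letters, but the points of
    the segment below l always form an interval, hence a Borel set. *)
Lemma measurable_le_Seg (le : rel (Omega R)) (hle : admissible_order le) (X : T -> {i01 R}) l :
  measurable_fun setT (fun w => (X w)%:num) -> measurable [set w | le (Seg (X w)) l].
Proof.
move=> mX; pose I := [set x : R | exists2 u : {i01 R}, u%:num = x & le (Seg u) l].
have -> : [set w | le (Seg (X w)) l] = setT `&` (fun w => (X w)%:num) @^-1` I.
  apply/seteqP; split=> w /=; first by split => //; exists (X w).
  by move=> [_ [u uX]]; apply: admissible_trans => //; rewrite (admissible_seg hle) uX.
apply: mX => //; apply: is_interval_measurable => x y [u <- ul] [v <- vl] z /andP[uz zv].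
have z0 : 0 <= z by apply: le_trans uz.
have z1 : z <= 1 by apply: le_trans zv _.
exists (Itv01 z0 z1) => //; apply: admissible_trans vl => //.
by rewrite (admissible_seg hle).
Qed.

Lemma measurable_Seg_le (le : rel (Omega R)) (hle : admissible_order le) (X : T -> {i01 R}) l :
  measurable_fun setT (fun w => (X w)%:num) -> measurable [set w | le l (Seg (X w))].
Proof.
move=> mX; pose I := [set x : R | exists2 u : {i01 R}, u%:num = x & le l (Seg u)].
have -> : [set w | le l (Seg (X w))] = setT `&` (fun w => (X w)%:num) @^-1` I.
  apply/seteqP; split=> w /=; first by split => //; exists (X w).
  by move=> [_ [u uX lu]]; apply: (admissible_trans hle) lu _; rewrite (admissible_seg hle) uX.
apply: mX => //; apply: is_interval_measurable => x y [u <- ul] [v <- vl] z /andP[uz zv].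
have z0 : 0 <= z by apply: le_trans uz.
have z1 : z <= 1 by apply: le_trans zv _.
exists (Itv01 z0 z1) => //; apply: (admissible_trans hle) ul _.
by rewrite (admissible_seg hle).
Qed.

Lemma measurable_extend_order (le : rel (Omega R)) (hle : admissible_order le)
    (X Y : T -> {i01 R}) a b :
  measurable_fun setT (fun w => (X w)%:num) -> measurable_fun setT (fun w => (Y w)%:num) ->
  measurable [set w | extend_order le (place a (X w)) (place b (Y w))].
Proof.
move=> mX mY; case: a => [|i|i|]; case: b => [|j|j|] /=; try exact: measurable_Prop.
- have -> : [set w | le (Seg (X w)) (Seg (Y w))] =
      setT `&` (fun w => (X w)%:num <= (Y w)%:num) @^-1` [set true].
    by apply/seteqP; split=> w /=; rewrite (admissible_seg hle) // => -[].
  exact: (measurable_fun_ler mX mY).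
- exact: measurable_le_Seg.
- exact: measurable_le_Seg.
- exact: measurable_Seg_le.
- exact: measurable_Seg_le.
Qed.

Lemma measurable_dot_clause (X Y : T -> {i01 R}) a b :
  measurable [set w | (place a (X w) == place b (Y w)) ==> ~~ is_dot (place a (X w))].
Proof.
case: a => [|i|i|] /=.
- by rewrite (_ : [set w | _] = setT) //; apply/seteqP; split=> w //= _; rewrite implybT.
- by case: b => [|j|j|] /=; try exact: measurable_Prop;
  rewrite (_ : [set w | _] = setT) //; apply/seteqP; split=> w //= _;
  case: eqP => // -[].
- by rewrite (_ : [set w | _] = setT) //; apply/seteqP; split=> w //= _; rewrite implybT.
- by rewrite (_ : [set w | _] = setT) //; apply/seteqP; split=> w //= _; rewrite implybT.
Qed.

Variables (P : probability T R) (pp pm : parameter_set R) (ap am : R)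
  (M : extended_model P pp pm ap am) (lep lem : rel (Omega R)).
Hypotheses (hlep : admissible_order lep) (hlem : admissible_order lem).

Lemma measurable_step i j :
  measurable [set w | increasing_step lep lem (point_site M w i) (point_site M w j)].
Proof.
have -> : [set w | increasing_step lep lem (point_site M w i) (point_site M w j)] =
  [set w | extend_order lep (point_site M w i).1 (point_site M w j).1] `&`
  ([set w | extend_order lem (point_site M w i).2 (point_site M w j).2] `&`
  ([set w | ((point_site M w i).1 == (point_site M w j).1) ==> ~~ is_dot (point_site M w i).1] `&`
   [set w | ((point_site M w i).2 == (point_site M w j).2) ==> ~~ is_dot (point_site M w i).2])).
  apply/seteqP; split=> w /=; first by move=> /and4P[].
  by move=> [? [? [? ?]]]; apply/and4P.
apply: measurableI; first by apply: measurable_extend_order => //; exact: abscissa_meas.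
apply: measurableI; first by apply: measurable_extend_order => //; exact: ordinate_meas.
by apply: measurableI; exact: measurable_dot_clause.
Qed.

Lemma measurable_sorted (t : seq (block * block * nat)) :
  measurable [set w | sorted (increasing_step lep lem) (map (point_site M w) t)].
Proof.
elim: t => [|i [|j t] IH] /=; try exact: measurable_Prop.
rewrite (_ : [set w | _] = [set w | increasing_step lep lem (point_site M w i) (point_site M w
    j)] `&`
   [set w | sorted (increasing_step lep lem) (map (point_site M w) (j :: t))]).
  by apply: measurableI => //; exact: measurable_step.
by apply/seteqP; split=> w /= /andP.
Qed.

Lemma measurable_points_in bl (t : seq (block * block * nat)) :
  measurable [set w | {subset t <= points_in M bl w}].
Proof.
elim: t => [|i t IH]; first by rewrite (_ : [set w | _] = setT) //; apply/seteqP; split.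
rewrite (_ : [set w | _] = [set w | (i.1 \in bl) /\ (i.2 < npoints M i.1.1 i.1.2 w)%N] `&`
   [set w | {subset t <= points_in M bl w}]); last first.
  apply/seteqP; split=> w /=.
    move=> it; split; last by move=> j jt; apply: it; rewrite inE jt orbT.
    by have := it i (mem_head _ _); rewrite mem_points_in => /andP.
  move=> [/andP ib tb] j; rewrite inE => /orP[/eqP->|/tb//].
  by rewrite mem_points_in.
apply: measurableI => //.
rewrite (_ : [set w | _] = [set _ | i.1 \in bl] `&`
  (setT `&` npoints M i.1.1 i.1.2 @^-1` [set k | (i.2 < k)%N])).
  by apply: measurableI; [exact: measurable_Prop | exact: npoints_meas].
by apply/seteqP; split=> w /= => [[]|[? []]].
Qed.

Local Notation L bl w := (lambda1 lep lem (restricted_multiset M bl w)).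

(** Expresses the event through a list of labels, which ranges over a countable type, instead of a
    chain of points with real coordinates. *)
Lemma restricted_length_geP bl m w : uniq bl -> (m <= L bl w)%N <->
  exists2 t : seq (block * block * nat), (uniq t /\ size t = m) &
   ({subset t <= points_in M bl w} /\ sorted (increasing_step lep lem) (map (point_site M w) t)).
Proof.
move=> ubl; have Lw := lambda1_restrictedP M lep lem w ubl; split.
  move=> /(multichain_of_size Lw)[s [se sM] sz].
  have [t [ut tp ts]] := @lift_indices _ _ (point_site M w) _ s (points_in_uniq M w ubl)
     (fun z => leq_trans (sM z) (eq_leq (restricted_multisetE M w z ubl))).
  by exists t; split => //; rewrite ?ts // -sz -ts size_map.
move=> [t [ut <-] [tp se]]; have [_ H] := Lw.
rewrite -(size_map (point_site M w)); apply: H; split => // z.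
by rewrite restricted_multisetE //; exact: count_map_sub.
Qed.

Lemma measurable_restricted_ge bl m : uniq bl -> measurable [set w | (m <= L bl w)%N].
Proof.
move=> ubl; rewrite (_ : [set w | _] = [set w | exists2 t : seq (block * block * nat),
   (uniq t /\ size t = m) & ([set w | {subset t <= points_in M bl w}] `&`
   [set w | sorted (increasing_step lep lem) (map (point_site M w) t)]) w]).
  apply: countable_bigcup_measurable => t _.
  by apply: measurableI; [exact: measurable_points_in | exact: measurable_sorted].
by apply/seteqP; split=> w /= /(restricted_length_geP m w ubl).
Qed.

Lemma measurable_nat_ge (f : T -> nat) : (forall m, measurable [set w | (m <= f w)%N]) ->
  measurable_fun setT f.
Proof.
move=> mf _ Y _; rewrite setTI.
rewrite (_ : f @^-1` Y = [set w | exists2 m, Y m & f w = m]); last first.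
  by apply/seteqP; split=> w /= => [Yf|[m Ym ->//]]; exists (f w).
apply: (@countable_bigcup_measurable _ _ nat Y (fun m => [set w | f w = m])) => m _.
rewrite (_ : [set w | f w = m] = [set w | (m <= f w)%N] `\` [set w | (m.+1 <= f w)%N]).
  exact: measurableD.
apply/seteqP; split=> w /=; first by move=> ->; split; rewrite ?ltnn.
by move=> [mf1 /negP]; rewrite -leqNgt => mf2; apply/eqP; rewrite eqn_leq mf2.
Qed.

Lemma measurable_restricted_length bl : uniq bl -> measurable_fun setT (fun w => L bl w).
Proof. by move=> ubl; apply: measurable_nat_ge => m; exact: measurable_restricted_ge. Qed.

(** A chain is finite and so meets only finitely many products of blocks. *)
Lemma multichain_random_multisetP m w :
  (exists2 s, multichain (increasing_step lep lem) (random_multiset M w) s & size s = m) <->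
  exists2 bl, uniq bl & (m <= L bl w)%N.
Proof.
split=> [[s [se sM] sz]|[bl ubl mL]].
  exists (undup [seq (block_of z.1, block_of z.2) | z <- s]); first exact: undup_uniq.
  set bl := undup _; have ubl : uniq bl by exact: undup_uniq.
  have [_ H] := lambda1_restrictedP M lep lem w ubl.
  rewrite -sz; apply: H; split => // z; rewrite /restricted_multiset mem_undup.
  case: ifPn => // zs; rewrite leqn0; apply/eqP/count_memPn; apply: contra zs.
  exact: (map_f (fun z => (block_of z.1, block_of z.2))).
have [s sM sz] := multichain_of_size (lambda1_restrictedP M lep lem w ubl) mL.
exists s => //; apply: multichain_sub sM => z; rewrite /restricted_multiset.
by case: ifP.
Qed.

Let H m := [set w | exists2 s, multichain (increasing_step lep lem) (random_multiset M w) s &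
    size s = m].

Lemma measurable_lambda1 : measurable_fun setT (fun w => lambda1 lep lem (random_multiset M w)).
Proof.
have mH m : measurable (H m).
  rewrite (_ : H m = [set w | exists2 bl, uniq bl & [set w | (m <= L bl w)%N] w]).
    by apply: countable_bigcup_measurable => bl ubl; exact: measurable_restricted_ge.
  by apply/seteqP; split=> w /= /multichain_random_multisetP.
have Hle m m' w : (m' <= m)%N -> H m w -> H m' w.
  move=> mm [s sM sz]; exists (drop (m - m') s); first exact: multichain_drop.
  by rewrite size_drop sz subKn.
apply: measurable_nat_ge => m; case: m => [|m]; first by rewrite (_ : [set w | _] = setT) //;
    apply/seteqP; split.
(* [lambda1] is 0 when chains are unbounded, so the configurations with chains of every length must
   be removed. *)
rewrite (_ : [set w | _] = H m.+1 `\` \bigcap_k H k).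
  by apply: measurableD => //; exact: bigcap_measurable.
apply/seteqP; split=> w /=.
  rewrite {1}/lambda1; case: xgetP => // l _ [[s sM sz] sl] ml; split.
    by apply: (Hle l) => //; exists s.
  move=> /(_ l.+1 I)[t tM tz]; have := sl t tM; by rewrite tz ltnn.
move=> [Hm nH].
have [k nHk] : exists k, ~ H k w by apply/existsNP => Hk; apply: nH => k _; exact: Hk.
have exN : exists k, `[< ~ H k w >] by exists k; apply/asboolP.
case: (ex_minnP exN) => -[|l] /asboolP nHl lmin.
  by exfalso; apply: nHl; apply: (Hle m.+1).
have Hl : H l w by apply: contrapT => nHl'; have := lmin l (asboolT nHl'); rewrite ltnn.
have -> : lambda1 lep lem (random_multiset M w) = l.
  apply: lambda1_maximal; split => // s sM; rewrite leqNgt; apply/negP => ls.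
  by apply: nHl; apply: (Hle (size s)) => //; exists s.
rewrite leqNgt ltnS; apply/negP => lm; apply: nHl; exact: (Hle m.+1).
Qed.

End Measurability.

Section LimitSide.
Variables (R : realType) (p : parameter_set R) (al be : R) (n : nat).
Hypotheses (al0 : 0 < al) (be0 : 0 < be).

Definition limit_side : R :=
  \prod_(i < n) ((1 + par_q p i / al) / (1 + par_q p i * be)) *
  \prod_(i < n) ((1 - par_r p i * be) / (1 - par_r p i / al)) *
  (expR (- (par_t p * be)) / expR (- (par_t p / al))).

Lemma cvg_side_product : side_product n N p al be @[N --> \oo] --> limit_side.
Proof.
apply: cvgM; first exact: cvg_cst.
have -> : (fun N => ((1 - par_t p / N.+1%:R * be) / (1 - par_t p / N.+1%:R / al)) ^+ N.+1) =
  (fun N => (1 - (par_t p * be) / N.+1%:R) ^+ N.+1 * ((1 - (par_t p / al) / N.+1%:R) ^+ N.+1)^-1).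
  by apply/funext => N; rewrite expr_div_n; congr (_ ^+ _ / _ ^+ _); congr (1 - _); rewrite
      mulrAC.
apply: cvgM; first by apply: cvg_expr_1B; rewrite mulr_ge0 ?par_t_ge0 // ltW.
apply: cvgV; first by rewrite gt_eqF // expR_gt0.
by apply: cvg_expr_1B; rewrite divr_ge0 ?par_t_ge0 // ltW.
Qed.

End LimitSide.

(** * The expectation for finitely many letters *)

Section TruncatedExpectation.
Variables (d : measure_display) (T : measurableType d) (R : realType) (P : probability T R)
  (pp pm : parameter_set R) (ap am : R) (M : extended_model P pp pm ap am) (n : nat)
  (lep lem : rel (Omega R)).
Hypotheses (hlep : admissible_order lep) (hlem : admissible_order lem).
Hypotheses (ap0 : 0 < ap) (am0 : 0 < am).
Hypotheses (qq : forall i j, par_q pp i * par_q pm j < 1) (rr : forall i j, par_r pp i * par_r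
    pm j < 1)
  (apr : forall j, ap * par_r pm j < 1) (ram : forall i, par_r pp i * am < 1)
  (rap : forall i, par_r pp i < ap) (rm_am : forall j, par_r pm j < am).

Local Notation Sp := (param_sum n pp ap).
Local Notation Sm := (param_sum n pm am).
Local Notation letter N := (letter n N).
Local Notation dot := (@dot_letter R n _).

Section LargeN.
Variable N : nat.
Hypotheses (N1 : Sp * Sm < N.+1%:R) (N2 : Sp / ap < N.+1%:R) (N3 : Sm / am < N.+1%:R).

Lemma cell_weight_lt1 (z : letter N * letter N) : z != (None, None) -> dot z.1 = dot z.2 ->
  cell_weight pp pm ap am z < 1.
Proof.
have [/strip_weight_le sz _ _|] := boolP (strip_cell z).
  apply: le_lt_trans (sz _ pp pm ap am ap0 am0) _.
  by rewrite ltr_pdivrMr ?ltr0n // mul1r.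
by case: z => -[[[i|i]|k]|] [[[j|j]|l]|] //= _ _ _; rewrite /cell_weight /=.
Qed.

(** On the axes the tilted weights are r_i / ap and r_j / am, which is where the lower bounds on
    [ap] and [am] enter; the strips are small because N is large. *)
Lemma tilted_weight_lt1 (z : letter N * letter N) : z != (None, None) -> dot z.1 = dot z.2 ->
  tilted_weight None None (@letter_param R n N pp ap) (@letter_param R n N pm am) z < 1.
Proof.
have strip p (al : R) (k : 'I_N.+1) : 0 < al -> param_sum n p al / al < N.+1%:R ->
    par_t p / N.+1%:R / al < 1.
  move=> al0 lt; rewrite mulrAC ltr_pdivrMr ?ltr0n // mul1r; apply: le_lt_trans lt.
  rewrite ler_pM2r ?invr_gt0 //.
  by rewrite /param_sum addrA lerDr addr_ge0 ?(ltW al0) // addr_ge0 // sumr_ge0 // => i _;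
    [exact: par_q_ge0|exact: par_r_ge0].
case: z => x y zr dxy; rewrite /tilted_weight /=; case: eqP => [y0|_].
  rewrite y0 in zr dxy *; case: x zr dxy => [[[i|i]|k]|] //= _ _.
    by rewrite ltr_pdivrMr // mul1r.
  exact: strip.
case: eqP => [x0|_]; last exact: (cell_weight_lt1 zr).
rewrite x0 in zr dxy *; case: y zr dxy => [[[i|i]|k]|] //= _ _.
  by rewrite ltr_pdivrMr // mul1r.
exact: strip.
Qed.

End LargeN.

Local Notation x := (ap * am)^-1.
Local Notation y := (Num.max 1 x ^+ 2).

(** Besides the two error terms, the sum contains the thresholds of the three largeness conditions
    on N, so that [total_error < N.+1%:R] implies them all. *)
Definition total_error : R :=
  discretization_error pp pm ap am n * y + strip_bound pp pm ap am n + Sp * Sm + Sp / ap + Sm /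
      am.

(** A forbidden pattern has one or two points and c >= 1, so c^2 covers both cases. *)
Lemma forbidden_growth N (h : {ffun letter N * letter N -> nat} -> R) (c : R) : 1 <= c ->
  (forall e, 0 <= h e) ->
  (forall e z, h (add_config e (unit_config z)) <= c * h e) ->
  forall e u, u \in forbidden n N lep lem -> h (add_config e u) <= c ^+ 2 * h e.
Proof.
move=> c1 h0 hu e u.
have one z : h (add_config e (unit_config z)) <= c ^+ 2 * h e.
  apply: (le_trans (hu e z)); rewrite ler_wpM2r // expr2 ler_peMl //.
  exact: le_trans c1.
have two z z' : h (add_config e (add_config (unit_config z) (unit_config z'))) <= c ^+ 2 * h e.
  have -> : add_config e (add_config (unit_config z) (unit_config z')) =
     add_config (add_config e (unit_config z)) (unit_config z').
    by apply/ffunP => v; rewrite !ffunE addnA.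
  apply: (le_trans (hu _ z')); rewrite expr2 -mulrA ler_wpM2l //.
  exact: le_trans c1.
rewrite !mem_cat => /or4P[] /mapP[v _ ->]; [exact: two|exact: two|exact: one|exact: one].
Qed.

Lemma truncated_bounds N : total_error < N.+1%:R ->
  let r := side_product n N pp ap am * side_product n N pm am ap in
  let del := total_error / N.+1%:R in
  let D := [set w | simple_config lep lem (cell_config M n N w)] in
  [/\ ((((1 - del) ^+ 2 * r)%:E <=
       \int[P]_(w in D) ((ap * am) ^- lambda1 lep lem (truncated_multiset M n w))%:E)%E /\
      (\int[P]_(w in D) ((ap * am) ^- lambda1 lep lem (truncated_multiset M n w))%:E
        <= ((1 - del)^-1 * r)%:E)%E) &
      (((1 - del) ^+ 2)%:E <= P D)%E].
Proof.
move=> tN r del D.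
have Sp0 := param_sum_gt0 n pp ap0; have Sm0 := param_sum_gt0 n pm am0.
have N0 : 0 < N.+1%:R :> R by rewrite ltr0n.
have y1 : 1 <= y by rewrite expr_ge1 // ?le_max ?lexx // (le_trans ler01) // le_max lexx.
have y0 : 0 <= y := le_trans ler01 y1.
have de0 : 0 <= discretization_error pp pm ap am n.
  by rewrite /discretization_error !addr_ge0 ?mulr_ge0 ?exprn_ge0 ?par_t_ge0 ?(ltW Sp0) ?(ltW
      Sm0).
have sb0 : 0 <= strip_bound pp pm ap am n by rewrite exprn_ge0 // mulr_ge0 // ltW.
have t1 : 0 <= Sp * Sm by rewrite mulr_ge0 // ltW.
have t2 : 0 <= Sp / ap by rewrite divr_ge0 // ltW.
have t3 : 0 <= Sm / am by rewrite divr_ge0 // ltW.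
have dey0 : 0 <= discretization_error pp pm ap am n * y by rewrite mulr_ge0.
have [N1 N2 N3] : [/\ Sp * Sm < N.+1%:R, Sp / ap < N.+1%:R & Sm / am < N.+1%:R].
  by split; apply: le_lt_trans tN; rewrite /total_error; lra.
have s1 := cell_weight_lt1 N1; have tw1 := tilted_weight_lt1 N1 N2 N3.
set k := config_constant pp pm ap am n N.
pose F1 := \prod_z cell_sum (@dot_letter R n N) (@dot_letter R n N) None None
  (@cell_weight R pp pm ap am n N) z.
pose F := \prod_z cell_sum (@dot_letter R n N) (@dot_letter R n N) None None
  (tilted_weight None None (@letter_param R n N pp ap) (@letter_param R n N pm am)) z.
have FE : F = r * F1 := prod_cell_sum_ratio ap0 am0 s1.
have rho_ge : 1 - strip_bound pp pm ap am n / N.+1%:R <= k * F1 :=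
  config_constant_sum_ge ap0 am0 s1 (ltW N1).
set eps := forbidden_weight pp pm ap am n N lep lem.
have eps_le : eps <= discretization_error pp pm ap am n / N.+1%:R := @forbidden_weight_le R pp
    pm ap am n N lep lem hlep hlem ap0 am0.
have eps0 : 0 <= eps.
  apply: sumr_ge0 => e _; apply: config_weight_ge0 => z; exact: cell_weight_ge0.
have del0 : 0 <= del by rewrite divr_ge0 // /total_error !addr_ge0.
have del1 : del < 1 by rewrite ltr_pdivrMr // mul1r.
have dE (c : R) : c <= total_error -> c / N.+1%:R <= del by move=> ct; rewrite ler_pM2r ?invr_gt0.
have epsy : eps * y <= del.
  apply: (@le_trans _ _ (discretization_error pp pm ap am n / N.+1%:R * y)); first by rewrite
      ler_wpM2r.
  by rewrite mulrAC; apply: dE; rewrite /total_error; lra.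
have epsd : eps <= del by apply: le_trans epsy; rewrite ler_peMr.
have rhod : 1 - del <= k * F1.
  by apply: le_trans rho_ge; rewrite lerB //; apply: dE; rewrite /total_error; lra.
have [Lc LcP] := choice (fun c : {ffun letter N * letter N -> nat} => ex_config_maximal_length
  (grid_step (@le_letter R n N lep) (@le_letter R n N lem) (@dot_letter R n N) (@dot_letter R n
      N)) c).
pose h (c : {ffun letter N * letter N -> nat}) : R := (ap * am) ^- Lc c.
have x0 : 0 < x by rewrite invr_gt0 mulr_gt0.
have h0 c : 0 <= h c by rewrite invr_ge0 exprn_ge0 // mulr_ge0 // ltW.
have hE : {in D, (fun w => ((ap * am) ^- lambda1 lep lem (truncated_multiset M n w))%:E) =1
    (fun w => (h (cell_config M n N w))%:E)}.
  move=> w /set_mem Dw; congr ((_ ^- _)%:E).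
  exact: (maximal_length_uniq (simple_maximal_length hlep hlem Dw) (LcP _)).
have ltr : transitive (grid_step (@le_letter R n N lep) (@le_letter R n N lem)
    (@dot_letter R n N) (@dot_letter R n N)).
  apply: grid_step_trans; first [exact: le_letter_anti|exact: le_letter_trans].
have hgrow c e : e \in forbidden n N lep lem -> h (add_config c e) <= y * h c.
  apply: (forbidden_growth _ h0); first by rewrite le_max lexx.
  by move=> {}e z; rewrite /h -!exprVn; apply: (expr_length_unit ltr LcP).
have hF : (\esum_(c in [set c | valid (@dot_letter R n N) (@dot_letter R n N) None None c])
   (config_weight (@cell_weight R pp pm ap am n N) c * h c)%:E = F%:E)%E.
  exact: (burke_sum (dA := @dot_letter R n N) (dB := @dot_letter R n N) (sA := None) (sB := None)
    isT isT (le_letter_refl hlep) (le_letter_anti hlep) (le_letter_trans hlep)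
    (le_letter_total hlep) (fun _ => isT) (le_letter_refl hlem) (le_letter_anti hlem)
    (le_letter_trans hlem) (le_letter_total hlem) (fun _ => isT)
    (fun z => letter_param_ge0 pp z ap0) (fun z => letter_param_ge0 pm z am0) ap0 am0 LcP tw1).
have /andP[A1 A2] := simple_integral_bounds M ap0 am0 s1 h0 y0 hgrow hF.
have h1F : (\esum_(c in [set c | valid (@dot_letter R n N) (@dot_letter R n N) None None c])
   (config_weight (@cell_weight R pp pm ap am n N) c * 1)%:E = F1%:E)%E.
  rewrite -esum_valid //; last by move=> z; exact: cell_weight_ge0.
  by apply: eq_esum => c _; rewrite mulr1.
have h1grow (c e : {ffun letter N * letter N -> nat}) : e \in forbidden n N lep lem -> (1 : R)
    <= 1 * 1.
  by rewrite mulr1.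
have /andP[B1 _] := simple_integral_bounds M ap0 am0 s1 (h := fun=> 1) (fun=> ler01) ler01
  h1grow h1F.
have mD : measurable D.
  by apply: (measurable_countable_preimage (fun c => measurable_cell_config M c) (fun c =>
      simple_config lep lem c)).
rewrite integral_cst // mul1e mulr1 in B1.
have P1 : (P D <= 1)%E := probability_le1 P mD.
(* The upper bound on the constant: the simple configurations have probability at most 1. Together
   with [rhod] it confines k * F1 between 1 - del and 1 / (1 - eps). *)
have rho1 : k * ((1 - eps) * F1) <= 1 by rewrite -lee_fin; exact: le_trans B1 P1.
have F10 : 0 < F1 by apply: prodr_gt0 => z _; exact: csum_gt0.
have F0 : 0 <= F.
  apply: prodr_ge0 => z _; rewrite /cell_sum; case: eqP => // /eqP zr; case: ifPn => [_|].
    rewrite addr_ge0 // /tilted_weight; do 2?case: ifP => _;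
    by rewrite ?divr_ge0 ?mulr_ge0 ?letter_param_ge0 // ltW.
  by rewrite negbK => /eqP dz; rewrite invr_ge0 subr_ge0 ltW // tw1.
have r0 : 0 <= r by rewrite -(pmulr_lge0 _ F10) -FE.
have k0 : 0 < k := config_constant_gt0 ap0 am0 s1.
rewrite (eq_integral _ _ hE); split; last first.
  apply: le_trans B1; rewrite lee_fin expr2; apply: (@le_trans _ _ ((1 - eps) * (k * F1))).
    apply: ler_pM => //; lra.
  by rewrite mulrCA.
split.
  apply: le_trans A1; rewrite lee_fin FE.
  have -> : k * ((1 - eps * y) * (r * F1)) = ((1 - eps * y) * (k * F1)) * r by ring.
  rewrite ler_wpM2r // expr2; apply: ler_pM => //; lra.
apply: (le_trans A2); rewrite lee_fin FE mulrCA mulrC ler_wpM2r //.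
rewrite -[leRHS]mul1r ler_pdivlMr; last lra.
apply: le_trans rho1; rewrite mulrCA mulrC ler_wpM2r //; last lra.
by rewrite mulr_ge0 // ltW.
Qed.

Lemma truncated_expectation :
  (\int[P]_w ((ap * am) ^- lambda1 lep lem (truncated_multiset M n w))%:E =
   (limit_side pp ap am n * limit_side pm am ap n)%:E)%E.
Proof.
set K := total_error.
pose r N := side_product n N pp ap am * side_product n N pm am ap.
pose del N := K / N.+1%:R.
have cdel : del N @[N --> \oo] --> 0 := cvg_div_succ K.
have c1 : 1 - del N @[N --> \oo] --> (1 : R).
  by rewrite -[X in _ --> X]subr0; apply: cvgB => //; exact: cvg_cst.
have cr : r N @[N --> \oo] --> limit_side pp ap am n * limit_side pm am ap n.
  by apply: cvgM; exact: cvg_side_product.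
have csq : (1 - del N) ^+ 2 @[N --> \oo] --> (1 : R).
  by rewrite -[X in _ --> X]mulr1; apply: cvgM.
apply: (integral_squeeze (D := fun N => [set w | simple_config lep lem (cell_config M n N w)])
  (lo := fun N => (1 - del N) ^+ 2 * r N) (up := fun N => (1 - del N)^-1 * r N)
  (pr := fun N => (1 - del N) ^+ 2)) => //.
- have mL := measurable_restricted_length M hlep hlem (block_pairs_uniq n).
  by apply: (measurableT_comp (f := fun k : nat => (ap * am) ^- k)).
- by move=> w; rewrite invr_ge0 exprn_ge0 // mulr_ge0 // ltW.
- move=> N; apply: (measurable_countable_preimage (fun c => measurable_cell_config M c)
    (fun c => simple_config lep lem c)).
- near=> N.
  have KN : K < N.+1%:R by near: N; exact: near_succ_gt.
  have [[lo_le le_up] _] := truncated_bounds KN.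
  by apply/andP.
- near=> N.
  have KN : K < N.+1%:R by near: N; exact: near_succ_gt.
  by have [] := truncated_bounds KN.
- by rewrite -[X in _ --> X]mul1r; apply: cvgM.
- rewrite -[X in _ --> X]mul1r -[X in X * _]invr1; apply: cvgM => //.
  by apply: cvgV => //; rewrite oner_eq0.
Unshelve. all: by end_near. Qed.

End TruncatedExpectation.

(** * Euler products *)

Section EulerProduct.
Variables (R : realType) (p : parameter_set R).

Lemma par_sums_fin :
  (\sum_(0 <= i <oo) (par_q p i)%:E < +oo)%E /\ (\sum_(0 <= i <oo) (par_r p i)%:E < +oo)%E.
Proof.
have q0 : (0 <= \sum_(0 <= i <oo) (par_q p i)%:E)%E.
  by apply: nneseries_ge0 => i _ _; rewrite lee_fin par_q_ge0.
have r0 : (0 <= \sum_(0 <= i <oo) (par_r p i)%:E)%E.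
  by apply: nneseries_ge0 => i _ _; rewrite lee_fin par_r_ge0.
have := par_summable p; split; apply: le_lt_trans (par_summable p).
  by rewrite leeDl.
by rewrite leeDr.
Qed.

Lemma partial_sums_bounded (u : nat -> R) : (forall i, 0 <= u i) ->
  (\sum_(0 <= i <oo) (u i)%:E < +oo)%E ->
  exists2 C : R, 0 <= C & forall n, \sum_(i < n) u i <= C.
Proof.
move=> u0 fin; exists (fine (\sum_(0 <= i <oo) (u i)%:E)).
  by apply/fine_ge0/nneseries_ge0 => i _ _; rewrite lee_fin.
move=> n; rewrite -lee_fin fineK; last first.
  by rewrite ge0_fin_numE //; apply: nneseries_ge0 => i _ _; rewrite lee_fin.
rewrite -(big_mkord xpredT) -sumEFin.
by apply: nneseries_lim_ge => i _ _; rewrite lee_fin.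
Qed.

Lemma par_q_sums : exists2 C : R, 0 <= C & forall n, \sum_(i < n) par_q p i <= C.
Proof. apply: partial_sums_bounded par_sums_fin.1; exact: par_q_ge0. Qed.

Lemma par_r_sums : exists2 C : R, 0 <= C & forall n, \sum_(i < n) par_r p i <= C.
Proof. apply: partial_sums_bounded par_sums_fin.2; exact: par_r_ge0. Qed.

Lemma le_sum_term (u : nat -> R) (C : R) i : (forall i, 0 <= u i) ->
  (forall n, \sum_(i < n) u i <= C) -> u i <= C.
Proof.
move=> u0 /(_ i.+1); apply: le_trans; rewrite big_ord_recr /= lerDr.
by apply: sumr_ge0.
Qed.

Lemma le_par_Q i : par_q p i <= par_Q p.
Proof.
have [C _ Cq] := par_q_sums; apply: ub_le_sup; last by exists i.
exists C => _ [j _ <-]; apply: le_sum_term Cq; exact: par_q_ge0.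
Qed.

Lemma le_par_R i : par_r p i <= par_R p.
Proof.
have [C _ Cr] := par_r_sums; apply: ub_le_sup; last by exists i.
exists C => _ [j _ <-]; apply: le_sum_term Cr; exact: par_r_ge0.
Qed.

Lemma par_R_ge0 : 0 <= par_R p.
Proof. by apply: le_trans (le_par_R 0); exact: par_r_ge0. Qed.

Definition euler_product (z : R) (n : nat) : R :=
  \prod_(i < n) ((1 + z * par_q p i) / (1 - z * par_r p i)).

Variables (z : R).
Hypotheses (z0 : 0 <= z) (zR : z * par_R p < 1).

Let zr i : z * par_r p i < 1.
Proof. by apply: le_lt_trans zR; rewrite ler_wpM2l // le_par_R. Qed.

Let factor_ge1 i : 1 <= (1 + z * par_q p i) / (1 - z * par_r p i).
Proof.
have zq : 0 <= z * par_q p i by rewrite mulr_ge0 // par_q_ge0.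
have zr0 : 0 <= z * par_r p i by rewrite mulr_ge0 // par_r_ge0.
by rewrite ler_pdivlMr ?subr_gt0 // mul1r; lra.
Qed.

(** Both factors are bounded by 1 + u <= exp u, after writing 1 / (1 - v) = 1 + v / (1 - v) with v =
    z r_i; the denominator is bounded uniformly by means of R(p). The exponents are summable. *)
Let factor_le i : (1 + z * par_q p i) / (1 - z * par_r p i) <=
  expR (z * par_q p i + z / (1 - z * par_R p) * par_r p i).
Proof.
have zr0 : 0 <= z * par_r p i by rewrite mulr_ge0 // par_r_ge0.
rewrite expRD; apply: ler_pM.
- by rewrite addr_ge0 // mulr_ge0 // par_q_ge0.
- by rewrite invr_ge0 subr_ge0 ltW.
- exact: expR_ge1Dx.
apply: le_trans (expR_ge1Dx _).
have -> : (1 - z * par_r p i)^-1 = 1 + z * par_r p i / (1 - z * par_r p i).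
  by field; rewrite subr_eq0 eq_sym lt_eqF.
rewrite lerD2l mulrAC ler_wpM2r ?par_r_ge0 // ler_wpM2l // lef_pV2 ?posrE ?subr_gt0 //.
by rewrite lerB // ler_wpM2l // le_par_R.
Qed.

Lemma euler_product_ge1 n : 1 <= euler_product z n.
Proof.
rewrite /euler_product; elim: n => [|n IH]; first by rewrite big_ord0.
rewrite big_ord_recr /=; apply: le_trans IH _; rewrite ler_peMr //.
by apply: prodr_ge0 => i _; apply: le_trans (factor_ge1 i).
Qed.

Lemma nondecreasing_euler_product : nondecreasing_seq (euler_product z).
Proof.
apply/nondecreasing_seqP => n; rewrite /euler_product big_ord_recr /= ler_peMr //.
exact: le_trans (euler_product_ge1 n).
Qed.

Lemma is_cvg_euler_product : cvgn (euler_product z).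
Proof.
apply: nondecreasing_is_cvgn; first exact: nondecreasing_euler_product.
have [Cq Cq0 qC] := par_q_sums; have [Cr Cr0 rC] := par_r_sums.
exists (expR (z * Cq + z / (1 - z * par_R p) * Cr)) => _ [n _ <-].
apply: (@le_trans _ _ (\prod_(i < n) expR (z * par_q p i + z / (1 - z * par_R p) * par_r p i))).
  apply: ler_prod => i _; rewrite factor_le andbT; exact: le_trans (factor_ge1 i).
rewrite -expR_sum ler_expR big_split /= -!mulr_sumr.
apply: lerD; first by apply: ler_wpM2l (qC n).
by apply: ler_wpM2l (rC n); rewrite divr_ge0 // subr_ge0 ltW.
Qed.

Lemma par_E_gt0 : 0 < par_E z p.
Proof.
rewrite /par_E mulr_gt0 ?expR_gt0 //; apply: (lt_le_trans ltr01).
by apply: limr_ge; [exact: is_cvg_euler_product | apply: nearW => n; exact: euler_product_ge1].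
Qed.

Lemma cvg_par_E : expR (par_t p * z) * euler_product z n @[n --> \oo] --> par_E z p.
Proof. apply: cvgM; [exact: cvg_cst | exact: is_cvg_euler_product]. Qed.

End EulerProduct.

Lemma cvg_limit_side (R : realType) (p : parameter_set R) (al be : R) :
  0 < al -> 0 < be -> al^-1 * par_R p < 1 -> be * par_R p < 1 ->
  limit_side p al be n @[n --> \oo] --> par_E al^-1 p / par_E be p.
Proof.
move=> al0 be0 alR beR.
have ali0 : 0 <= al^-1 by rewrite invr_ge0 ltW.
have be0' := ltW be0.
have -> : (fun n => limit_side p al be n) = (fun n => (expR (par_t p * al^-1) * euler_product p
    al^-1 n) *
   (expR (par_t p * be) * euler_product p be n)^-1).
  apply/funext => n; rewrite /limit_side !expRN.
  have -> : \prod_(i < n) ((1 + par_q p i / al) / (1 + par_q p i * be)) *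
    \prod_(i < n) ((1 - par_r p i * be) / (1 - par_r p i / al)) =
    euler_product p al^-1 n / euler_product p be n.
    rewrite /euler_product -prodfV -!big_split /=; apply: eq_bigr => i _.
    by rewrite ![al^-1 * _]mulrC ![be * _]mulrC invf_div; ring.
  by rewrite invrK invfM; ring.
apply: cvgM; first exact: cvg_par_E.
by apply: cvgV; [rewrite gt_eqF // par_E_gt0 | exact: cvg_par_E].
Qed.

(** * Infinitely many letters *)

Section EventuallyConstant.
Variables (d : measure_display) (T : measurableType d) (R : realType) (P : probability T R).

(** The alternative matches the two regimes of the length factor: for [ap * am <= 1] it increases
    with the length, and monotone convergence applies off the null set; otherwise it is dominated by
    1. *)
Lemma cvg_integral_eventually_eq (f_ : nat -> T -> R) (f : T -> R) (N : set T) :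
  (forall n, measurable_fun setT (f_ n)) -> measurable_fun setT f ->
  (forall n w, 0 <= f_ n w) -> (forall w, 0 <= f w) ->
  measurable N -> P N = 0%E ->
  (forall w, ~ N w -> \forall n \near \oo, f_ n w = f w) ->
  (forall w, nondecreasing_seq (f_^~ w)) \/ (forall n w, f_ n w <= 1) ->
  (\int[P]_w (f_ n w)%:E)%E @[n --> \oo] --> (\int[P]_w (f w)%:E)%E.
Proof.
move=> mf_ mf f_0 f0 mN N0 ev mono.
have mfE n : measurable_fun setT (fun w => (f_ n w)%:E) by apply/measurable_EFinP.
have mfE' : measurable_fun setT (fun w => (f w)%:E) by apply/measurable_EFinP.
have cv w : ~ N w -> (f_ n w)%:E @[n --> \oo] --> (f w)%:E.
  by move=> /ev Nw; apply: cvg_near_cst; apply: filterS Nw => n ->.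
case: mono => [nd|le1].
  have cut (g : T -> R) : measurable_fun setT g -> (forall w, 0 <= g w) ->
      (\int[P]_w (g w)%:E = \int[P]_(w in setT `\` N) (g w)%:E)%E.
    move=> mg g0; apply: (ge0_negligible_integral mN measurableT) => //.
      by apply/measurable_EFinP.
    by move=> w _; rewrite lee_fin.
  rewrite cut // (eq_integral (fun w => limn (fun n => (f_ n w)%:E))); last first.
    by move=> w /set_mem[_ Nw]; apply/esym/cvg_lim => //; exact: cv.
  under eq_fun do rewrite cut //.
  apply: (cvg_monotone_convergence (measurableD measurableT mN)).
  - by move=> n; exact: measurable_funTS.
  - by move=> n w _; rewrite lee_fin.
  - by move=> w _ m m' mm'; rewrite lee_fin; exact: nd.
have [] := @dominated_convergence _ _ _ P setT measurableT (fun n w => (f_ n w)%:E)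
  (fun w => (f w)%:E) (cst 1%E) mfE mfE' _ _ _ => //.
- by exists N; split => // w /= /not_implyP[_ nc]; apply: contrapT => /cv.
- exact: finite_measure_integrable_cst.
- by apply: aeW => w n _; rewrite gee0_abs lee_fin.
Qed.

End EventuallyConstant.

(** * Almost every configuration is finite *)

Section BorelCantelli.
Variables (d : measure_display) (T : measurableType d) (R : realType) (P : probability T R)
  (pp pm : parameter_set R) (ap am : R) (M : extended_model P pp pm ap am).
Hypotheses (ap0 : 0 < ap) (am0 : 0 < am).

Lemma block_param_ge0 (p : parameter_set R) (al : R) a : 0 < al -> 0 <= block_param p al a.
Proof. by case: a => [|i|i|] /= al0; [exact: par_t_ge0|exact: par_q_ge0|exact: par_r_ge0|exact:
    ltW]. Qed.

Lemma sum_block_param (p : parameter_set R) (al : R) n :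
  \sum_(a <- small_blocks n) block_param p al a = param_sum n p al.
Proof.
have iotaE : iota 0 n = index_iota 0 n by rewrite /index_iota subn0.
rewrite /small_blocks big_cat big_cat !big_map !big_cons big_nil iotaE !big_mkord /= /param_sum.
by rewrite addr0 [_ + al]addrC -addrA; congr (_ + _); rewrite addrC.
Qed.

Lemma param_sum_bounded (p : parameter_set R) (al : R) : exists C : R, forall n, param_sum n p
    al <= C.
Proof.
have [Cq _ qC] := par_q_sums p; have [Cr _ rC] := par_r_sums p.
by exists (al + (Cq + Cr + par_t p)) => n; rewrite lerD2l lerD2r lerD.
Qed.

(** The probability of a nonzero value is 1 - exp(-s), s or s / (1 + s) for the three laws, never
    more than s. The bound is a product, whose sum over pairs of blocks factorizes. *)
Lemma prob_npoints_neq0 a b :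
  (P [set w | npoints M a b w <> 0%N] <= (block_param pp ap a * block_param pm am b)%:E)%E.
Proof.
have -> : [set w | npoints M a b w <> 0%N] = ~` [set w | npoints M a b w = 0%N] by [].
have m0 : measurable [set w | npoints M a b w = 0%N].
  rewrite (_ : [set w | _] = setT `&` npoints M a b @^-1` [set 0%N]); last by rewrite setTI.
  exact: npoints_meas.
rewrite probability_setC // npoints_law -EFinB lee_fin.
have eb (s : R) : 1 - pmf_P s 0 <= s.
  rewrite /pmf_P expr0 mulr1 fact0 divr1; have := expR_ge1Dx (- s); lra.
have gb (s : R) : 1 - pmf_g s 0 <= s by rewrite /pmf_g expr0 mulr1; lra.
have bb (s : R) : 0 <= s -> 1 - pmf_b s 0 <= s.
  move=> s0; rewrite /pmf_b div1r -{1}(@divff _ (1 + s)); last by lra.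
  rewrite -{2}[(1 + s)^-1]mul1r -mulrBl addrAC subrr add0r ler_pdivrMr; last by lra.
  have := mulr_ge0 s0 s0; lra.
have pos (p : parameter_set R) (al : R) c : 0 < al -> 0 <= block_param p al c by exact:
    block_param_ge0.
have := mulr_ge0 (pos pp ap a ap0) (pos pm am b am0).
case: a {m0} => [|i|i|]; case: b => [|j|j|] //= s0; rewrite ?[am * _]mulrC;
  by [exact: eb | exact: gb | exact: bb | rewrite ?eqxx subrr].
Qed.

Let busy (k : nat) : set T :=
  if pickle_inv k is Some ab then [set w | npoints M (ab : block * block).1 ab.2 w <> 0%N] else
      set0.

Let busy_seq (m : nat) : seq (block * block) := pmap pickle_inv (iota 0 m).

Let index_bound (X : seq (block * block)) : exists n, {subset X <= block_pairs n}.
Proof.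
pose idx a := match a with BDot i | BPrime i => i.+1 | _ => 0%N end.
have idxP a n : (idx a <= n)%N -> a \in small_blocks n.
  by rewrite mem_small_blocks; case: a.
exists (\max_(ab <- X) maxn (idx ab.1) (idx ab.2)) => ab abX.
have := leq_bigmax_seq (P := xpredT) (F := fun ab : block * block => maxn (idx ab.1) (idx ab.2))
    ab abX isT.
by rewrite geq_max mem_block_pairs => /andP[/idxP -> /idxP ->].
Qed.

Let measurable_busy k : measurable (busy k).
Proof.
rewrite /busy; case: pickle_inv => // ab.
rewrite (_ : [set w | _] = setT `&` npoints M ab.1 ab.2 @^-1` [set k | k <> 0%N]); last by
    rewrite setTI.
exact: npoints_meas.
Qed.

(** The sum of the probabilities is bounded by the product of the two total parameter sums, so
    almost surely only finitely many products of blocks are occupied. Every truncation that contains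
    these is the whole multiset. *)
Lemma finitely_many_busy : exists N : set T, [/\ measurable N, P N = 0%E &
  forall w, ~ N w -> exists n0, forall n, (n0 <= n)%N -> truncated_multiset M n w =
      random_multiset M w].
Proof.
exists (lim_sup_set busy); split.
- by apply: bigcapT_measurable => k; apply: bigcup_measurable => j _.
- apply: lim_sup_set_cvg0 => //.
  have [Cp CpP] := param_sum_bounded pp ap; have [Cm CmP] := param_sum_bounded pm am.
  apply: (@le_lt_trans _ _ (Cp * Cm)%:E); last exact: ltry.
  apply: lime_le; first by apply: is_cvg_nneseries => k _ _.
  apply: nearW => m.
  have [n Xn] := index_bound (busy_seq m).
  have uX : uniq (busy_seq m) by apply: (pmap_uniq pickle_invK); exact: iota_uniq.
  apply: (@le_trans _ _ (\sum_(ab <- busy_seq m) (block_param pp ap ab.1 * block_param pm am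
      ab.2)%:E)%E).
    rewrite /busy_seq /index_iota subn0; elim: (iota 0 m) => [|k s IH]; first by rewrite !big_nil.
    rewrite big_cons /= {1}/busy; case: pickle_inv => [ab|] /=.
      by rewrite big_cons; apply: leeD IH; exact: prob_npoints_neq0.
    by rewrite measure0 add0e.
  rewrite sumEFin lee_fin.
  have w0 (ab : block * block) : 0 <= block_param pp ap ab.1 * block_param pm am ab.2.
    by rewrite mulr_ge0 // block_param_ge0.
  apply: (@le_trans _ _ (\sum_(ab <- block_pairs n) block_param pp ap ab.1 * block_param pm am
      ab.2)).
    have pf : perm_eq [seq ab <- block_pairs n | ab \in busy_seq m] (busy_seq m).
      apply: uniq_perm => //; first by rewrite filter_uniq // block_pairs_uniq.
      by move=> ab; rewrite mem_filter; case: (boolP (ab \in busy_seq m)) => // /Xn ->.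
    rewrite [leRHS](bigID (mem (busy_seq m))) -[leLHS]addr0 lerD ?sumr_ge0 //.
    by rewrite -[leRHS]big_filter (perm_big _ pf).
  rewrite big_allpairs_dep /= -big_distrlr /= !sum_block_param.
  by apply: ler_pM => //; apply: ltW; exact: param_sum_gt0.
- move=> w; rewrite /lim_sup_set => nw.
  have [k0 H] : exists k0, forall j, (k0 <= j)%N -> ~ busy j w.
    apply: contrapT => /forallNP nk; apply: nw => k0 _.
    have /existsNP[j /not_implyP[kj /contrapT bj]] := nk k0.
    by exists j.
  have [n0 Xn] := index_bound (busy_seq k0); exists n0 => n n0n.
  apply/funext => z; rewrite /truncated_multiset /restricted_multiset; case: ifPn => // zn.
  rewrite /random_multiset.
  have [E|/eqP ne] := eqVneq (npoints M (block_of z.1) (block_of z.2) w) 0%N.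
    by apply/esym/eqP/pred0P => -[k kE]; exfalso; move: kE; rewrite E.
  exfalso; move/negP: zn; apply.
  have zX : (block_of z.1, block_of z.2) \in busy_seq k0.
    have kz : (pickle (block_of z.1, block_of z.2) < k0)%N.
      rewrite ltnNge; apply/negP => /H; rewrite /busy pickleK_inv /=; exact.
    rewrite mem_pmap; apply/mapP; exists (pickle (block_of z.1, block_of z.2)).
      by rewrite mem_iota.
    by rewrite pickleK_inv.
  exact/(block_pairs_sub n0n)/Xn.
Qed.

End BorelCantelli.

Theorem theorem3p2 (R : realType) (pp pm : parameter_set R) (ap am : R)
    (lep lem : rel (Omega R))
    (d : measure_display) (T : measurableType d) (P : probability T R)
    (M : extended_model P pp pm ap am)
    (hcompat : compatible pp pm)
    (hap : par_R pp < ap) (hap' : (ap%:E < (par_R pm)%:E^-1)%E)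
    (ham : par_R pm < am) (ham' : (am%:E < (par_R pp)%:E^-1)%E)
    (hlep : admissible_order lep) (hlem : admissible_order lem) :
  ('E_P[fun w => (ap * am) ^- lambda1 lep lem (random_multiset M w)] =
   ((par_E ap pm)^-1 * (par_E am pp)^-1 *
    par_E ap^-1 pp * par_E am^-1 pm)%:E)%E.
Proof.
have ap0 : 0 < ap := le_lt_trans (par_R_ge0 pp) hap.
have am0 : 0 < am := le_lt_trans (par_R_ge0 pm) ham.
(* The inverse is taken in the extended reals, so for R(p) = 0 the bound is infinite and the product
   with z is 0. *)
have inv_lt (z : R) (p : parameter_set R) : (z%:E < (par_R p)%:E^-1)%E -> z * par_R p < 1.
  rewrite inver; case: eqP => [-> _|/eqP Rn0]; first by rewrite mulr0.
  have R0 : 0 < par_R p by rewrite lt_neqAle eq_sym Rn0 par_R_ge0.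
  by rewrite lte_fin -[_^-1]mul1r ltr_pdivlMr.
have apR := inv_lt _ _ hap'; have amR := inv_lt _ _ ham'.
have [hQ hR] := hcompat.
have apiR : ap^-1 * par_R pp < 1 by rewrite mulrC ltr_pdivrMr // mul1r.
have amiR : am^-1 * par_R pm < 1 by rewrite mulrC ltr_pdivrMr // mul1r.
have qq i j : par_q pp i * par_q pm j < 1.
  by apply: le_lt_trans hQ; apply: ler_pM; rewrite ?par_q_ge0 ?le_par_Q.
have rr i j : par_r pp i * par_r pm j < 1.
  by apply: le_lt_trans hR; apply: ler_pM; rewrite ?par_r_ge0 ?le_par_R.
have apr j : ap * par_r pm j < 1.
  by apply: le_lt_trans apR; rewrite ler_wpM2l ?le_par_R // ltW.
have ram i : par_r pp i * am < 1.
  by rewrite mulrC; apply: le_lt_trans amR; rewrite ler_wpM2l ?le_par_R // ltW.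
have rap i : par_r pp i < ap := le_lt_trans (le_par_R pp i) hap.
have rm_am j : par_r pm j < am := le_lt_trans (le_par_R pm j) ham.
have b0 : 0 < ap * am by rewrite mulr_gt0.
have [N [mN N0 NP]] := finitely_many_busy M ap0 am0.
rewrite unlock.
pose f_ n w : R := (ap * am) ^- lambda1 lep lem (truncated_multiset M n w).
have mpow (g : T -> nat) : measurable_fun setT g -> measurable_fun setT (fun w => (ap * am) ^- g
    w).
  by move=> mg; apply: (measurableT_comp (f := fun k : nat => (ap * am) ^- k)).
have cv : (\int[P]_w (f_ n w)%:E)%E @[n --> \oo] -->
    (\int[P]_w ((ap * am) ^- lambda1 lep lem (random_multiset M w))%:E)%E.
  apply: (cvg_integral_eventually_eq _ _ _ _ mN N0).
  - by move=> n; apply/mpow/measurable_restricted_length => //; exact: block_pairs_uniq.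
  - exact/mpow/measurable_lambda1.
  - by move=> n w; rewrite invr_ge0 exprn_ge0 // ltW.
  - by move=> w; rewrite invr_ge0 exprn_ge0 // ltW.
  - move=> w /NP[n0 n0P]; near=> n; rewrite /f_ n0P //; near: n; exact: nbhs_infty_ge.
  (* The truncated lengths increase with n, hence so does the length factor when its base (ap *
     am)^-1 is at least 1. *)
  - have [b1|b1] := leP (ap * am) 1; [left|right].
      move=> w m m' mm'; rewrite /f_ lef_pV2 ?posrE ?exprn_gt0 //.
      apply: ler_wiXn2l => //; first exact: ltW.
      apply: maximal_length_mono (lambda1_restrictedP M lep lem w (block_pairs_uniq m))
        (lambda1_restrictedP M lep lem w (block_pairs_uniq m')) => z.
      rewrite /restricted_multiset; case: ifP => //.
      by move=> /(block_pairs_sub mm') ->.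
    by move=> n w; rewrite invf_le1 ?exprn_gt0 // exprn_ege1 // ltW.
have cv' : (\int[P]_w (f_ n w)%:E)%E @[n --> \oo] -->
   ((par_E ap^-1 pp / par_E am pp) * (par_E am^-1 pm / par_E ap pm))%:E.
  under eq_fun do rewrite (truncated_expectation M _ hlep hlem ap0 am0 qq rr apr ram rap rm_am).
  by apply: cvg_EFin; [exact: nearW|apply: cvgM; exact: cvg_limit_side].
rewrite (cvg_unique _ cv cv') //; congr EFin; ring.
Unshelve. all: by end_near. Qed.
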